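(* There is an absolute constant $C_0>0$ such that the following holds. Assume: (a) $d\le n$ and $\eta_1 := C_0\sigma_x^2\sqrt{d/n}<\tfrac12$; (b) (large tail effective rank) $\eta_2:=C_0\sigma_x^2\sqrt{\frac{4n^2}{r_d(\Sigma)^2}+\frac{2n}{r_d(\Sigma)}}\le\frac12$; (c) (rotational sparsity) for some $0<\delta_2<1$, $\dfrac{\Vert\theta^*_{(d+1):p}\Vert^2_{\Sigma_{(d+1):p}}}{\Vert\theta^*_{1:d}\Vert^2_{\Sigma_{1:d}^{-1}}}\le \dfrac{\delta_2}{4(1+\sigma_x^2)}\Big(\dfrac1{\lambda_d}+\dfrac{4n}{\sum_{j>d}\lambda_j}\Big)^{-2}$. Let $$\kappa_2(\tau)=\max\Big\{1-\Big(16\,\tfrac{\lambda_{d+1}\frac{r_d(\Sigma)}{n}}{\tau+\lambda_{d+1}\frac{r_d(\Sigma)}{n}}\big(1+112\tfrac{\sqrt{\delta_2}}{1-\sqrt{\delta_2}}\big)+64\tfrac{\sqrt{\delta_2}}{1-\sqrt{\delta_2}}\Big),\,0\Big\}.$$ Then for any $\nu$ with $0<\nu<\frac14$ and $\frac{r_d(\Sigma)\nu^2}{C_0^2\sigma_x^4}>1$, and any $A_0>0$, there are constants $M_1,M_2>0$ depending only on $(\sigma_x,\eta_2,\delta_2,\nu,A_0)$ such that, with probability at least $$1-2n\exp\{-\tfrac{\nu\sqrt{r_d(\Sigma)}}{C_0\sigma_x^2}\}-2\exp\{-\tfrac{\nu^2 n}{C_0^2\sigma_x^4}\}-2\exp\{-\tfrac{\nu^2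 n}{C_0\sigma_x^4}\}-12\exp\{-\tfrac{n}{C_0}\},$$ the following inequalities hold uniformly over all $\tau\ge 0$ in the stated ranges: (i) for $\tau+\lambda_{d+1}\frac{r_d(\Sigma)}{n}\le A_0\lambda_d$: $$M_2\left(\Vert\theta^*_{1:d}\Vert^2_{\Sigma_{1:d}^{-1}}\Big(\tau+\lambda_{d+1}\tfrac{r_d(\Sigma)}{n}\Big)^2+\sigma^2\Big(\frac dn+\frac{\lambda_{d+1}^2}{(\tau+\lambda_{d+1}\frac{r_d(\Sigma)}{n})^2}\frac{r_d^2(\Sigma)}{n^2}\Big)\right)\ge\mathrm{MSE}_{\mathrm{in}}$$ $$\ge M_1\left(\kappa_2(\tau)\Vert\theta^*_{1:d}\Vert^2_{\Sigma_{1:d}^{-1}}\Big(\tau+\lambda_{d+1}\tfrac{r_d(\Sigma)}{n}\Big)^2+\sigma^2\Big(\frac dn+\frac{\lambda_{d+1}^2}{(\tau+\lambda_{d+1}\frac{r_d(\Sigma)}{n})^2}\frac{r_d^2(\Sigma)}{n^2}\Big)\right);$$ (ii) for $\tau+\lambda_{d+1}\frac{r_d(\Sigma)}{n}\ge A_0\lambda_d$: $$\mathrm{MSE}_{\mathrm{in}}\ge M_1\left(\kappa_2(\tau)\Vert\theta^*_{1:d}\Vert^2_{\Sigma_{1:d}^{-1}}\lambda_d^2+\sigma^2\frac{\lambda_{d+1}^2}{(\tau+\lambda_{d+1}\frac{r_d(\Sigma)}{n})^2}\frac{r_d^2(\Sigma)}{n^2}\right).$$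
   Context: Let $n\ge 1$ and $1\le d<p$ be integers. The data $(y_1,x_1),\dots,(y_n,x_n)$ are i.i.d. from the model $y_i=x_i^\top\theta^*+\epsilon_i$, where $\theta^*\in\mathbb R^p$, $x_i\in\mathbb R^p$ is random with $E(x_i)=0$, $\mathrm{Var}(x_i)=\Sigma$ non-singular, and $\epsilon_i\in\mathbb R$ is independent of $x_i$ with $E(\epsilon_i)=0$, $\mathrm{Var}(\epsilon_i)=\sigma^2$. Throughout, $\Sigma=\mathrm{Diag}(\lambda_1,\dots,\lambda_p)$ with $\lambda_1\ge\dots\ge\lambda_p>0$. The vector $\Sigma^{-1/2}x_i$ is sub-gaussian with sub-gaussian norm $\sigma_x$; here a real random variable $z$ has norm $\Vert z\Vert_{\psi_2}=\inf\{t>0: E\exp(z^2/t^2)\le 2\}$ and a random vector $Z$ has norm $\sup_{s\ne 0}\Vert\langle s,Z\rangle/\Vert s\Vert\,\Vert_{\psi_2}$. $Y=(y_1,\dots,y_n)^\top$, $X=(x_1,\dots,x_n)^\top\in\mathbb R^{n\times p}$, $\hat\Sigma=X^\top X/n$. For $\tau>0$ the ridge estimator is $\hat\theta(\tau)=\arg\min_\theta\{\frac1n\Vert Y-X\theta\Vert^2+\tau\Vert\theta\Vert^2\}=X^\top(XX^\top+n\tau I_n)^{-1}Y$, and $\hat\theta(0)=\lim_{\tau\to0+}\hat\theta(\tau)$ (the min-norm interpolator). For positive semi-definite $M$, $\Vert b\Vert_M=(b^\top Mb)^{1/2}$. The in-sample error is $\mathrm{MSE}_{\mathrm{in}}=E[\frac1n\Vert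 X(\hat\theta(\tau)-\theta^* )\Vert^2\mid X]=E[\Vert\hat\theta(\tau)-\theta^*\Vert_{\hat\Sigma}^2\mid X]$, a function of $X$ and $\tau$. $\theta^*_{1:d}$ and $\theta^*_{(d+1):p}$ are the first $d$ and last $p-d$ entries of $\theta^*$; $\Sigma_{1:d}=\mathrm{Diag}(\lambda_1,\dots,\lambda_d)$, $\Sigma_{(d+1):p}=\mathrm{Diag}(\lambda_{d+1},\dots,\lambda_p)$. Tail effective rank: $r_d(\Sigma)=\frac{\sum_{j>d}\lambda_j}{\lambda_{d+1}}$; $r_d^2(\Sigma)=(r_d(\Sigma))^2$. *)

(* Defs.v *)
From mathcomp Require Import all_boot all_order all_algebra.
From mathcomp Require Import all_classical all_reals all_analysis.
From mathcomp Require Import ring.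

Set Implicit Arguments.
Unset Strict Implicit.
Unset Printing Implicit Defensive.
Import Order.TTheory GRing.Theory Num.Theory.
Import numFieldNormedType.Exports.
Local Open Scope classical_set_scope.
Local Open Scope ring_scope.

Definition mxnorm (R : realType) (k : nat) (M : 'M[R]_k) (b : 'cV[R]_k) : R :=
  Num.sqrt ((b^T *m M *m b) 0 0).

Definition enorm (R : realType) (k : nat) (b : 'cV[R]_k) : R := mxnorm 1%:M b.

(* Vectors of R^p are tuples, which carry the library's product sigma-algebra
   and are 0-indexed: the entry with 1-based index j is v`_j.-1. *)
Definition colt (R : realType) (p : nat) (v : p.-tuple R) : 'cV[R]_p :=
  \col_j tnth v j.

Definition headv (R : realType) (p : nat) (d : nat) (v : p.-tuple R) : 'cV[R]_d :=
  \col_(j < d) v`_j.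

Definition tailv (R : realType) (p : nat) (d : nat) (v : p.-tuple R) :
  'cV[R]_(p - d) := \col_(j < p - d) v`_(d + j).

Definition mxdiag_col (R : realType) (k : nat) (v : 'cV[R]_k) : 'M[R]_k :=
  diag_mx v^T.

Definition tail_rank (R : realType) (p : nat) (lambda : p.-tuple R) (d : nat) : R :=
  (\sum_(d <= j < p) lambda`_j) / lambda`_d.

Definition head_signal (R : realType) (p : nat) (lambda theta : p.-tuple R)
  (d : nat) : R :=
  mxnorm (invmx (mxdiag_col (headv d lambda))) (headv d theta) ^+ 2.

Definition tail_signal (R : realType) (p : nat) (lambda theta : p.-tuple R)
  (d : nat) : R :=
  mxnorm (mxdiag_col (tailv d lambda)) (tailv d theta) ^+ 2.

Definition eff_ridge (R : realType) (p : nat) (lambda : p.-tuple R) (d n : nat)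
  (tau : R) : R := tau + lambda`_d * (tail_rank lambda d / n%:R).

Definition kappa2 (R : realType) (p : nat) (lambda : p.-tuple R) (d n : nat)
  (delta2 tau : R) : R :=
  Num.max
    (1 - (16 * (lambda`_d * (tail_rank lambda d / n%:R)
                 / eff_ridge lambda d n tau)
             * (1 + 112 * (Num.sqrt delta2 / (1 - Num.sqrt delta2)))
          + 64 * (Num.sqrt delta2 / (1 - Num.sqrt delta2))))
    0.

Section ridge.
Variables (R : realType) (n p : nat).
Implicit Types (X : 'M[R]_(n, p)) (Y : 'cV[R]_n).

Definition ridge_objective X Y (tau : R) (theta : 'cV[R]_p) : R :=
  n%:R^-1 * enorm (Y - X *m theta) ^+ 2 + tau * enorm theta ^+ 2.

Definition ridge_pos X Y (tau : R) : 'cV[R]_p :=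
  X^T *m invmx (X *m X^T + (n%:R * tau)%:M) *m Y.

Definition ridge X Y (tau : R) : 'cV[R]_p :=
  if tau == 0 then lim (ridge_pos X Y t @[t --> 0^'+]) else ridge_pos X Y tau.

Lemma enorm_sq (k : nat) (b : 'cV[R]_k) : enorm b ^+ 2 = \sum_i b i 0 ^+ 2.
Proof.
rewrite /enorm /mxnorm mulmx1 mxE.
under eq_bigr do rewrite mxE -expr2.
by rewrite sqr_sqrtr// sumr_ge0// => i _; rewrite sqr_ge0.
Qed.

Lemma enorm_sqE (k : nat) (b : 'cV[R]_k) : enorm b ^+ 2 = (b^T *m b) 0 0.
Proof. by rewrite enorm_sq mxE; apply: eq_bigr => i _; rewrite mxE expr2. Qed.

Lemma enorm_sq_eq0 (k : nat) (b : 'cV[R]_k) : enorm b ^+ 2 = 0 -> b = 0.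
Proof.
rewrite enorm_sq => /eqP; rewrite psumr_eq0; last by move=> i _; rewrite sqr_ge0.
move=> /allP b0; apply/matrixP => i j; rewrite ord1 mxE.
by have := b0 i (mem_index_enum i); rewrite sqrf_eq0 => /eqP.
Qed.

Lemma enorm_sqD (k : nat) (a b : 'cV[R]_k) :
  enorm (a + b) ^+ 2 = enorm a ^+ 2 + 2 * (a^T *m b) 0 0 + enorm b ^+ 2.
Proof.
rewrite !enorm_sq mxE mulr_sumr -!big_split/=; apply: eq_bigr => i _.
by rewrite !mxE sqrrD mulr_natl.
Qed.

Lemma gram_unit X (tau : R) : (0 < n)%N -> 0 < tau ->
  X *m X^T + (n%:R * tau)%:M \in unitmx.
Proof.
move=> n0 tau0; rewrite -row_free_unit; apply: inj_row_free => v vG.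
have nt : 0 < n%:R * tau by rewrite mulr_gt0// ltr0n.
have : (v *m (X *m X^T + (n%:R * tau)%:M) *m v^T) 0 0 = 0.
  by rewrite vG mul0mx mxE.
rewrite mulmxDr mulmxDl mul_mx_scalar -scalemxAl.
have -> : v *m (X *m X^T) *m v^T = (X^T *m v^T)^T *m (X^T *m v^T).
  by rewrite trmx_mul !trmxK !mulmxA.
have -> : v *m v^T = v^T^T *m v^T by rewrite trmxK.
rewrite mxE [X in _ + X]mxE -!enorm_sqE => /eqP.
rewrite paddr_eq0; last by rewrite mulr_ge0 ?sqr_ge0 ?(ltW nt).
  2: exact: sqr_ge0.
rewrite (mulf_eq0 (n%:R * tau)) (gt_eqF nt)/= => /andP[_ /eqP/enorm_sq_eq0 v0].
by rewrite -[v]trmxK v0 trmx0.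
Qed.

Lemma ridge_argmin X Y (tau : R) : (0 < n)%N -> 0 < tau ->
  forall theta, theta != ridge X Y tau ->
  ridge_objective X Y tau (ridge X Y tau) < ridge_objective X Y tau theta.
Proof.
move=> n0 tau0 theta thetaN.
rewrite /ridge (gt_eqF tau0) in thetaN *.
set t0 := ridge_pos X Y tau in thetaN *; pose h := theta - t0.
have -> : theta = t0 + h by rewrite /h addrC subrK.
have nR : n%:R != 0 :> R by rewrite pnatr_eq0 -lt0n.
have U := gram_unit X n0 tau0.
pose u := invmx (X *m X^T + (n%:R * tau)%:M) *m Y.
have t0E : t0 = X^T *m u by rewrite /t0 /ridge_pos /u mulmxA.
have YE : Y - X *m t0 = (n%:R * tau) *: u.
  have -> : Y = (X *m X^T + (n%:R * tau)%:M) *m u by rewrite /u mulKVmx.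
  by rewrite t0E mulmxDl mul_scalar_mx mulmxA addrAC subrr add0r.
rewrite /ridge_objective mulmxDr opprD addrA.
rewrite (enorm_sqD (Y - X *m t0)) (enorm_sqD t0) YE.
have -> : enorm (- (X *m h)) ^+ 2 = enorm (X *m h) ^+ 2.
  by rewrite !enorm_sq; apply: eq_bigr => i _; rewrite mxE sqrrN.
have -> : ((((n%:R * tau) *: u)^T) *m (- (X *m h))) 0 0
    = - (n%:R * tau * (t0^T *m h) 0 0).
  rewrite t0E trmx_mul trmxK linearZ/= mulmxN -scalemxAl mulmxA mxE.
  by rewrite [X in - X]mxE.
set A := enorm _ ^+ 2; set B := (t0^T *m h) 0 0.
set C := enorm (X *m h) ^+ 2; set D := enorm t0 ^+ 2; set E := enorm h ^+ 2.
have E0 : 0 < E.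
  rewrite lt0r sqr_ge0 andbT; apply: contraNneq thetaN => /enorm_sq_eq0 /eqP.
  by rewrite subr_eq0.
have C0 : 0 <= n%:R^-1 * C by rewrite mulr_ge0 ?sqr_ge0// invr_ge0.
rewrite -subr_gt0.
have -> : n%:R^-1 * (A + 2 * - (n%:R * tau * B) + C) + tau * (D + 2 * B + E) -
  (n%:R^-1 * A + tau * D) = n%:R^-1 * C + tau * E.
  by field.
by rewrite ltr_wpDl// mulr_gt0.
Qed.
End ridge.


Definition psi2_norm (dT : measure_display) (T : measurableType dT)
  (R : realType) (P : probability T R) (z : T -> R) : \bar R :=
  ereal_inf [set t%:E | t in
    [set t : R | 0 < t /\
       ('E_P[fun w => expR (z w ^+ 2 / t ^+ 2)] <= 2%:E)%E]].

Definition psi2_vnorm (dT : measure_display) (T : measurableType dT)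
  (R : realType) (P : probability T R) (p : nat) (Z : T -> 'cV[R]_p) : \bar R :=
  ereal_sup [set psi2_norm P (fun w => (s^T *m Z w) 0 0 / enorm s) | s in
    [set s : 'cV[R]_p | s != 0]].

Definition independent2 (dT dS dU : measure_display) (T : measurableType dT)
  (S : measurableType dS) (U : measurableType dU) (R : realType)
  (P : probability T R) (f : T -> S) (g : T -> U) : Prop :=
  forall (A : set S) (B : set U), measurable A -> measurable B ->
    P (f @^-1` A `&` g @^-1` B) = (P (f @^-1` A) * P (g @^-1` B))%E.

(* The product rule for subfamilies is the case B i = setT off the subfamily. *)
Definition iid (dT dS : measure_display) (T : measurableType dT)
  (S : measurableType dS) (R : realType) (P : probability T R) (n : nat)
  (Z : 'I_n -> T -> S) : Prop :=
  (forall (i j : 'I_n) (B : set S), measurable B ->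
     P (Z i @^-1` B) = P (Z j @^-1` B)) /\
  (forall B : 'I_n -> set S, (forall i, measurable (B i)) ->
     P (\bigcap_(i in [set: 'I_n]) (Z i @^-1` B i)) =
     (\prod_(i < n) P (Z i @^-1` B i))%E).

(* g is a version of E[f | G], for G a sub-sigma-algebra. *)
Definition cond_expectation (dT : measure_display) (T : measurableType dT)
  (R : realType) (P : probability T R) (G : set (set T)) (f g : T -> R) : Prop :=
  [/\ forall B : set R, measurable B -> G (g @^-1` B),
      P.-integrable setT (EFin \o g)
    & forall A : set T, G A ->
        (\int[P]_(w in A) (g w)%:E = \int[P]_(w in A) (f w)%:E)%E].

Definition design (T : Type) (R : realType) (n p : nat)
  (x : 'I_n -> T -> p.-tuple R) (w : T) : 'M[R]_(n, p) :=
  \matrix_(i, j) tnth (x i w) j.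

Definition response (T : Type) (R : realType) (n : nat) (y : 'I_n -> T -> R)
  (w : T) : 'cV[R]_n := \col_i y i w.

Definition insample_loss (T : Type) (R : realType) (n p : nat)
  (x : 'I_n -> T -> p.-tuple R) (y : 'I_n -> T -> R) (theta : p.-tuple R)
  (tau : R) (w : T) : R :=
  n%:R^-1 * enorm (design x w *m
    (ridge (design x w) (response y w) tau - colt theta)) ^+ 2.

(* Conditional expectations are only determined almost surely for each tau
   separately; a statement uniform in tau needs the version whose paths are
   continuous in tau, which is unique up to a null set not depending on tau. *)
Definition is_MSE_in (dT : measure_display) (T : measurableType dT)
  (R : realType) (P : probability T R) (n p : nat)
  (x : 'I_n -> T -> p.-tuple R) (y : 'I_n -> T -> R) (theta : p.-tuple R)
  (mse : R -> T -> R) : Prop :=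
  (forall tau, 0 <= tau ->
     cond_expectation P (g_sigma_preimage x) (insample_loss x y theta tau)
       (mse tau)) /\
  (forall w, {within `[0, +oo[, continuous (fun tau => mse tau w)}).

(* Main.v *)
(* For [tau > 0] let [s = tau + t] with [t] the tail trace over [n]. Conditionally
   on the design, the risk is the explicit sum of a squared bias and of
   [sigma^2] times a squared Frobenius norm of the smoother
   [G (G + n tau)^-1], where [G = Z diag(l) Z^T + X2 X2^T] separates the [d]
   whitened head columns from the tail columns. Four events suffice to bound it
   for all [tau] at once: [Z / sqrt n] is a near-isometry (net argument),
   [|X2|^2 <= K n t], [|X2|_F^2 >= n^2 t / 2], and the tail signal seen through
   the design is of its expected order. On them [G] is of order at least [n l] on
   the range of [Z] and at most [K n t] off it, so the tail acts as the extra
   ridge penalty [t]. The conditional expectation is identified almost surely for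
   rational [tau] only; continuity in [tau] then gives all [tau >= 0], and in
   particular [tau = 0], without any analysis of the interpolator. *)

From HB Require Import structures.
Require Import Defs.
From mathcomp Require Import all_boot all_order all_algebra.
From mathcomp Require Import all_classical all_reals all_analysis.
From mathcomp Require Import measurable_realfun.
From mathcomp Require Import ring lra zify.
Set Implicit Arguments.
Unset Strict Implicit.
Unset Printing Implicit Defensive.
Import Order.TTheory GRing.Theory Num.Theory.
Import numFieldNormedType.Exports.
Local Open Scope classical_set_scope.
Local Open Scope ring_scope.

(** * Norms and the ridge smoother *)

(** The constants may involve neither [p] nor the spread of the head eigenvalues, and this shapes
    the estimates. The whitened head signal [v] enters the fit as [Z diag(l) v]; in the upper bound
    on the bias diag(l) counts only as a positive form, and the isometry of [Z] does the rest. For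
    the tail, (b) yields that [n] times the first tail eigenvalue is at most the tail trace, which
    replaces any count of tail columns. The tail signal is a perturbation [f] of the fit. Condition
    (c) makes [f] small against both [t] and the last head eigenvalue: the upper bound uses the
    first, the lower bound the second, where [kappa2 > 0] supplies [t <= tau] and a small [delta2].
    Lower bounds on the Frobenius norm of the smoother pass through traces and Cauchy-Schwarz,
    because its quadratic form is monotone in the Gram matrix. The whole failure probability is
    charged to 2 exp(-nu^2 n / (C0^2 sx^4)): if that term reaches 1 the claim is empty, and
    otherwise [C0 >= 300] lets (a) pay for a net of the head space. *)

Section euclidean.
Variable R : realType.

Definition dotv k (a b : 'cV[R]_k) : R := (a^T *m b) 0 0.

Lemma dotvE k (a b : 'cV[R]_k) : dotv a b = \sum_i a i 0 * b i 0.
Proof. by rewrite /dotv mxE; apply: eq_bigr => i _; rewrite mxE. Qed.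

Lemma dotvC k (a b : 'cV[R]_k) : dotv a b = dotv b a.
Proof. by rewrite !dotvE; apply: eq_bigr => i _; rewrite mulrC. Qed.

Lemma dotvDl k (a b c : 'cV[R]_k) : dotv (a + b) c = dotv a c + dotv b c.
Proof. by rewrite /dotv linearD mulmxDl mxE. Qed.

Lemma dotvDr k (a b c : 'cV[R]_k) : dotv a (b + c) = dotv a b + dotv a c.
Proof. by rewrite /dotv mulmxDr mxE. Qed.

Lemma dotvZl k (x : R) (a b : 'cV[R]_k) : dotv (x *: a) b = x * dotv a b.
Proof. by rewrite /dotv linearZ/= -scalemxAl mxE. Qed.

Lemma dotvZr k (x : R) (a b : 'cV[R]_k) : dotv a (x *: b) = x * dotv a b.
Proof. by rewrite /dotv -scalemxAr mxE. Qed.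

Lemma dotvBl k (a b c : 'cV[R]_k) : dotv (a - b) c = dotv a c - dotv b c.
Proof. by rewrite -scaleN1r dotvDl dotvZl mulN1r. Qed.

Lemma dotvBr k (a b c : 'cV[R]_k) : dotv a (b - c) = dotv a b - dotv a c.
Proof. by rewrite -scaleN1r dotvDr dotvZr mulN1r. Qed.

Lemma dotvv k (a : 'cV[R]_k) : dotv a a = enorm a ^+ 2.
Proof. by rewrite enorm_sqE. Qed.

Lemma dotv_mul m k (A : 'M[R]_(m, k)) (a : 'cV[R]_k) (b : 'cV[R]_m) :
  dotv (A *m a) b = dotv a (A^T *m b).
Proof. by rewrite /dotv trmx_mul mulmxA. Qed.

Lemma dotv_mulT m k (A : 'M[R]_(m, k)) (a : 'cV[R]_k) (b : 'cV[R]_m) :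
  dotv (A^T *m b) a = dotv b (A *m a).
Proof. by rewrite dotv_mul trmxK. Qed.

Lemma enorm_ge0 k (a : 'cV[R]_k) : 0 <= enorm a.
Proof. exact: sqrtr_ge0. Qed.

Lemma enorm0 k : enorm (0 : 'cV[R]_k) = 0.
Proof. by rewrite /enorm /mxnorm mulmx0 mxE sqrtr0. Qed.

Lemma enormZ k (x : R) (a : 'cV[R]_k) : enorm (x *: a) = `|x| * enorm a.
Proof.
apply/eqP; rewrite -(@eqrXn2 _ 2) ?mulr_ge0 ?enorm_ge0//.
by rewrite -dotvv dotvZl dotvZr dotvv exprMn -normrX ger0_norm ?sqr_ge0// mulrA -expr2.
Qed.

Lemma enormN k (a : 'cV[R]_k) : enorm (- a) = enorm a.
Proof. by rewrite -scaleN1r enormZ normrN1 mul1r. Qed.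

Lemma dotv_le k (a b : 'cV[R]_k) : dotv a b <= enorm a * enorm b.
Proof.
have [b0|b0] := eqVneq (enorm b) 0.
  have -> : b = 0 by apply: enorm_sq_eq0; rewrite b0 expr0n.
  by rewrite enorm0 mulr0 /dotv mulmx0 mxE.
have [a0|a0] := eqVneq (enorm a) 0.
  have -> : a = 0 by apply: enorm_sq_eq0; rewrite a0 expr0n.
  by rewrite enorm0 mul0r dotvC /dotv mulmx0 mxE.
have ap : 0 < enorm a by rewrite lt0r a0 enorm_ge0.
have bp : 0 < enorm b by rewrite lt0r b0 enorm_ge0.
have := sqr_ge0 (enorm (enorm b *: a - enorm a *: b)).
rewrite -dotvv dotvBl !dotvBr !dotvZl !dotvZr !dotvv (dotvC b a) => H.
have : 0 <= 2 * (enorm a * enorm b) * (enorm a * enorm b - dotv a b) by lra.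
by rewrite pmulr_rge0 ?subr_ge0// !mulr_gt0.
Qed.

Lemma dotv_normle k (a b : 'cV[R]_k) : `|dotv a b| <= enorm a * enorm b.
Proof.
rewrite ler_norml dotv_le andbT lerNl.
by rewrite -mulN1r -dotvZl (le_trans (dotv_le _ _))// scaleN1r enormN.
Qed.

Lemma enormD k (a b : 'cV[R]_k) : enorm (a + b) <= enorm a + enorm b.
Proof.
rewrite -(@ler_pXn2r _ 2) ?nnegrE ?addr_ge0 ?enorm_ge0//.
rewrite -dotvv dotvDl !dotvDr !dotvv (dotvC b a).
by have := dotv_le a b; lra.
Qed.

Lemma enormB k (a b : 'cV[R]_k) : enorm (a - b) <= enorm a + enorm b.
Proof. by rewrite (le_trans (enormD _ _))// enormN. Qed.

Lemma enorm_le_sq k (a : 'cV[R]_k) (c : R) : 0 <= c ->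
  enorm a ^+ 2 <= c ^+ 2 -> enorm a <= c.
Proof. by move=> c0; rewrite ler_pXn2r// nnegrE enorm_ge0. Qed.

(** Duality: [enorm (A^T *m b) ^+ 2] is the inner product of [b] with [A *m (A^T *m b)];
    Cauchy-Schwarz and the bound on [A] leave one factor to cancel. *)
Lemma enorm_tr_le m k (A : 'M[R]_(m, k)) (c : R) : 0 <= c ->
  (forall a, enorm (A *m a) <= c * enorm a) ->
  forall b, enorm (A^T *m b) <= c * enorm b.
Proof.
move=> c0 Ac b; have [b0|b0] := eqVneq (enorm (A^T *m b)) 0.
  by rewrite b0 mulr_ge0 ?enorm_ge0.
have bp : 0 < enorm (A^T *m b) by rewrite lt0r b0 enorm_ge0.
rewrite -(ler_pM2l bp) -expr2 -dotvv dotv_mulT.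
rewrite (le_trans (dotv_le _ _))// mulrC mulrA ler_wpM2r ?enorm_ge0//.
by rewrite mulrC Ac.
Qed.

(** The Frobenius norm squared, so that it is a polynomial in the entries. *)
Definition frob m k (A : 'M[R]_(m, k)) : R := \sum_i \sum_j A i j ^+ 2.

Definition bvec k (j : 'I_k) : 'cV[R]_k := delta_mx j 0.

Lemma enorm_bvec k (j : 'I_k) : enorm (bvec j) = 1.
Proof.
apply/eqP; rewrite -(@eqrXn2 _ 2) ?enorm_ge0//; rewrite enorm_sq expr1n (bigD1 j)//=.
rewrite mxE !eqxx expr1n big1 ?addr0// => i ij.
by rewrite mxE (negbTE ij) expr0n.
Qed.

Lemma frob_ge0 m k (A : 'M[R]_(m, k)) : 0 <= frob A.
Proof. by apply: sumr_ge0 => i _; apply: sumr_ge0 => j _; exact: sqr_ge0. Qed.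

Lemma frob_tr m k (A : 'M[R]_(m, k)) : frob A^T = frob A.
Proof.
by rewrite /frob exchange_big/=; do 2!apply: eq_bigr => ? _; rewrite mxE.
Qed.

Lemma frob_cols m k (A : 'M[R]_(m, k)) :
  frob A = \sum_j enorm (A *m bvec j) ^+ 2.
Proof.
rewrite /frob exchange_big/=; apply: eq_bigr => j _; rewrite enorm_sq.
by apply: eq_bigr => i _; rewrite -colE mxE.
Qed.

Lemma frob_mulE m k (A : 'M[R]_(m, k)) l (B : 'M[R]_(k, l)) :
  frob (A *m B) = \sum_j enorm (A *m (B *m bvec j)) ^+ 2.
Proof. by rewrite frob_cols; apply: eq_bigr => j _; rewrite mulmxA. Qed.

(** Each column has norm at most [c]. A matrix with few rows is treated through its transpose, which
    shares the bound by [enorm_tr_le]. *)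
Lemma frob_le m k (A : 'M[R]_(m, k)) (c : R) : 0 <= c ->
  (forall a, enorm (A *m a) <= c * enorm a) -> frob A <= k%:R * c ^+ 2.
Proof.
move=> c0 Ac; rewrite frob_cols.
rewrite (@le_trans _ _ (\sum_(j < k) c ^+ 2))//; last first.
  by rewrite sumr_const card_ord mulr_natl.
apply: ler_sum => j _; rewrite ler_pXn2r ?nnegrE ?enorm_ge0//.
by rewrite (le_trans (Ac _))// enorm_bvec mulr1.
Qed.

Lemma frob_mul_le m k l (A : 'M[R]_(m, k)) (B : 'M[R]_(k, l)) (c : R) :
  0 <= c -> (forall a, enorm (A *m a) <= c * enorm a) ->
  frob (A *m B) <= c ^+ 2 * frob B.
Proof.
move=> c0 Ac; rewrite frob_mulE frob_cols mulr_sumr; apply: ler_sum => j _.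
by rewrite -exprMn ler_pXn2r ?nnegrE ?mulr_ge0 ?enorm_ge0.
Qed.

Lemma frobD_le m k (A B : 'M[R]_(m, k)) :
  frob (A + B) <= 2 * frob A + 2 * frob B.
Proof.
rewrite /frob !mulr_sumr -big_split/=; apply: ler_sum => i _.
rewrite !mulr_sumr -big_split/=; apply: ler_sum => j _.
by rewrite mxE; have := sqr_ge0 (A i j - B i j); lra.
Qed.

Lemma sum_mul_sqr_le (I : finType) (f g : I -> R) :
  (\sum_i f i * g i) ^+ 2 <= (\sum_i f i ^+ 2) * (\sum_i g i ^+ 2).
Proof.
pose a : 'cV[R]_#|I| := \col_i f (enum_val i).
pose b : 'cV[R]_#|I| := \col_i g (enum_val i).
have E (h : I -> R) : \sum_i h i = \sum_(i < #|I|) h (enum_val i).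
  by rewrite (reindex (@enum_val _ I))//=; apply: onW_bij; exact: enum_val_bij.
have -> : \sum_i f i * g i = dotv a b.
  by rewrite dotvE E; apply: eq_bigr => i _; rewrite !mxE.
have -> : \sum_i f i ^+ 2 = enorm a ^+ 2.
  by rewrite enorm_sq E; apply: eq_bigr => i _; rewrite !mxE.
have -> : \sum_i g i ^+ 2 = enorm b ^+ 2.
  by rewrite enorm_sq E; apply: eq_bigr => i _; rewrite !mxE.
rewrite -[leLHS]ger0_norm ?sqr_ge0// normrX -exprMn.
by rewrite ler_pXn2r ?nnegrE ?mulr_ge0 ?enorm_ge0// dotv_normle.
Qed.

(** Cauchy-Schwarz on the diagonal. This and the next lemma turn lower bounds on traces, which
    quadratic forms provide, into lower bounds on Frobenius norms. *)
Lemma mxtrace_sqr_le m (A : 'M[R]_m) : (\tr A) ^+ 2 <= m%:R * frob A.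
Proof.
rewrite /mxtrace; have := sum_mul_sqr_le (fun=> 1) (fun i : 'I_m => A i i).
under eq_bigr do rewrite mul1r.
under [X in X * _]eq_bigr do rewrite expr1n.
rewrite sumr_const card_ord => /le_trans; apply; rewrite ler_wpM2l//.
apply: ler_sum => i _; rewrite (bigD1 i)//= lerDl.
by apply: sumr_ge0 => j _; exact: sqr_ge0.
Qed.

Lemma mxtrace_mul_sqr_le m k (A : 'M[R]_(m, k)) (B : 'M[R]_(k, m)) :
  (\tr (A *m B)) ^+ 2 <= frob A * frob B.
Proof.
rewrite /mxtrace.
have -> : \sum_i (A *m B) i i = \sum_(q : 'I_m * 'I_k) A q.1 q.2 * B q.2 q.1.
  rewrite -(pair_bigA _ (fun i j => A i j * B j i))/=.
  by apply: eq_bigr => i _; rewrite mxE.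
rewrite (le_trans (sum_mul_sqr_le _ _))//.
rewrite -(pair_bigA _ (fun i j => A i j ^+ 2))/=.
by rewrite -(pair_bigA _ (fun i j => B j i ^+ 2))/= [X in _ * X]exchange_big.
Qed.

Lemma mxtraceE_dotv m (A : 'M[R]_m) : \tr A = \sum_i dotv (bvec i) (A *m bvec i).
Proof.
apply: eq_bigr => i _; rewrite dotvE (bigD1 i)//= big1 ?addr0.
  by rewrite mxE !eqxx mul1r -colE mxE.
by move=> j ji; rewrite mxE (negbTE ji) mul0r.
Qed.

End euclidean.
Arguments bvec {R k} j.

(** * The resolvent of a matrix with nonnegative quadratic form *)

Section resolvent.
Variables (R : realType) (n : nat) (G Q : 'M[R]_n) (g : R).
Hypotheses (g0 : 0 < g) (Gge0 : forall a, 0 <= dotv a (G *m a)).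
Hypothesis (QK : (G + (g ^+ 2)%:M) *m Q = 1%:M).

Lemma resolventE (a : 'cV[R]_n) : G *m (Q *m a) + g ^+ 2 *: (Q *m a) = a.
Proof. by rewrite -mul_scalar_mx -mulmxDl mulmxA QK mul1mx. Qed.

(** The two summands of [resolventE] have a nonnegative inner product, so neither can be longer than
    their sum [a]. *)
Lemma resolvent_norms (a : 'cV[R]_n) :
  enorm (g ^+ 2 *: (Q *m a)) <= enorm a /\ enorm (G *m (Q *m a)) <= enorm a.
Proof.
have := dotvv a; rewrite -{1 2}(resolventE a).
set x := G *m _; set y := Q *m a.
rewrite dotvDl !dotvDr !dotvv (dotvC _ x) dotvZr => E.
have xy : 0 <= dotv x y by rewrite dotvC Gge0.
have gxy : 0 <= g ^+ 2 * dotv x y by rewrite mulr_ge0 ?sqr_ge0.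
have := sqr_ge0 (enorm x); have := sqr_ge0 (enorm (g ^+ 2 *: y)).
by split; (apply: enorm_le_sq; [exact: enorm_ge0|lra]).
Qed.

Lemma smoother_contract (a : 'cV[R]_n) : enorm (G *m Q *m a) <= 1 * enorm a.
Proof. by rewrite mul1r -mulmxA; case: (resolvent_norms a). Qed.

Lemma smootherE (a : 'cV[R]_n) : G *m Q *m a = a - g ^+ 2 *: (Q *m a).
Proof. by rewrite -mulmxA -{2}(resolventE a) addrK. Qed.

(* The variational identity behind the lower bounds on the smoother: it makes
   the quadratic form of [G *m Q] monotone in [G]. *)
Lemma smoother_form (a : 'cV[R]_n) : let u := g ^+ 2 *: (Q *m a) in
  dotv a (G *m Q *m a) = enorm (u - a) ^+ 2 + dotv u (G *m u) / g ^+ 2.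
Proof.
move=> u; have g2 : g ^+ 2 != 0 by rewrite expf_neq0// gt_eqF.
have E : G *m u = g ^+ 2 *: (a - u).
  by rewrite /u -scalemxAr mulmxA smootherE.
rewrite smootherE -/u E dotvZr -dotvv.
rewrite [_ * dotv _ _ / _]mulrAC divff// mul1r.
by rewrite dotvBl !dotvBr (dotvC u a); ring.
Qed.

(** Both summands of [smoother_form] are minorized through [Y]: [Y^T a] is at most [Y^T u] plus
    [Y^T (u - a)] in norm, the first paid by the form of [G] at [u] and the second by [u - a]. It is
    applied with [Y] the whole tail block and with [Y] a single scaled head column. *)
Lemma smoother_form_ge m (Y : 'M[R]_(n, m)) (k : R) (a : 'cV[R]_n) : 0 <= k ->
  (forall u, enorm (Y^T *m u) ^+ 2 <= dotv u (G *m u)) ->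
  (forall u, enorm (Y^T *m u) ^+ 2 <= k * enorm u ^+ 2) ->
  enorm (Y^T *m a) ^+ 2 <= (g ^+ 2 + k) * dotv a (G *m Q *m a).
Proof.
move=> k0 YG Yk; rewrite smoother_form; set u := g ^+ 2 *: _.
have g2 : 0 < g ^+ 2 by rewrite exprn_gt0.
have := Yk (u - a); have := YG u.
have : enorm (Y^T *m a) <= enorm (Y^T *m u) + enorm (Y^T *m (u - a)).
  by rewrite (le_trans _ (enormB _ _))// -mulmxBr opprB addrCA subrr addr0.
move: (enorm_ge0 (Y^T *m a)) (enorm_ge0 (Y^T *m u)) (enorm_ge0 (Y^T *m (u - a))).
move: (sqr_ge0 (enorm (u - a))).
set A := enorm (Y^T *m a); set B := enorm (Y^T *m u).
set C := enorm (Y^T *m (u - a)); set D := enorm (u - a) ^+ 2.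
set E := dotv u (G *m u) => D0 A0 B0 C0 ABC BE CD.
have E0 : 0 <= E by apply: le_trans BE; exact: sqr_ge0.
(* The weight for the arithmetic-geometric mean inequality: [F] times [g ^+ 2 * D] bounds
   [(B * C) ^+ 2], and the resulting terms add up exactly to [(g ^+ 2 + k) * (D + E / g ^+ 2)]. *)
pose F := k * E / g ^+ 2.
have F0 : 0 <= F by rewrite divr_ge0 ?(ltW g2)// mulr_ge0.
have GF : (g ^+ 2 * D) * F = k * D * E by rewrite /F; field; rewrite gt_eqF.
have GD0 : 0 <= g ^+ 2 * D by rewrite mulr_ge0 ?(ltW g2).
have BC : 2 * (B * C) <= g ^+ 2 * D + F.
  rewrite -(@ler_pXn2r _ 2) ?nnegrE ?(addr_ge0 GD0)// ?mulr_ge0 ?mulr_ge0//.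
  have : (B * C) ^+ 2 <= E * (k * D).
    by rewrite exprMn ler_pM ?sqr_ge0.
  by have := sqr_ge0 (g ^+ 2 * D - F); nra.
have -> : (g ^+ 2 + k) * (D + E / g ^+ 2) = g ^+ 2 * D + F + E + k * D.
  by rewrite /F; field; rewrite gt_eqF.
have : A ^+ 2 <= (B + C) ^+ 2 by rewrite ler_pXn2r ?nnegrE ?(addr_ge0 B0).
by rewrite sqrrD; lra.
Qed.
End resolvent.

(** * Bias and smoother under deterministic hypotheses, with [r = sqrt n] and [g = sqrt (n tau)] *)

Section ridge_bounds.
Variables (R : realType) (n d m : nat).
Variables (Z : 'M[R]_(n, d)) (X2 : 'M[R]_(n, m)) (l : 'rV[R]_d) (Q : 'M[R]_n).
Variables (r g kap K t tau ld : R).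
Let D := X2 *m X2^T.
Let G := Z *m diag_mx l *m Z^T + D.
Let s := tau + t.
Hypotheses (r0 : 0 < r) (rn : r ^+ 2 = n%:R).
Hypotheses (g0 : 0 < g) (gt : g ^+ 2 = n%:R * tau).
Hypotheses (kap0 : 0 <= kap) (kapt : kap ^+ 2 = K * (n%:R * t)) (K1 : 1 <= K).
Hypotheses (t0 : 0 < t) (ld0 : 0 < ld) (lge : forall k, ld <= l 0 k).
Hypothesis (QK : (G + (g ^+ 2)%:M) *m Q = 1%:M).
Hypothesis (Zub : forall y, enorm (Z *m y) <= 3 * r * enorm y).
Hypothesis (Zlb : forall y, r * enorm y <= 3 * enorm (Z *m y)).
Hypothesis (Xub : forall a, enorm (X2 *m a) <= kap * enorm a).

Let n0 : 0 < n%:R :> R.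
Proof. by rewrite -rn exprn_gt0. Qed.

Let tau0 : 0 < tau.
Proof. by rewrite -(pmulr_rgt0 _ n0) -gt exprn_gt0. Qed.

Let s0 : 0 < s. Proof. by rewrite addr_gt0. Qed.

Let K0 : 0 < K. Proof. exact: lt_le_trans ltr01 K1. Qed.

Let r_ : 0 <= r. Proof. exact: ltW. Qed.
Let g_ : 0 <= g. Proof. exact: ltW. Qed.
Let n_ : 0 <= n%:R :> R. Proof. exact: ltW. Qed.
Let t_ : 0 <= t. Proof. exact: ltW. Qed.
Let tau_ : 0 <= tau. Proof. exact: ltW. Qed.
Let s_ : 0 <= s. Proof. exact: ltW. Qed.
Let K_ : 0 <= K. Proof. exact: ltW. Qed.
Let ld_ : 0 <= ld. Proof. exact: ltW. Qed.

Let XTub a : enorm (X2^T *m a) <= kap * enorm a.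
Proof. exact: enorm_tr_le. Qed.

Let ZTub a : enorm (Z^T *m a) <= 3 * r * enorm a.
Proof. by apply: enorm_tr_le => //; rewrite mulr_ge0// ltW. Qed.

Let l0 k : 0 < l 0 k. Proof. exact: lt_le_trans (lge k). Qed.

Let dotvD a : dotv a (D *m a) = enorm (X2^T *m a) ^+ 2.
Proof. by rewrite -mulmxA -dotv_mulT dotvv. Qed.

Let dotvL a : dotv a (diag_mx l *m a) = \sum_k l 0 k * a k 0 ^+ 2.
Proof.
rewrite dotvE; apply: eq_bigr => k _.
by rewrite mul_diag_mx mxE mulrCA expr2.
Qed.

Let dotvL_ge0 a : 0 <= dotv a (diag_mx l *m a).
Proof.
rewrite dotvL; apply: sumr_ge0 => k _.
by rewrite mulr_ge0 ?sqr_ge0// ltW.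
Qed.

Let dotvG a : dotv a (G *m a) =
  dotv (Z^T *m a) (diag_mx l *m (Z^T *m a)) + enorm (X2^T *m a) ^+ 2.
Proof. by rewrite mulmxDl dotvDr dotvD -!mulmxA -dotv_mulT. Qed.

Let G_ge0 a : 0 <= dotv a (G *m a).
Proof. by rewrite dotvG addr_ge0 ?sqr_ge0. Qed.

Let E1 := resolventE QK.

(** A positive operator [M] of norm at most [c] satisfies [|M a|^2 <= c <a, M a>]. Here [M] is the
    tail Gram matrix plus the ridge, of norm at most [kap ^+ 2 + g ^+ 2], hence at most [K n s]:
    this is where the tail counts as an extra penalty [t]. *)
Let tailK a : enorm (D *m a + g ^+ 2 *: a) ^+ 2 <=
  K * n%:R * s * dotv a (D *m a + g ^+ 2 *: a).
Proof.
rewrite dotvDr dotvD dotvZr dotvv.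
have A0 := enorm_ge0 (X2^T *m a); have B0 := enorm_ge0 a.
have : enorm (D *m a + g ^+ 2 *: a) <=
    kap * enorm (X2^T *m a) + g * (g * enorm a).
  rewrite (le_trans (enormD _ _))// lerD//.
    by rewrite -mulmxA Xub.
  by rewrite enormZ ger0_norm ?sqr_ge0// expr2 mulrA.
rewrite -(@ler_pXn2r _ 2) ?nnegrE ?enorm_ge0 ?addr_ge0 ?mulr_ge0 ?(ltW g0)//.
move=> /le_trans; apply; set A := enorm (_ *m _); set B := enorm a.
have -> : K * n%:R * s = K * (n%:R * tau) + K * (n%:R * t).
  by rewrite /s; ring.
rewrite -gt -kapt.
apply: (@le_trans _ _ ((g ^+ 2 + kap ^+ 2) * (A ^+ 2 + g ^+ 2 * B ^+ 2))).
  have := sqr_ge0 (kap * (g * B) - g * A); nra.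
rewrite ler_wpM2r//.
  by rewrite addr_ge0 ?sqr_ge0// mulr_ge0 ?sqr_ge0.
by rewrite lerD2r ler_peMl// sqr_ge0.
Qed.

Let tailK_norm a : enorm (D *m a + g ^+ 2 *: a) <= K * n%:R * s * enorm a.
Proof.
have [z|z] := eqVneq (enorm (D *m a + g ^+ 2 *: a)) 0.
  by rewrite z !mulr_ge0 ?enorm_ge0.
have zp : 0 < enorm (D *m a + g ^+ 2 *: a) by rewrite lt0r z enorm_ge0.
rewrite -(ler_pM2l zp) -expr2 (le_trans (tailK _))//.
have c0 : 0 <= K * n%:R * s by rewrite !mulr_ge0.
by rewrite mulrCA ler_wpM2l// mulrC dotv_le.
Qed.

(** With the head part of [G] moved to the other side, [y = l (v - Z^T a)] satisfies
    [Z y = (D + g^2) a]. Pairing with [a] and dropping the positive form of [l] at [v - Z^T a]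
    leaves at most [|y| |v|]; together with [tailK] and the lower isometry this gives
    [|y| <= 9 K s |v|], whatever the size of [l]. *)
Lemma bias_head_le v :
  enorm (g ^+ 2 *: (Q *m (Z *m (diag_mx l *m v)))) <= 3 * K * r * s * enorm v.
Proof.
set a := Q *m _.
have Ea : Z *m (diag_mx l *m (v - Z^T *m a)) = D *m a + g ^+ 2 *: a.
  rewrite !mulmxBr -{1}(E1 (Z *m (diag_mx l *m v))) -/a /G mulmxDl -!mulmxA.
  by rewrite addrAC [_ + X2 *m _]addrC addrK.
set y := diag_mx l *m _ in Ea.
have form : dotv a (D *m a + g ^+ 2 *: a) <= enorm y * enorm v.
  rewrite -Ea -dotv_mulT mulrC; apply: le_trans (dotv_le _ _).
  rewrite -subr_ge0 -dotvBl /y; exact: dotvL_ge0.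
have yle : enorm y <= 9 * K * s * enorm v.
  have := Zlb y; rewrite -(@ler_pXn2r _ 2) ?nnegrE ?mulr_ge0 ?enorm_ge0//.
  rewrite !exprMn rn Ea => H.
  have {}H : n%:R * enorm y ^+ 2 <= n%:R * (enorm y * (9 * K * s * enorm v)).
    apply: le_trans H _; apply: le_trans (ler_wpM2l _ (tailK a)) _ => //.
    have := ler_wpM2l (ltW (mulr_gt0 (mulr_gt0 K0 n0) s0)) form; nra.
  move: H; rewrite ler_pM2l// expr2; have [->|y0] := eqVneq (enorm y) 0.
    by rewrite !mulr_ge0 ?enorm_ge0.
  by rewrite ler_pM2l// lt0r y0 enorm_ge0.
have v0 := enorm_ge0 v.
apply: enorm_le_sq; first by rewrite !mulr_ge0.
rewrite enormZ ger0_norm ?sqr_ge0// exprMn.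
(* The same pairing also contains [g ^+ 2 * enorm a ^+ 2], so one more factor [g ^+ 2 = n tau] gives
   the squared bias; the surplus [tau] is finally bounded by [K s]. *)
have H : g ^+ 2 * enorm a ^+ 2 <= enorm y * enorm v.
  apply: le_trans form; rewrite dotvDr dotvZr dotvv lerDr dotvD; exact: sqr_ge0.
rewrite [X in X * _]expr2 -mulrA (le_trans (ler_wpM2l _ H)) ?sqr_ge0// gt.
rewrite (le_trans (_ : _ <= n%:R * tau * (9 * K * s * enorm v * enorm v)))//.
  by rewrite ler_wpM2l ?mulr_ge0 ?mulr_ge0// ler_wpM2r.
rewrite !exprMn rn.
have -> : n%:R * tau * (9 * K * s * enorm v * enorm v) =
  9 * n%:R * (K * s * enorm v ^+ 2) * tau by ring.
have -> : 3 ^+ 2 * K ^+ 2 * n%:R * s ^+ 2 * enorm v ^+ 2 =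
  9 * n%:R * (K * s * enorm v ^+ 2) * (K * s) by ring.
rewrite ler_wpM2l ?mulr_ge0 ?mulr_ge0// ?sqr_ge0//.
rewrite (@le_trans _ _ s)//; first by rewrite /s lerDl ltW.
by rewrite ler_peMl// ltW.
Qed.

Lemma bias_le v f : enorm (g ^+ 2 *: (Q *m (Z *m (diag_mx l *m v) + f))) <=
  3 * K * r * s * enorm v + enorm f.
Proof.
rewrite mulmxDr scalerDr; apply: le_trans (enormD _ _) _; apply: lerD.
  exact: bias_head_le.
by case: (resolvent_norms G_ge0 QK f).
Qed.

(** The identity of [bias_head_le] read backwards: [v] is [Z^T a] plus a remainder [w], and the
    lower isometry with [l >= ld] controls [w] by [(D + g^2) a - f]. The right side carries no
    factor [g ^+ 2], so it yields a bias of order [s] only where [tau] is comparable to [s]. *)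
Lemma bias_ge v f :
  enorm v <= 3 * r * (1 + K * s / ld) *
    enorm (Q *m (Z *m (diag_mx l *m v) + f)) + 3 * enorm f / (r * ld).
Proof.
set a := Q *m _.
have Ea : Z *m (diag_mx l *m (v - Z^T *m a)) = D *m a + g ^+ 2 *: a - f.
  have -> : Z *m (diag_mx l *m (v - Z^T *m a)) =
      Z *m (diag_mx l *m v) - Z *m (diag_mx l *m (Z^T *m a)).
    by rewrite !mulmxBr.
  have -> : Z *m (diag_mx l *m v) = G *m a + g ^+ 2 *: a - f by rewrite E1 addrK.
  rewrite addrAC; congr (_ - f); rewrite /G mulmxDl -!mulmxA.
  by rewrite addrAC [_ + X2 *m _]addrC addrK.
have lle x : ld * enorm x <= enorm (diag_mx l *m x).
  rewrite -(@ler_pXn2r _ 2) ?nnegrE ?mulr_ge0 ?enorm_ge0//.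
  rewrite exprMn !enorm_sq mulr_sumr; apply: ler_sum => k _.
  rewrite mul_diag_mx mxE exprMn ler_wpM2r ?sqr_ge0//.
  by have lk0 := ltW (l0 k); rewrite ler_pXn2r ?nnegrE.
set w := v - _ in Ea.
have H : r * ld * enorm w <= 3 * (K * n%:R * s * enorm a + enorm f).
  apply: le_trans (_ : _ <= r * enorm (diag_mx l *m w)) _.
    by rewrite -mulrA ler_pM2l.
  apply: le_trans (Zlb _) _; rewrite Ea ler_pM2l//.
  by rewrite (le_trans (enormB _ _))// lerD2r tailK_norm.
have : enorm v <= enorm w + 3 * r * enorm a.
  rewrite -{1}(subrK (Z^T *m a) v) (le_trans (enormD _ _))// lerD2l; exact: ZTub.
move=> /le_trans; apply.
have rl0 : 0 < r * ld by rewrite mulr_gt0.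
have {}H : enorm w <= 3 * (K * n%:R * s * enorm a + enorm f) / (r * ld).
  by rewrite ler_pdivlMr// mulrC.
apply: le_trans (lerD H (lexx _)) _; rewrite -rn le_eqVlt; apply/orP; left; apply/eqP.
by field; rewrite !gt_eqF.
Qed.

Let H := G *m Q.

(** Two regimes. For [tau <= t] the smoother is a contraction in dimension [n] and [t / s >= 1/2],
    so the second term alone suffices. For [tau > t] it splits as [Z N + D Q]: the tail part has
    norm at most [K t / tau], and the rest factors through dimension [d]. *)
Lemma smoother_frob_le : frob H <= 162 * (1 + K) ^+ 2 * d%:R +
  8 * K ^+ 2 * (n%:R * (t / s) ^+ 2).
Proof.
have ts0 : 0 <= t / s by rewrite divr_ge0.
have [tt|tt] := leP tau t.
  have H1 : frob H <= n%:R * 1 ^+ 2.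
    by apply: frob_le => // a; exact: smoother_contract G_ge0 QK a.
  apply: le_trans H1 _; rewrite expr1n mulr1.
  have : 1 / 2 <= t / s by rewrite ler_pdivlMr// /s; lra.
  rewrite -(@ler_pXn2r _ 2) ?nnegrE// => h.
  apply: ler_wpDl; first by rewrite mulr_ge0// mulr_ge0// sqr_ge0.
  have K2 : 1 <= K ^+ 2 by rewrite exprn_ege1.
  have : 1 <= 8 * K ^+ 2 * (t / s) ^+ 2 by nra.
  by move/(ler_wpM2l n_); rewrite mulr1 => /le_trans; apply; rewrite mulrCA.
have tt1 : t / tau <= 1 by rewrite ler_pdivrMr// mul1r ltW.
have tt0 : 0 <= t / tau by rewrite divr_ge0.
have DQ a : enorm (D *m Q *m a) <= K * (t / tau) * enorm a.
  rewrite -!mulmxA; apply: le_trans (Xub _) _.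
  apply: le_trans (ler_wpM2l kap0 (XTub _)) _.
  have := (resolvent_norms G_ge0 QK a).1.
  rewrite enormZ ger0_norm ?sqr_ge0// [X in _ -> X <= _]mulrA -expr2 kapt gt => h.
  have -> : K * (n%:R * t) * enorm (Q *m a) =
      K * (t / tau) * (n%:R * tau * enorm (Q *m a)).
    by field; rewrite gt_eqF.
  by rewrite ler_wpM2l// mulr_ge0.
pose N := diag_mx l *m Z^T *m Q.
have HE : H = Z *m N + D *m Q by rewrite /H /G mulmxDl /N !mulmxA.
(* [Z N] is a difference of two operators already bounded: [G Q] by 1 and [D Q] by [K], as
   [t <= tau] in this regime. *)
have ZN a : enorm (Z *m (N *m a)) <= (1 + K) * enorm a.
  have -> : Z *m (N *m a) = H *m a - D *m Q *m a.
    by rewrite HE mulmxDl addrK mulmxA.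
  rewrite (le_trans (enormB _ _))// mulrDl lerD//.
    exact: smoother_contract G_ge0 QK a.
  by rewrite (le_trans (DQ _))// ler_wpM2r ?enorm_ge0// ler_piMr.
have Na a : enorm (N *m a) <= 3 * (1 + K) / r * enorm a.
  rewrite mulrAC ler_pdivlMr// mulrC (le_trans (Zlb _))// -mulrA ler_pM2l//.
(* [N] has [d] rows and [n] columns; passing to the transpose is what produces the factor [d]. *)
have fN : frob N <= d%:R * (3 * (1 + K) / r) ^+ 2.
  rewrite -frob_tr; apply: frob_le.
    by rewrite divr_ge0// mulr_ge0// addr_ge0.
  by apply: enorm_tr_le => //; rewrite divr_ge0// mulr_ge0// addr_ge0.
have A1 : frob (Z *m N) <= 81 * (1 + K) ^+ 2 * d%:R.
  apply: le_trans (frob_mul_le N _ Zub) _; first by rewrite mulr_ge0.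
  apply: le_trans (ler_wpM2l (sqr_ge0 _) fN) _.
  by rewrite le_eqVlt; apply/orP; left; apply/eqP; field; rewrite gt_eqF.
have A2 : frob (D *m Q) <= n%:R * (K * (t / tau)) ^+ 2.
  by apply: frob_le DQ; rewrite mulr_ge0.
have h : t / tau <= 2 * (t / s).
  rewrite mulrA ler_pdivlMr// mulrAC ler_pdivrMr// (mulrC 2) -mulrA ler_wpM2l//.
  by rewrite /s; lra.
have {}h : (t / tau) ^+ 2 <= (2 * (t / s)) ^+ 2.
  by rewrite ler_pXn2r ?nnegrE// mulr_ge0.
rewrite HE (le_trans (frobD_le _ _))//.
have := ler_wpM2l (mulr_ge0 n_ (sqr_ge0 K)) h.
rewrite exprMn in A2; rewrite exprMn; lra.
Qed.

(** [smoother_form_ge] with the tail block as [Y], summed over the standard basis, gives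
    [frob X2 <= K n s tr H]; the hypothesis on [frob X2] then bounds the trace below, and
    [mxtrace_sqr_le] passes to [frob H]. *)
Lemma smoother_frob_ge_tail : n%:R * (n%:R * t) / 2 <= frob X2 ->
  n%:R * (t / s) ^+ 2 <= 4 * K ^+ 2 * frob H.
Proof.
move=> X2ge.
have gk : 0 <= kap ^+ 2 by rewrite sqr_ge0.
have step a : enorm (X2^T *m a) ^+ 2 <= K * n%:R * s * dotv a (H *m a).
  have YG u : enorm (X2^T *m u) ^+ 2 <= dotv u (G *m u) by rewrite dotvG lerDr.
  have Yk u : enorm (X2^T *m u) ^+ 2 <= kap ^+ 2 * enorm u ^+ 2.
    by rewrite -exprMn ler_pXn2r ?nnegrE ?enorm_ge0// mulr_ge0// enorm_ge0.
  apply: le_trans (smoother_form_ge g0 QK a gk YG Yk) _.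
  rewrite -/H ler_wpM2r//.
    rewrite /H (smoother_form g0 QK) addr_ge0 ?sqr_ge0// divr_ge0 ?sqr_ge0//.
  rewrite gt kapt /s.
  have -> : K * n%:R * (tau + t) = K * (n%:R * tau) + K * (n%:R * t) by ring.
  by rewrite lerD2r ler_peMl// mulr_ge0.
have trH : n%:R * (t / s) <= 2 * K * \tr H.
  have : frob X2 <= K * n%:R * s * \tr H.
    rewrite -frob_tr frob_cols mxtraceE_dotv mulr_sumr.
    by apply: ler_sum => i _; exact: step.
  move/(le_trans X2ge) => h.
  have c0 : 0 < n%:R * s by rewrite mulr_gt0.
  rewrite -(ler_pM2l c0).
  have -> : n%:R * s * (n%:R * (t / s)) = n%:R * (n%:R * t).
    by field; rewrite gt_eqF.
  by lra.
have nts : 0 <= n%:R * (t / s) by rewrite mulr_ge0// divr_ge0.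

have : (n%:R * (t / s)) ^+ 2 <= (2 * K * \tr H) ^+ 2.
  by rewrite ler_pXn2r ?nnegrE// (le_trans nts).
rewrite !exprMn => h2; rewrite -(ler_pM2l n0).
have K2 : 0 <= K ^+ 2 by exact: sqr_ge0.
have := mxtrace_sqr_le H; move/(ler_wpM2l K2) => h3.
lra.
Qed.

(** The whitened head columns [a = Z e_k] are tested one at a time: [G] dominates [l_k a a^T], of
    norm of order [n l_k], while the ridge is at most [n A l_k]. The eigenvalue [l_k] cancels and
    the smoother has form of order [n] at [a]. Summing bounds [tr (H Z Z^T)] below by order [d n],
    and Cauchy-Schwarz against [frob (Z Z^T)], of order [n^2 d], leaves [d]. *)
Lemma smoother_frob_ge_head (A : R) : s <= A * ld ->
  d%:R <= 81 ^+ 3 * (A + 9) ^+ 2 * frob H.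
Proof.
move=> sA.
have A0 : 0 <= A by rewrite -(pmulr_lge0 _ ld0) (le_trans _ sA).
have step k : n%:R <= 81 * (A + 9) * dotv (bvec k) (Z^T *m H *m Z *m bvec k).
  set a := Z *m bvec k.
  have -> : dotv (bvec k) (Z^T *m H *m Z *m bvec k) = dotv a (H *m a).
    by rewrite /a dotv_mul !mulmxA.
  pose Y : 'M[R]_(n, 1) := Num.sqrt (l 0 k) *: a.
  have lk := l0 k.
  have YE u : enorm (Y^T *m u) ^+ 2 = l 0 k * dotv a u ^+ 2.
    rewrite enorm_sq big_ord1 /Y linearZ/= -scalemxAl mxE exprMn sqr_sqrtr ?ltW//.
  have YG u : enorm (Y^T *m u) ^+ 2 <= dotv u (G *m u).
    rewrite YE dotvG /a dotv_mul ler_wpDr ?sqr_ge0// dotvL (bigD1 k)//=.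
    rewrite ler_wpDr//.
      by apply: sumr_ge0 => j _; rewrite mulr_ge0 ?sqr_ge0// ltW.
    rewrite dotvE (bigD1 k)//= big1 ?addr0 => [|j jk].
      by rewrite mxE !eqxx mul1r.
    by rewrite mxE (negbTE jk) mul0r.
  have Yk u : enorm (Y^T *m u) ^+ 2 <= l 0 k * enorm a ^+ 2 * enorm u ^+ 2.
    rewrite YE -mulrA ler_pM2l// -exprMn -[leLHS]ger0_norm ?sqr_ge0// normrX.
    by rewrite ler_pXn2r ?nnegrE ?mulr_ge0 ?enorm_ge0// dotv_normle.
  have la0 : 0 <= l 0 k * enorm a ^+ 2 by rewrite mulr_ge0 ?sqr_ge0// ltW.
  have := smoother_form_ge g0 QK a la0 YG Yk.
  rewrite YE dotvv -/H; set q := dotv a _; set N := enorm a ^+ 2 => h.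
  have q0 : 0 <= q.
    rewrite /q /H (smoother_form g0 QK) addr_ge0 ?sqr_ge0// divr_ge0 ?sqr_ge0//.
  have N9 : N <= 9 * n%:R.
    have := Zub (bvec k); rewrite enorm_bvec mulr1 -/a.
    rewrite -(@ler_pXn2r _ 2) ?nnegrE ?enorm_ge0 ?mulr_ge0//.
    by rewrite exprMn rn -/N -natrX.
  have Nn : n%:R <= 9 * N.
    have := Zlb (bvec k); rewrite enorm_bvec mulr1 -/a.
    rewrite -(@ler_pXn2r _ 2) ?nnegrE ?enorm_ge0 ?mulr_ge0 ?enorm_ge0//.
    by rewrite exprMn rn -/N -natrX.
  have gl : g ^+ 2 <= n%:R * (A * l 0 k).
    rewrite gt ler_pM2l// (le_trans _ (_ : s <= _))//; first by rewrite lerDl.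
    by rewrite (le_trans sA)// ler_wpM2l.
  have h2 : l 0 k * N ^+ 2 <= l 0 k * (n%:R * (A + 9) * q).
    apply: le_trans h _.
    have -> : l 0 k * (n%:R * (A + 9) * q) =
      (n%:R * (A * l 0 k) + l 0 k * (9 * n%:R)) * q by ring.
    by rewrite ler_wpM2r// lerD// ler_pM2l.
  rewrite ler_pM2l// in h2.
  have h3 : n%:R * n%:R <= n%:R * (81 * (A + 9) * q).
    have : n%:R ^+ 2 <= (9 * N) ^+ 2.
      by rewrite ler_pXn2r ?nnegrE// mulr_ge0// sqr_ge0.
    by rewrite exprMn; lra.
  by rewrite ler_pM2l// in h3.
have tr1 : d%:R * n%:R <= 81 * (A + 9) * \tr (H *m (Z *m Z^T)).
  rewrite mulmxA mxtrace_mulC mulmxA mxtraceE_dotv mulr_sumr.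
  rewrite (@le_trans _ _ (\sum_(i < d) n%:R))//.
    by rewrite sumr_const card_ord mulr_natl.
  by apply: ler_sum => k _; exact: step.
have fZZ : frob (Z *m Z^T) <= 81 * n%:R ^+ 2 * d%:R.
  have r3 : 0 <= 3 * r by rewrite mulr_ge0.
  apply: le_trans (frob_mul_le Z^T r3 Zub) _; rewrite frob_tr.
  apply: le_trans (ler_wpM2l (sqr_ge0 _) (frob_le r3 Zub)) _.
  by rewrite exprMn rn le_eqVlt; apply/orP; left; apply/eqP; ring.
have [->|d0] := eqVneq d 0%N.
  by rewrite mulr_ge0 ?frob_ge0// mulr_ge0 ?sqr_ge0// exprn_ge0.
have dp : 0 < d%:R :> R by rewrite ltr0n lt0n.
have dn0 : 0 <= d%:R * n%:R :> R by rewrite mulr_ge0.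
have : (d%:R * n%:R) ^+ 2 <= (81 * (A + 9) * \tr (H *m (Z *m Z^T))) ^+ 2.
  by rewrite ler_pXn2r ?nnegrE// (le_trans dn0).
rewrite exprMn [in leRHS]exprMn => h.
have c0 : 0 <= (81 * (A + 9)) ^+ 2 by exact: sqr_ge0.
have {}h := le_trans h (ler_wpM2l c0 (mxtrace_mul_sqr_le _ _)).
have {}h := le_trans h (ler_wpM2l c0 (ler_wpM2l (frob_ge0 H) fZZ)).
have n2 : 0 < n%:R ^+ 2 * d%:R :> R by rewrite mulr_gt0// exprn_gt0.
rewrite -(ler_pM2l n2); move: h; rewrite !exprMn; lra.
Qed.

End ridge_bounds.

(** * Nets and near-isometries *)

Section net.
Variables (R : realType) (k : nat).

(* Integer vectors coded by signs and absolute values (so that 0 has two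
   codes); the points of Euclidean norm at most [8 * sqrt k] form the net. *)
Definition lattice := {ffun 'I_k -> bool * 'I_(64 * k).+1}.

Definition latvec (f : lattice) : 'cV[R]_k :=
  \col_i ((-1) ^+ (f i).1 * (f i).2%:R).

(** An l1 condition: as [m <= m^2] for natural [m], it holds at every lattice point of Euclidean
    norm at most [8 * sqrt k], and unlike the Euclidean condition it suits a count by geometric
    series. *)
Definition innet (f : lattice) := (\sum_i (f i).2 <= 64 * k)%N.

Lemma sum_half_pow_le (M : nat) : \sum_(j < M) (2^-1 : R) ^+ j <= 2.
Proof.
have -> : \sum_(j < M) (2^-1 : R) ^+ j = 2 - 2 * 2^-1 ^+ M.
  elim: M => [|M IH]; first by rewrite big_ord0 expr0; lra.
  by rewrite big_ord_recr/= IH exprS; lra.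
by rewrite gerBl mulr_ge0// exprn_ge0// invr_ge0.
Qed.

(** Every net point has weight [2 ^ (64 k)] times [2 ^ -|f|_1] at least 1, and the sum of these
    weights over the whole lattice factorizes. Each coordinate contributes at most 4: two signs
    times a geometric series bounded by 2. *)
Lemma card_net_le : (#|[pred f | innet f]|%:R : R) <= 2 ^+ (66 * k).
Proof.
rewrite -sum1_card natr_sum.
apply: (@le_trans _ _ (\sum_(f : lattice) 2 ^+ (64 * k) * \prod_i 2^-1 ^+ (f i).2)).
  rewrite [leRHS](bigID innet)/= ler_wpDr//.
    by apply: sumr_ge0 => f _; rewrite mulr_ge0 ?exprn_ge0// prodr_ge0// => i _; rewrite exprn_ge0// invr_ge0.
  apply: ler_sum => f fn; rewrite prodrXr exprVn ler_pdivlMr ?exprn_gt0//.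
  by rewrite mul1r ler_eXn2l// ltr1n.
rewrite -mulr_sumr.
have -> : \sum_(f : lattice) \prod_i (2^-1 : R) ^+ (f i).2 =
    \prod_(i < k) \sum_(c : bool * 'I_(64 * k).+1) 2^-1 ^+ c.2.
  by rewrite (bigA_distr_bigA (fun (i : 'I_k) (c : bool * 'I_(64 * k).+1) => (2^-1 : R) ^+ c.2)).
have -> : (66 * k = 64 * k + 2 * k)%N by lia.
rewrite exprD ler_pM2l ?exprn_gt0// exprM prodr_const card_ord.
have S0 : 0 <= \sum_(j < (64 * k).+1) (2^-1 : R) ^+ j.
  by apply: sumr_ge0 => j _; rewrite exprn_ge0// invr_ge0.
have E : \sum_(c : bool * 'I_(64 * k).+1) (2^-1 : R) ^+ c.2 =
   2 * \sum_(j < (64 * k).+1) 2^-1 ^+ j.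
  rewrite -(pair_bigA _ (fun (b : bool) (j : 'I_(64 * k).+1) => (2^-1 : R) ^+ j))/=.
  by rewrite big_bool/= mulr2n mulrDl mul1r.
rewrite E; apply: lerXn2r; rewrite ?nnegrE ?mulr_ge0//.
by have := sum_half_pow_le (64 * k).+1; rewrite expr2; lra.
Qed.

Let K := Num.sqrt (k%:R : R).

Let K0 : 0 <= K. Proof. exact: sqrtr_ge0. Qed.

Let KK : K ^+ 2 = k%:R. Proof. by rewrite sqr_sqrtr. Qed.

(** Rounding each coordinate towards 0 does not increase the norm and moves every coordinate by less
    than 1, so the error is at most [sqrt k], one eighth of the radius at which it is used. *)
Lemma net_round (w : 'cV[R]_k) : enorm w <= 8 * K ->
  exists f, [/\ innet f, enorm (latvec f) <= enorm w &
                enorm (w - latvec f) <= K].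
Proof.
move=> wK.
have w64 : enorm w ^+ 2 <= (64 * k)%:R.
  have : enorm w ^+ 2 <= (8 * K) ^+ 2 by rewrite ler_pXn2r ?nnegrE ?enorm_ge0 ?mulr_ge0.
  by move=> /le_trans; apply; rewrite exprMn KK natrM -natrX.
pose T (i : 'I_k) := Num.truncn `|w i 0|.
have Tle i : (T i)%:R <= `|w i 0| by have /andP[] := truncn_itv (normr_ge0 (w i 0)).
have Tle2 i : ((T i)%:R : R) <= w i 0 ^+ 2.
  rewrite -[leRHS]ger0_norm ?sqr_ge0// normrX; have := Tle i; case: (T i) => [|m]; first by rewrite sqr_ge0.
  move=> h; rewrite (le_trans h)// expr2 ler_peMl//.
  by rewrite (le_trans _ h)// ler1n.
have sT : (\sum_i T i <= 64 * k)%N.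
  rewrite -(ler_nat R) natr_sum (le_trans _ w64)// enorm_sq.
  by apply: ler_sum => i _.
have TM i : (T i < (64 * k).+1)%N.
  by rewrite ltnS (leq_trans _ sT)// (bigD1 i)//= leq_addr.
pose f : lattice := [ffun i => (w i 0 < 0, Ordinal (TM i))].
have fE i : latvec f i 0 = (-1) ^+ (w i 0 < 0)%R * (T i)%:R.
  by rewrite mxE ffunE.
exists f; split.
- by rewrite /innet; under eq_bigr do rewrite ffunE.
- apply: enorm_le_sq; first exact: enorm_ge0.
  rewrite !enorm_sq; apply: ler_sum => i _.
  rewrite fE exprMn -exprM mulnC exprM sqrrN expr1n expr1n mul1r.
  by rewrite -[leRHS]ger0_norm ?sqr_ge0// normrX ler_pXn2r ?nnegrE.
- apply: enorm_le_sq => //.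
  rewrite KK enorm_sq -[k in leRHS]card_ord -sum1_card natr_sum.
  apply: ler_sum => i _; rewrite mxE [X in _ + X]mxE fE.
  have : `|w i 0| < (T i).+1%:R by have /andP[] := truncn_itv (normr_ge0 (w i 0)).
  have := Tle i; rewrite -natr1.
  set x := w i 0; set t := (T i)%:R => h1 h2.
  rewrite -[leLHS]ger0_norm ?sqr_ge0// normrX expr_le1//.
  have [x0|x0] := ltP x 0.
    by rewrite (ltr0_norm x0) in h1 h2; rewrite expr1 mulN1r opprK ler_norml; apply/andP; split; lra.
  by rewrite (ger0_norm x0) in h1 h2; rewrite expr0 mul1r ler_norml; apply/andP; split; lra.
Qed.

Lemma enorm_frob m (A : 'M[R]_(m, k)) (y : 'cV[R]_k) :
  enorm (A *m y) <= Num.sqrt (frob A) * enorm y.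
Proof.
apply: enorm_le_sq; first by rewrite mulr_ge0 ?sqrtr_ge0 ?enorm_ge0.
rewrite exprMn (sqr_sqrtr (frob_ge0 A)) !enorm_sq /frob mulr_suml.
apply: ler_sum => i _; rewrite mxE.
exact: (sum_mul_sqr_le (fun j => A i j) (fun j => y j 0)).
Qed.

Lemma le_geom (x y z : R) : (forall j, x <= y + z * (8^-1) ^+ j) -> x <= y.
Proof.
move=> h; rewrite leNgt; apply/negP => yx.
have xy0 : 0 < x - y by rewrite subr_gt0.
pose N := Num.truncn `|z / (x - y)|.
have zN : z / (x - y) < N.+1%:R.
  apply: le_lt_trans (ler_norm _) _.
  by have /andP[] := truncn_itv (normr_ge0 (z / (x - y))).
have N8 : (N.+1%:R : R) <= 8 ^+ N.+1.
  by rewrite -natrX ler_nat ltnW// ltn_expl.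
have := h N.+1; rewrite exprVn leNgt => /negP; apply.
rewrite -ltrBrDl ltr_pdivrMr ?exprn_gt0//.
rewrite ltr_pdivrMr// in zN; apply: lt_le_trans zN _.
by rewrite mulrC ler_pM2l.
Qed.

Hypothesis k0 : (0 < k)%N.

Let Kp : 0 < K. Proof. by rewrite sqrtr_gt0 ltr0n. Qed.

Let scale (y : 'cV[R]_k) : y != 0 -> exists c w,
  [/\ 0 < c, y = c *: w & enorm w = 8 * K].
Proof.
move=> y0.
have yp : 0 < enorm y.
  rewrite lt0r enorm_ge0 andbT; apply: contraNneq y0 => y0.
  by apply/eqP; apply: enorm_sq_eq0; rewrite y0 expr0n.
exists (enorm y / (8 * K)), ((8 * K / enorm y) *: y); split.
- by rewrite divr_gt0// mulr_gt0.
- rewrite scalerA (_ : _ * _ = 1) ?scale1r//.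
  by field; rewrite !gt_eqF.
- by rewrite enormZ ger0_norm ?divr_ge0 ?enorm_ge0 ?mulr_ge0// divfK// gt_eqF.
Qed.

(** Any bound [C] on the operator improves to [c + C / 8] after rounding. Iterating from the
    Frobenius bound converges to the fixed point [8 / 7 * c], which avoids introducing the operator
    norm as a supremum. *)
Lemma net_upper m (A : 'M[R]_(m, k)) (c : R) : 0 <= c ->
  (forall f, innet f -> enorm (A *m latvec f) <= c * enorm (latvec f)) ->
  forall y, enorm (A *m y) <= 8 / 7 * c * enorm y.
Proof.
move=> c0 Ac.
have step C : 0 <= C -> (forall y, enorm (A *m y) <= C * enorm y) ->
    forall y, enorm (A *m y) <= (c + C / 8) * enorm y.
  move=> C0 AC y; have [->|/scale[e [w [e0 -> wE]]]] := eqVneq y 0.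
    by rewrite mulmx0 !enorm0 mulr0.
  rewrite -scalemxAr !enormZ mulrCA ler_wpM2l//.
  have [|f [fn fw wf]] := @net_round w; first by rewrite wE.
  rewrite -[w in A *m w](subrK (latvec f)) mulmxDr (le_trans (enormD _ _))//.
  have := AC (w - latvec f); have := Ac f fn.
  have := ler_wpM2l c0 fw; have := ler_wpM2l C0 wf; rewrite wE.
  move: Kp; nra.
have iter j : forall y, enorm (A *m y) <=
    (8 / 7 * c + Num.sqrt (frob A) * 8^-1 ^+ j) * enorm y.
  have F0 := sqrtr_ge0 (frob A).
  elim: j => [|j IH] y.
    rewrite expr0 mulr1 (le_trans (enorm_frob _ _))// ler_wpM2r ?enorm_ge0//.
    by rewrite lerDr mulr_ge0.
  have C0 : 0 <= 8 / 7 * c + Num.sqrt (frob A) * 8^-1 ^+ j.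
    by rewrite addr_ge0 ?mulr_ge0// ?exprn_ge0// invr_ge0.
  apply: le_trans (step _ C0 IH y) _; rewrite ler_wpM2r ?enorm_ge0//.
  by rewrite exprS; lra.
move=> y; apply: (@le_geom _ _ (Num.sqrt (frob A) * enorm y)) => j.
by apply: le_trans (iter j y) _; rewrite mulrDl [X in _ + X <= _]mulrAC.
Qed.

(** At radius [8 sqrt k] the rounded vector keeps norm at least [7 sqrt k] and the rounding error
    costs at most [C sqrt k]. *)
Lemma net_lower m (A : 'M[R]_(m, k)) (b C : R) : 0 <= b -> 0 <= C ->
  (forall f, innet f -> b * enorm (latvec f) <= enorm (A *m latvec f)) ->
  (forall y, enorm (A *m y) <= C * enorm y) ->
  forall y, (7 * b - C) / 8 * enorm y <= enorm (A *m y).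
Proof.
move=> b0 C0 Ab AC y; have [->|/scale[e [w [e0 -> wE]]]] := eqVneq y 0.
  by rewrite mulmx0 !enorm0 mulr0.
rewrite -scalemxAr !enormZ mulrCA ler_wpM2l//.
have [|f [fn fw wf]] := @net_round w; first by rewrite wE.
have h1 : enorm w <= enorm (latvec f) + enorm (w - latvec f).
  by rewrite -[w in leLHS](subrK (latvec f)) addrC (le_trans (enormD _ _)).
have h2 : enorm (A *m latvec f) <= enorm (A *m w) + enorm (A *m (w - latvec f)).
  rewrite -[latvec f in leLHS](subKr w) mulmxBr (le_trans (enormB _ _))//.
have := AC (w - latvec f); have := Ab f fn; have := ler_wpM2l C0 wf.
have h3 : 7 * K <= enorm (latvec f) by rewrite wE in h1; lra.
have := ler_wpM2l b0 h3; rewrite wE; lra.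
Qed.

End net.

(** * Independence and deviation bounds *)

Section independence.
Context d (T : measurableType d) (R : realType) (P : probability T R).
Local Open Scope ereal_scope.

Section two.
Variables X Y : T -> R.
Hypotheses (mX : measurable_fun setT X) (mY : measurable_fun setT Y).
Hypothesis XY : independent2 P X Y.

Let pX : {mfun T >-> R} := HB.pack X (isMeasurableFun.Build _ _ _ _ _ mX).
Let pY : {mfun T >-> R} := HB.pack Y (isMeasurableFun.Build _ _ _ _ _ mY).
Let m1 := distribution P (pX : {RV P >-> R}).
Let m2 := distribution P (pY : {RV P >-> R}).

Let mXY : measurable_fun setT (fun w => (X w, Y w)).
Proof. exact: measurable_fun_pair. Qed.

(** Independence is the equality of the joint law and the product law on rectangles; uniqueness of
    the product measure extends it. *)
Let m'E A : measurable A -> (m1 \x m2) A = pushforward P (fun w => (X w, Y w)) A.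
Proof.
move=> mA.
pose p : {mfun T >-> (R * R)%type} :=
  HB.pack (fun w => (X w, Y w)) (isMeasurableFun.Build _ _ _ _ _ mXY).
change ((m1 \x m2) A = distribution P (p : {RV P >-> (R * R)%type}) A).
by apply: product_measure_unique => // B C mB mC.
Qed.

Let mf : measurable_fun setT (fun z : R * R => (z.1 * z.2)%:E).
Proof.
apply/measurable_EFinP; apply: measurable_funM; [exact: measurable_fst|exact: measurable_snd].
Qed.

Let ge0_prod (f : R * R -> \bar R) : measurable_fun setT f -> (forall z, 0 <= f z) ->
  \int[P]_w f (X w, Y w) = \int[m1]_x \int[m2]_y f (x, y).
Proof.
move=> mff f0; rewrite -fubini_tonelli1//.
rewrite (eq_measure_integral (pushforward P (fun w => (X w, Y w)))); last first.
  by move=> A mA _; exact: m'E.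
by rewrite ge0_integral_pushforward.
Qed.

Let absE : \int[P]_w `|X w * Y w|%:E = (\int[P]_w `|X w|%:E) * (\int[P]_w `|Y w|%:E).
Proof.
pose f (z : R * R) := `|z.1 * z.2|%:E.
have mff : measurable_fun setT f.
  apply/measurable_EFinP; apply: (measurableT_comp (@normr_measurable R setT)).
  exact/measurable_EFinP.
rewrite (ge0_prod mff) => [|z]; last by rewrite lee_fin.
have ma : measurable_fun [set: R] (fun y : R => `|y|%:E).
  by apply/measurable_EFinP; exact: normr_measurable.
have E (x : R) : \int[m2]_y f (x, y) = `|x|%:E * \int[m2]_y `|y|%:E.
  rewrite -ge0_integralZl//; apply: eq_integral => y _.
  by rewrite /f normrM EFinM.
rewrite (eq_integral (fun x : R => `|x|%:E * \int[m2]_y `|y|%:E)); last by move=> x _; exact: E.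
rewrite ge0_integralZr//; last by apply: integral_ge0.
by rewrite !ge0_integral_distribution.
Qed.

Lemma indep_ge0_expectationM : (forall w, 0 <= X w)%R -> (forall w, 0 <= Y w)%R ->
  \int[P]_w (X w * Y w)%:E = (\int[P]_w (X w)%:E) * (\int[P]_w (Y w)%:E).
Proof.
move=> X0 Y0; have := absE.
under eq_integral do rewrite ger0_norm ?mulr_ge0//.
under [X in _ = X * _ -> _]eq_integral do rewrite ger0_norm//.
by under [X in _ = _ * X -> _]eq_integral do rewrite ger0_norm//.
Qed.

Hypotheses (iX : P.-integrable setT (EFin \o X)) (iY : P.-integrable setT (EFin \o Y)).

Let fin_abs (Z : T -> R) : P.-integrable setT (EFin \o Z) ->
  \int[P]_w `|Z w|%:E < +oo.
Proof. by case/integrableP. Qed.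

Lemma indep_integrableM : P.-integrable setT (fun w => (X w * Y w)%:E).
Proof.
apply/integrableP; split.
  by apply/measurable_EFinP; exact: measurable_funM.
under eq_integral do rewrite abse_EFin.
rewrite absE lte_mul_pinfty// ?fin_abs//.
  exact: integral_ge0.
by rewrite ge0_fin_numE ?fin_abs//; exact: integral_ge0.
Qed.

Lemma indep_expectationM :
  \int[P]_w (X w * Y w)%:E = (\int[P]_w (X w)%:E) * (\int[P]_w (Y w)%:E).
Proof.
have -> : \int[P]_w (X w * Y w)%:E = \int[m1 \x m2]_z (z.1 * z.2)%:E.
  rewrite [RHS](eq_measure_integral (pushforward P (fun w => (X w, Y w)))); last first.
    by move=> A mA _; exact: m'E.
  by rewrite integral_pushforward//; exact: indep_integrableM.
have imf : (m1 \x m2).-integrable setT (fun z : R * R => (z.1 * z.2)%:E).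
  apply/integrableP; split => //.
  rewrite (eq_measure_integral (pushforward P (fun w => (X w, Y w)))); last first.
    by move=> A mA _; exact: m'E.
  rewrite ge0_integral_pushforward//; last exact: measurableT_comp.
  by have /integrableP[] := indep_integrableM.
rewrite -integral12_prod_meas1//.
have EX : \int[m1]_x x%:E = \int[P]_w (X w)%:E.
  by rewrite integral_distribution.
have EY : \int[m2]_x x%:E = \int[P]_w (Y w)%:E.
  by rewrite integral_distribution.
have iX' : m1.-integrable [set: R] (fun x : R => x%:E).
  exact: (integrable_pushforward mX (@EFin_measurable R setT) iX).
have iY' : m2.-integrable [set: R] (fun x : R => x%:E).
  exact: (integrable_pushforward mY (@EFin_measurable R setT) iY).
have E (x : R) : \int[m2]_y (x * y)%:E = x%:E * \int[m2]_y y%:E.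
  by under eq_integral do rewrite EFinM; rewrite integralZl.
rewrite (eq_integral (fun x : R => x%:E * \int[m2]_y y%:E)); last by move=> x _; exact: E.
have fY : \int[m2]_y y%:E \is a fin_num by exact: integrable_fin_num.
by rewrite -(fineK fY) integralZr// fineK// EX EY.
Qed.
End two.

(** The measures sending [A] to [P (A & B)] and to [P B * P A] are finite and agree on the pi-system
    [G], hence on the sigma-algebra it generates. *)
Lemma prob_indep_sigma (G : set (set T)) (B : set T) :
  G `<=` measurable -> setI_closed G -> G setT -> measurable B ->
  (forall A, G A -> P (A `&` B) = P A * P B) ->
  forall A, <<s G >> A -> P (A `&` B) = P A * P B.
Proof.
move=> Gm GI GT mB GB A sA.
have PBfin : P B \is a fin_num by exact: fin_num_measure.
have PB0 : (0 <= fine (P B))%R by rewrite fine_ge0.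
pose m1 := mrestr P mB.
pose m2 := mscale (NngNum PB0) P.
have := @g_sigma_algebra_measure_unique _ R T G Gm (fun=> setT) (fun=> GT) _ m1 m2 GI.
rewrite bigcup_const//= => /(_ erefl) H.
have {}H : m1 A = m2 A.
  apply: H => // [C GC|_].
    rewrite /m1 /m2 /mrestr /mscale/= GB//.
    by rewrite fineK// muleC.
  rewrite /m1 /mrestr/= (le_lt_trans (probability_le1 _ _)) ?ltry//.
  exact: measurableI.
by move: H; rewrite /m1 /m2 /mrestr /mscale/= fineK// muleC.
Qed.

End independence.

Lemma measurable_prodr d (T : measurableType d) (R : realType) (D : set T)
  (I : Type) (s : seq I) (h : I -> T -> R) :
  (forall i, measurable_fun D (h i)) ->
  measurable_fun D (fun x => \prod_(i <- s) h i x).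
Proof.
move=> mh; elim: s => [|i s IH].
  by under eq_fun do rewrite big_nil; exact: measurable_cst.
under eq_fun do rewrite big_cons; exact: measurable_funM.
Qed.

Section mutual_independence.
Context d (T : measurableType d) (R : realType) (P : probability T R).

(** The second clause of [iid] on its own: it passes to images of the variables by
    [indep_family_comp]. *)
Definition indep_family dS (S : measurableType dS) n (Z : 'I_n -> T -> S) :=
  forall B : 'I_n -> set S, (forall i, measurable (B i)) ->
     P (\bigcap_(i in [set: 'I_n]) (Z i @^-1` B i)) =
     (\prod_(i < n) P (Z i @^-1` B i))%E.

(** The cylinders that constrain only the indices in [r]: a pi-system that makes each [Z i] with [i]
    in [r] measurable. *)
Definition rects dS (S : measurableType dS) n (Z : 'I_n -> T -> S) (r : seq 'I_n) :
    set (set T) :=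
  [set A | exists B : 'I_n -> set S, [/\ forall i, measurable (B i),
     forall i, i \notin r -> B i = setT &
     A = \bigcap_(i in [set: 'I_n]) (Z i @^-1` B i)]].

Section rects.
Context dS (S : measurableType dS) n (Z : 'I_n -> T -> S) (r : seq 'I_n).

Lemma rects_setI : setI_closed (rects Z r).
Proof.
move=> _ _ [B [mB rB ->]] [C [mC rC ->]]; exists (fun i => B i `&` C i); split.
- by move=> i; exact: measurableI.
- by move=> i ir; rewrite rB// rC// setTI.
- by rewrite -bigcapI; apply: eq_bigcapr => i _; rewrite preimage_setI.
Qed.

Lemma rects_setT : rects Z r setT.
Proof.
exists (fun=> setT); split => //.
by apply/esym; rewrite -subTset => w _ i _.
Qed.

Lemma rects_measurable : (forall i, measurable_fun setT (Z i)) ->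
  rects Z r `<=` measurable.
Proof.
move=> mZ _ [B [mB rB ->]]; apply: fin_bigcap_measurable.
  exact: finite_finset.
by move=> i _; rewrite -[_ @^-1` _]setTI; exact: mZ.
Qed.

Lemma rects_comp (i : 'I_n) (B : set S) : i \in r -> measurable B ->
  rects Z r (Z i @^-1` B).
Proof.
move=> ir mB; exists (fun j => if j == i then B else setT); split.
- by move=> j; case: ifP.
- by move=> j; case: eqP => // ->; rewrite ir.
- apply/seteqP; split => [w Bw j _|w]; last by move/(_ i I); rewrite /= eqxx.
  by rewrite /=; case: eqP => // ->.
Qed.
End rects.

Local Open Scope ereal_scope.

Lemma indep_family_seq dS (S : measurableType dS) n (Z : 'I_n -> T -> S)
    (B : 'I_n -> set S) (i : 'I_n) (C : set S) :
  indep_family Z -> (forall i, measurable (B i)) -> B i = setT -> measurable C ->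
  P (\bigcap_(j in [set: 'I_n]) (Z j @^-1` B j) `&` Z i @^-1` C) =
  P (\bigcap_(j in [set: 'I_n]) (Z j @^-1` B j)) * P (Z i @^-1` C).
Proof.
move=> indZ mB Bi mC.
pose B' j := if j == i then C else B j.
have -> : \bigcap_(j in [set: 'I_n]) (Z j @^-1` B j) `&` Z i @^-1` C =
    \bigcap_(j in [set: 'I_n]) (Z j @^-1` B' j).
  apply/seteqP; split => [w [h1 h2] j _|w h].
    by rewrite /B' /=; case: eqP => [->//|_]; exact: h1.
  split; last by have := h i I; rewrite /B'/= eqxx.
  move=> j _; have := h j I; rewrite /B'/=; case: eqP => // ->.
  by rewrite Bi.
rewrite !indZ//; last by move=> j; rewrite /B'; case: ifP.
rewrite (bigD1 i)//= [in RHS](bigD1 i)//= Bi preimage_setT probability_setT mul1e.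
rewrite /B' eqxx muleC; congr (_ * _).
by apply: eq_bigr => j /negbTE ji; rewrite ji.
Qed.

(** Induction on a duplicate-free list of indices: the product over the tail of the list is
    measurable for the sigma-algebra of [rects V r], which is independent of the head variable. *)
Lemma indep_family_expectation_prod n (V : 'I_n -> T -> R) :
  (forall i, measurable_fun setT (V i)) -> (forall i w, (0 <= V i w)%R) ->
  indep_family V ->
  \int[P]_w (\prod_(i < n) V i w)%:E = \prod_(i < n) \int[P]_w (V i w)%:E.
Proof.
move=> mV V0 indV.
suff H : forall r : seq 'I_n, uniq r ->
  \int[P]_w (\prod_(i <- r) V i w)%:E = \prod_(i <- r) \int[P]_w (V i w)%:E.
  by apply: H; exact: index_enum_uniq.
elim=> [_|i r IH /= /andP[ir ur]].
  rewrite !big_nil; under eq_integral do rewrite big_nil.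
  by rewrite integral_cst// mul1e; exact: probability_setT.
rewrite big_cons -(IH ur); under eq_integral do rewrite big_cons.
apply: indep_ge0_expectationM => //; last by move=> w; exact: prodr_ge0.
  exact: measurable_prodr.
move=> C D mC mD; rewrite setIC muleC.
have mVC : measurable (V i @^-1` C) by rewrite -[_ @^-1` _]setTI; exact: mV.
apply: (prob_indep_sigma (rects_measurable mV) (@rects_setI _ _ _ V r) (rects_setT V r) mVC).
  move=> _ [B [mB rB ->]]; apply: indep_family_seq => //.
  exact: rB.
pose TG := g_sigma_algebraType (rects V r).
have mVG j : j \in r -> measurable_fun [set: TG] (V j).
  move=> jr _ E mE; rewrite setTI; apply: sub_sigma_algebra.
  exact: rects_comp.
(* [measurable_prodr] asks for measurability of the factor at every index, so factors outside [r]
   are replaced by 1; the product over [r] is unchanged. *)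
have : measurable_fun [set: TG] (fun w : TG => \prod_(j <- r) (if j \in r then V j w else 1))%R.
  apply: measurable_prodr => j; case jr: (j \in r); [exact: mVG|exact: measurable_cst].
move=> /(_ measurableT _ mD); rewrite setTI.
congr (<<s _ >> _); apply/funext => w /=.
by congr (D _); apply: eq_big_seq => j ->.
Qed.

Lemma prob_indep_sigma2 (G1 G2 : set (set T)) :
  G1 `<=` measurable -> setI_closed G1 -> G1 setT ->
  G2 `<=` measurable -> setI_closed G2 -> G2 setT ->
  (forall A B, G1 A -> G2 B -> P (A `&` B) = P A * P B) ->
  forall A B, <<s G1 >> A -> <<s G2 >> B -> P (A `&` B) = P A * P B.
Proof.
move=> G1m G1I G1T G2m G2I G2T H A B sA sB.
have mB : measurable B by exact: (smallest_sub (@sigma_algebra_measurable _ T) G2m).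
apply: (prob_indep_sigma G1m G1I G1T mB) => // A' GA'.
rewrite setIC muleC.
apply: (prob_indep_sigma G2m G2I G2T _) => //; first exact: G1m.
by move=> B' GB'; rewrite setIC muleC; exact: H.
Qed.

End mutual_independence.

(** * Chernoff bounds for nonnegative variables with an exponential moment *)

Section exp_inequalities.
Variable R : realType.
Implicit Types x y q s V : R.

(** From [expR y >= 1 + y] and [(1 + y) (1 - y + y^2) = 1 + y^3]. *)
Lemma expRN_le_quad y : 0 <= y -> expR (- y) <= 1 - y + y ^+ 2.
Proof.
move=> y0; rewrite expRN.
have h : 1 + y <= expR y by exact: expR_ge1Dx.
rewrite (@le_trans _ _ (1 + y)^-1)//.
  by rewrite lef_pV2 ?posrE ?expR_gt0//; lra.
rewrite -[leLHS]mul1r ler_pdivrMr; last lra.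
have : 0 <= y ^+ 3 by exact: exprn_ge0.
by rewrite !exprS; lra.
Qed.

Lemma expR_le_quad y : 0 <= y -> expR y <= 1 + y + y ^+ 2 * expR y.
Proof.
move=> y0; have e0 := expR_gt0 y.
have h : expR y <= 1 + y * expR y.
  have : 1 - y <= (expR y)^-1 by rewrite -expRN; exact: expR_ge1Dx.
  by rewrite -(ler_pM2r e0) mulVf ?gt_eqF//; lra.
by have := ler_wpM2l y0 h; rewrite expr2; lra.
Qed.

Lemma sqr_le_expR y : 0 <= y -> y ^+ 2 <= 4 * expR y.
Proof.
move=> y0; have h : 1 + y / 2 <= expR (y / 2) by exact: expR_ge1Dx.
have : (y / 2) ^+ 2 <= expR (y / 2) ^+ 2.
  by rewrite ler_pXn2r ?nnegrE ?expR_ge0//; lra.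
have -> : expR (y / 2) ^+ 2 = expR y.
  by rewrite -expRM_natl; congr expR; field.
by rewrite expr_div_n; lra.
Qed.

Lemma sqr_le_expR_div q V : 0 < q -> 0 <= V -> V ^+ 2 <= 4 * q ^+ 2 * expR (V / q).
Proof.
move=> q0 V0; have := @sqr_le_expR (V / q) (divr_ge0 V0 (ltW q0)).
by rewrite expr_div_n ler_pdivrMr ?exprn_gt0// mulrAC.
Qed.

(** The second-order term is expressed by [expR (V / q)], whose expectation is at most 2 in the
    application. The linear term stays on the left so that both sides are nonnegative and can be
    integrated without an integrability argument. *)
Lemma expRN_mul_le q s V : 0 < q -> 0 <= V -> 0 <= s ->
  expR (- (s * V)) + s * V <= 1 + 4 * s ^+ 2 * q ^+ 2 * expR (V / q).
Proof.
move=> q0 V0 s0; have := expRN_le_quad (mulr_ge0 s0 V0).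
have := ler_wpM2l (sqr_ge0 s) (sqr_le_expR_div q0 V0).
by rewrite exprMn; lra.
Qed.

(** The condition on [s] splits the exponent: one half of [V / q] dominates [V ^+ 2], the other half
    dominates [expR (s * V)]. *)
Lemma expR_mul_le q s V : 0 < q -> 0 <= V -> 0 <= s -> s <= (2 * q)^-1 ->
  expR (s * V) <= 1 + s * V + 16 * s ^+ 2 * q ^+ 2 * expR (V / q).
Proof.
move=> q0 V0 s0 sq; have := expR_le_quad (mulr_ge0 s0 V0).
have q20 : 0 < 2 * q by lra.
have h1 := sqr_le_expR_div q20 V0.
have h2 : expR (s * V) <= expR (V / (2 * q)).
  by rewrite ler_expR (mulrC V) ler_wpM2r.
have h3 : V ^+ 2 * expR (s * V) <= 4 * (2 * q) ^+ 2 * expR (V / q).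
  apply: le_trans (ler_pM (sqr_ge0 _) (expR_ge0 _) h1 h2) _.
  have -> : expR (V / q) = expR (V / (2 * q)) * expR (V / (2 * q)).
    by rewrite -expRD; congr expR; field; rewrite gt_eqF.
  by rewrite mulrA.
by have := ler_wpM2l (sqr_ge0 s) h3; rewrite !exprMn; lra.
Qed.

End exp_inequalities.

Section chernoff_bounds.
Context d (T : measurableType d) (R : realType) (P : probability T R).
Local Open Scope ereal_scope.

Lemma indep_family_comp d1 d2 (S : measurableType d1) (S' : measurableType d2) n
    (Z : 'I_n -> T -> S) (f : S -> S') :
  measurable_fun setT f -> indep_family P Z ->
  indep_family P (fun i w => f (Z i w)).
Proof.
move=> mf indZ B mB; apply: (indZ (fun i => f @^-1` B i)) => i.
by rewrite -[_ @^-1` _]setTI; exact: mf.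
Qed.

Lemma measurable_le_set (X : T -> R) (a : R) : measurable_fun setT X ->
  measurable [set w | (a <= X w)%R].
Proof.
move=> mX; rewrite (_ : [set w | _] = X @^-1` `[a, +oo[).
  by rewrite -[_ @^-1` _]setTI; exact: mX.
by apply/seteqP; split => w /=; rewrite in_itv/= andbT.
Qed.

Lemma markov_ge0 (X : T -> R) (a : R) : measurable_fun setT X ->
  (forall w, 0 <= X w)%R -> (0 < a)%R ->
  P [set w | (a <= X w)%R] <= (a^-1)%:E * \int[P]_w (X w)%:E.
Proof.
move=> mX X0 a0; set A := [set w | _].
have mA : measurable A by exact: measurable_le_set.
rewrite -lee_pdivrMl ?invr_gt0// invrK.
rewrite -(integral_cst P mA).
apply: (@le_trans _ _ (\int[P]_(w in A) (X w)%:E)).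
  apply: ge0_le_integral => //.
  - by move=> w _; rewrite lee_fin ltW.
  - by apply/measurable_EFinP; exact: measurable_funTS.
apply: ge0_subset_integral => //; first exact/measurable_EFinP.
by move=> w _; rewrite lee_fin.
Qed.

Lemma lee_prode (I : Type) (s : seq I) (f : I -> \bar R) (c : R) :
  (forall i, 0 <= f i <= c%:E) -> \prod_(i <- s) f i <= (c ^+ size s)%:E.
Proof.
move=> fc; elim: s => [|i s IH]; first by rewrite big_nil expr0.
have /andP[f0 f1] := fc i.
rewrite big_cons exprS EFinM; apply: lee_pmul => //.
by apply: prode_ge0 => j _; have /andP[] := fc j.
Qed.

Section bounds.
Variables (n : nat) (V : 'I_n -> T -> R) (q : R).
Hypotheses (q0 : (0 < q)%R) (mV : forall i, measurable_fun setT (V i)).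
Hypotheses (V0 : forall i w, (0 <= V i w)%R) (indV : indep_family P V).
Hypothesis expV : forall i, \int[P]_w (expR (V i w / q))%:E <= 2%:E.

Let prodf_le (g : R -> R) (c : R) : measurable_fun setT g ->
  (forall x, 0 <= g x)%R -> (forall i, \int[P]_w (g (V i w))%:E <= c%:E) ->
  \int[P]_w (\prod_(i < n) g (V i w))%:E <= (c ^+ n)%:E.
Proof.
move=> mg g0 gc; rewrite indep_family_expectation_prod//.
- rewrite (le_trans (lee_prode _ (c := c) _))//.
    move=> i; rewrite gc andbT; apply: integral_ge0 => w _; exact: g0.
  by rewrite /index_enum -enumT size_enum_ord.
- by move=> i; exact: measurableT_comp.
- exact: indep_family_comp.
Qed.

Let sumE (s : R) w : (\prod_(i < n) expR (s * V i w) = expR (s * \sum_(i < n) V i w))%R.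
Proof. by rewrite mulr_sumr expR_sum. Qed.

(** The sign of [s] is free: positive for upper deviations, negative for lower ones. *)
Lemma chernoff_sum (s c a : R) :
  (forall i, \int[P]_w (expR (s * V i w))%:E <= (expR c)%:E) ->
  P [set w | (a <= s * \sum_(i < n) V i w)%R] <= (expR (n%:R * c - a))%:E.
Proof.
move=> sc.
have mS : measurable_fun setT (fun w => expR (s * \sum_(i < n) V i w)).
  by apply: measurableT_comp => //; apply: measurable_funM => //; exact: measurable_sum.
rewrite (_ : [set w | _] = [set w | expR a <= expR (s * \sum_(i < n) V i w)]%R); last first.
  by apply/seteqP; split => w /=; rewrite ler_expR.
apply: le_trans (markov_ge0 mS (fun w => expR_ge0 _) (expR_gt0 a)) _.
under eq_integral do rewrite -sumE.
rewrite expRD expRN mulrC EFinM expRM_natl; apply: lee_pmul => //.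
- by apply: integral_ge0 => w _; rewrite lee_fin; apply: prodr_ge0 => i _; exact: expR_ge0.
- apply: (@prodf_le (fun x => expR (s * x))) => //.
  by apply: measurableT_comp => //; exact: mulrl_measurable.
Qed.

Lemma expectation_expR_sum_le :
  \int[P]_w (expR ((\sum_(i < n) V i w) / q))%:E <= (2 ^+ n)%:E.
Proof.
under eq_integral do rewrite mulrC -sumE.
apply: (@prodf_le (fun x => expR (q^-1 * x))) => // [|i]; last first.
  by under eq_integral do rewrite mulrC.
by apply: measurableT_comp => //; exact: mulrl_measurable.
Qed.

Hypothesis (q1 : (1 <= q)%R) (EV : forall i, \int[P]_w (V i w)%:E = 1).

Let mexp (s : R) i : measurable_fun setT (fun w => expR (s * V i w)).
Proof. by apply: measurableT_comp => //; exact: measurable_funM. Qed.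

Let int1 : \int[P]_w 1 = 1.
Proof. by rewrite integral_cst// mul1e; exact: probability_setT. Qed.

Let int_bound (g : T -> R) (b e : R) i : measurable_fun setT g ->
  (forall w, 0 <= g w)%R -> (0 <= b)%R -> (0 <= e)%R ->
  (forall w, g w <= 1 + b * V i w + e * expR (V i w / q))%R ->
  \int[P]_w (g w)%:E <= (1 + b + 2 * e)%:E.
Proof.
move=> mg g0 b0 e0 gle.
have mV' : measurable_fun setT (fun w => (b * V i w)%:E).
  by apply/measurable_EFinP; exact: measurable_funM.
have mE' : measurable_fun setT (fun w => (e * expR (V i w / q))%:E).
  apply/measurable_EFinP; apply: measurable_funM => //.
  by under eq_fun do rewrite mulrC; exact: mexp.
apply: (@le_trans _ _ (\int[P]_w (1 + (b * V i w)%:E + (e * expR (V i w / q))%:E))).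
  apply: ge0_le_integral => //.
  - by move=> w _; rewrite lee_fin.
  - exact/measurable_EFinP.
  - by apply: emeasurable_funD => //; apply: emeasurable_funD.
  - by move=> w _; rewrite -!EFinD lee_fin.
rewrite ge0_integralD//; last 3 first.
- by move=> w _; rewrite adde_ge0// lee_fin mulr_ge0.
- exact: emeasurable_funD.
- by move=> w _; rewrite lee_fin mulr_ge0// expR_ge0.
rewrite ge0_integralD//; last by move=> w _; rewrite lee_fin mulr_ge0.
rewrite int1 !EFinD; apply: leeD.
  apply: leeD => //.
  under eq_integral do rewrite EFinM.
  rewrite ge0_integralZl//; [by rewrite EV mule1|exact/measurable_EFinP|].
  by move=> w _; rewrite lee_fin.
under eq_integral do rewrite EFinM.
rewrite ge0_integralZl//.
- by rewrite mulrC EFinM lee_wpmul2l// lee_fin.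
- by apply/measurable_EFinP; under eq_fun do rewrite mulrC; exact: mexp.
Qed.

Lemma upper_deviation :
  P [set w | (2 * n%:R <= \sum_(i < n) V i w)%R] <=
  (expR (- (n%:R / (128 * q ^+ 2))))%:E.
Proof.
(* Makes the second-order term [32 s^2 q^2] equal to [s / 2], so the exponent is
   [n (3 s / 2 - 2 s) = - n / (128 q^2)]. *)
pose s := ((64 * q ^+ 2)^-1)%R.
have q2 : (1 <= q ^+ 2)%R by exact: exprn_ege1.
have qq : (q <= q ^+ 2)%R by rewrite expr2 ler_peMl// ltW.
have s0 : (0 < s)%R by rewrite invr_gt0; lra.
have sq : (s <= (2 * q)^-1)%R by rewrite lef_pV2 ?posrE ?mulr_gt0// ?exprn_gt0//; lra.
have sE : (s * q ^+ 2 = 64^-1)%R by rewrite /s; field; rewrite gt_eqF.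
rewrite (_ : [set w | _] = [set w | s * (2 * n%:R) <= s * \sum_(i < n) V i w]%R); last first.
  by apply/seteqP; split => w /=; rewrite ler_pM2l.
apply: (le_trans (@chernoff_sum s (s + 32 * s ^+ 2 * q ^+ 2)%R (s * (2 * n%:R))%R _)).
  move=> i; apply: le_trans (_ : _ <= (1 + s + 2 * (16 * s ^+ 2 * q ^+ 2))%:E) _.
    apply: (@int_bound _ s (16 * s ^+ 2 * q ^+ 2)%R i) => //.
    - exact: ltW.
    - by rewrite mulr_ge0 ?sqr_ge0// mulr_ge0 ?sqr_ge0.
    - by move=> w; apply: expR_mul_le => //; exact: ltW.
  rewrite lee_fin; apply: le_trans (expR_ge1Dx _); lra.
rewrite lee_fin ler_expR.
have -> : (32 * s ^+ 2 * q ^+ 2 = s / 2)%R by rewrite expr2 -!mulrA sE; field.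
have -> : (n%:R / (128 * q ^+ 2) = n%:R * (s / 2))%R by rewrite /s; field; rewrite gt_eqF.
by rewrite le_eqVlt; apply/orP; left; apply/eqP; field.
Qed.

Lemma lower_deviation :
  P [set w | (\sum_(i < n) V i w <= n%:R / 2)%R] <=
  (expR (- (n%:R / (128 * q ^+ 2))))%:E.
Proof.
(* Makes [8 s^2 q^2] equal to [s / 4], so the exponent is [n (- s + s / 4 + s / 2) = - n s / 4], the
   same rate as for the upper deviation. *)
pose s := ((32 * q ^+ 2)^-1)%R.
have q2 : (1 <= q ^+ 2)%R by exact: exprn_ege1.
have s0 : (0 < s)%R by rewrite invr_gt0; lra.
have sE : (s * q ^+ 2 = 32^-1)%R by rewrite /s; field; rewrite gt_eqF.
rewrite (_ : [set w | _] = [set w | - s * (n%:R / 2) <= - s * \sum_(i < n) V i w]%R); last first.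
  by apply/seteqP; split => w /=; rewrite ler_nM2l// oppr_lt0.
apply: (le_trans (@chernoff_sum (- s)%R (- s + 8 * s ^+ 2 * q ^+ 2)%R (- s * (n%:R / 2))%R _)).
  move=> i; apply: le_trans (_ : _ <= (1 - s + 8 * s ^+ 2 * q ^+ 2)%:E) _; last first.
    by rewrite lee_fin; apply: le_trans (expR_ge1Dx _); lra.
  (* [int_bound] requires a nonnegative linear coefficient, so [s * V] is added to the integrand,
     used with coefficient 0, and its expectation [s] is subtracted afterwards. *)
  have : \int[P]_w (expR (- s * V i w) + s * V i w)%:E <=
      (1 + 0 + 2 * (4 * s ^+ 2 * q ^+ 2))%:E.
    apply: (@int_bound _ 0%R (4 * s ^+ 2 * q ^+ 2)%R i) => //.
    - by apply: measurable_funD => //; exact: measurable_funM.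
    - by move=> w; rewrite addr_ge0 ?expR_ge0// mulr_ge0// ltW.
    - by rewrite mulr_ge0 ?sqr_ge0// mulr_ge0 ?sqr_ge0.
    - by move=> w; rewrite mul0r addr0 mulNr; apply: expRN_mul_le => //; exact: ltW.
  under eq_integral do rewrite EFinD.
  rewrite ge0_integralD//; last 3 first.
  - exact/measurable_EFinP.
  - by move=> w _; rewrite lee_fin mulr_ge0// ltW.
  - by apply/measurable_EFinP; exact: measurable_funM.
  have -> : \int[P]_w (s * V i w)%:E = s%:E.
    under eq_integral do rewrite EFinM.
    rewrite ge0_integralZl//; [by rewrite EV mule1|exact/measurable_EFinP| |].
    + by move=> w _; rewrite lee_fin.
    + by rewrite lee_fin ltW.
  rewrite -leeBrDr// -EFinB => /le_trans; apply; rewrite lee_fin; lra.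
rewrite lee_fin ler_expR.
have -> : (8 * s ^+ 2 * q ^+ 2 = s / 4)%R by rewrite expr2 -!mulrA sE; field.
have -> : (n%:R / (128 * q ^+ 2) = n%:R * (s / 4))%R by rewrite /s; field; rewrite gt_eqF.
by rewrite le_eqVlt; apply/orP; left; apply/eqP; field.
Qed.

End bounds.

End chernoff_bounds.

(** * Whitened sub-gaussian designs *)

Section whitened.
Context d (T : measurableType d) (R : realType) (P : probability T R).
Variables (p : nat) (lambda : p.-tuple R) (X : T -> p.-tuple R) (sx : R).

(* Positions [f j] beyond [p] contribute 0, as [0 / 0 = 0]. *)
Definition whit k (f : 'I_k -> nat) (v : p.-tuple R) (u : 'cV[R]_k) : R :=
  \sum_j v`_(f j) / Num.sqrt lambda`_(f j) * u j 0.

Definition whitc (c : 'I_p -> R) (v : p.-tuple R) : R :=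
  \sum_j c j * (tnth v j / Num.sqrt (tnth lambda j)).

(** Reduces a combination of selected coordinates to a linear form in the whole vector, where the
    covariance and the psi2 norm apply; indices beyond [p] vanish on both sides. *)
Lemma whitE k (f : 'I_k -> nat) (u : 'cV[R]_k) v :
  whit f v u = whitc (fun j => \sum_i (f i == j)%:R * u i 0) v.
Proof.
rewrite /whit /whitc.
under [RHS]eq_bigr do rewrite mulr_suml.
rewrite exchange_big/=; apply: eq_bigr => i _.
have [fp|fp] := ltnP (f i) p; last first.
  rewrite [v`__]nth_default ?size_tuple// !mul0r big1// => j _.
  by rewrite gtn_eqF ?mul0r ?mul0r// (leq_trans _ fp).
rewrite (bigD1 (Ordinal fp))//= eqxx mul1r big1 ?addr0 => [|j ji].
  by rewrite !(tnth_nth 0)/= mulrC.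
rewrite (_ : (f i == j) = false) ?mul0r ?mul0r//.
by apply: contraNF ji => /eqP fij; apply/eqP/val_inj; rewrite /= fij.
Qed.

Lemma sum_select_sqr k (f : 'I_k -> nat) (u : 'cV[R]_k) : injective f ->
  \sum_(j < p) (\sum_i (f i == j)%:R * u i 0) ^+ 2 =
  \sum_i (f i < p)%:R * u i 0 ^+ 2.
Proof.
move=> finj.
transitivity (\sum_(j < p) \sum_i (f i == j)%:R * u i 0 ^+ 2).
  apply: eq_bigr => j _.
  have [/existsP[i /eqP fij]|/existsPn nf] := boolP [exists i, f i == j].
    have nf i' : i' != i -> (f i' == j) = false.
      by move=> i'i; apply: contraNF i'i => /eqP; rewrite -fij => /finj ->.
    rewrite (bigD1 i)//= [in RHS](bigD1 i)//= fij eqxx !mul1r.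
    rewrite big1 => [|i' i'i]; last by rewrite nf// mul0r.
    by rewrite addr0 big1 ?addr0// => i' i'i; rewrite nf// mul0r.
  by rewrite !big1 ?expr0n// => i _; rewrite (negbTE (nf i)) mul0r.
rewrite exchange_big/=; apply: eq_bigr => i _.
have [fp|fp] := ltnP (f i) p.
  rewrite (bigD1 (Ordinal fp))//= eqxx big1 ?addr0// => j ji.
  rewrite (_ : (f i == j) = false) ?mul0r//.
  by apply: contraNF ji => /eqP fij; apply/eqP/val_inj; rewrite /= fij.
rewrite mul0r big1// => j _.
by rewrite gtn_eqF ?mul0r// (leq_trans _ fp).
Qed.

Lemma measurable_whitc c : measurable_fun setT (whitc c).
Proof.
apply: measurable_sum => j; apply: measurable_funM; first exact: measurable_cst.
by apply: measurable_funM; [exact: measurable_tnth|exact: measurable_cst].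
Qed.

Hypothesis l0 : forall j, 0 < tnth lambda j.
Hypothesis mX : measurable_fun setT X.
Hypothesis cov : forall j k, (\int[P]_w (tnth (X w) j * tnth (X w) k)%:E =
  (if j == k then tnth lambda j else 0)%:E)%E.
Hypothesis psi : psi2_vnorm P
  (fun w => mxdiag_col (map_mx (fun l => (Num.sqrt l)^-1) (colt lambda)) *m colt (X w)) = sx%:E.

Let mXj j : measurable_fun setT (fun w => tnth (X w) j).
Proof. exact: (measurableT_comp (measurable_tnth j) mX). Qed.

Lemma integrable_coord_sqr j : P.-integrable setT (fun w => (tnth (X w) j ^+ 2)%:E).
Proof.
apply/integrableP; split.
  by apply/measurable_EFinP; exact: measurable_funX.
under eq_integral => w _ do rewrite gee0_abs ?lee_fin ?sqr_ge0// expr2.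
by rewrite cov eqxx ltry.
Qed.

Lemma integrable_coordM j k :
  P.-integrable setT (fun w => (tnth (X w) j * tnth (X w) k)%:E).
Proof.
have := integrableD measurableT (integrable_coord_sqr j) (integrable_coord_sqr k).
apply: le_integrable => //.
  by apply/measurable_EFinP; exact: measurable_funM.
move=> w _ /=; rewrite ?abse_EFin ?lee_fin.
rewrite [leRHS]ger0_norm ?addr_ge0 ?sqr_ge0// ler_norml; apply/andP.
set a := tnth _ _; set b := tnth _ _.
by have := sqr_ge0 (a - b); have := sqr_ge0 (a + b); split; nra.
Qed.

Lemma whitc_sqr_expectation c :
  (\int[P]_w (whitc c (X w) ^+ 2)%:E = (\sum_j c j ^+ 2)%:E)%E.
Proof.
pose a j k := c j * c k / (Num.sqrt (tnth lambda j) * Num.sqrt (tnth lambda k)).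
have E w : whitc c (X w) ^+ 2 = \sum_j \sum_k a j k * (tnth (X w) j * tnth (X w) k).
  rewrite /whitc expr2 mulr_suml; apply: eq_bigr => j _; rewrite mulr_sumr.
  apply: eq_bigr => k _; rewrite /a invfM; ring.
have iA j k : P.-integrable setT (fun w => (a j k * (tnth (X w) j * tnth (X w) k))%:E).
  under eq_fun do rewrite EFinM; apply: integrableZl => //; exact: integrable_coordM.
under eq_integral do rewrite E -sumEFin.
rewrite integral_sum//; last first.
  move=> j; under eq_fun do rewrite -sumEFin; exact: integrable_sum.
rewrite -sumEFin; apply: eq_bigr => j _.
under eq_integral do rewrite -sumEFin.
rewrite integral_sum//.
have -> : (\sum_(k < p) \int[P]_w (a j k * (tnth (X w) j * tnth (X w) k))%:E =
    \sum_(k < p) (a j k * (if j == k then tnth lambda j else 0))%:E)%E.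
  apply: eq_bigr => k _; under eq_integral do rewrite EFinM.
  by rewrite integralZl//; [rewrite cov EFinM|exact: integrable_coordM].
rewrite (bigD1 j)//= big1 ?adde0 => [|k kj].
  rewrite eqxx /a -[X in _ * X](sqr_sqrtr (ltW (l0 j))); congr EFin.
  by field; rewrite gt_eqF// sqrtr_gt0.
by rewrite eq_sym (negbTE kj) mulr0.
Qed.

Let int_cst (c : R) : (\int[P]_w c%:E = c%:E)%E.
Proof.
rewrite integral_cst//; rewrite -[RHS]mule1; congr (_ * _)%E.
exact: probability_setT.
Qed.

Let zs (s : 'cV[R]_p) w : R :=
  (s^T *m (mxdiag_col (map_mx (fun l => (Num.sqrt l)^-1) (colt lambda)) *m colt (X w))) 0 0
    / enorm s.

Lemma whitc_div_enorm (s : 'cV[R]_p) w : zs s w = whitc (fun j => s j 0 / enorm s) (X w).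
Proof.
rewrite /zs mxE mulr_suml; apply: eq_bigr => j _.
rewrite /mxdiag_col mul_diag_mx !mxE; ring.
Qed.

Let unit (s : 'cV[R]_p) : s != 0 -> 0 < enorm s /\ \sum_j (s j 0 / enorm s) ^+ 2 = 1.
Proof.
move=> s0.
have ep : 0 < enorm s.
  rewrite lt0r enorm_ge0 andbT; apply: contraNneq s0 => s0.
  by apply/eqP; apply: enorm_sq_eq0; rewrite s0 expr0n.
split=> //; under eq_bigr do rewrite expr_div_n.
by rewrite -mulr_suml -enorm_sq divff// expf_neq0// gt_eqF.
Qed.

(** A normalized projection of the whitened vector has second moment 1, so [expR u >= 1 + u] gives
    an expectation of at least [1 + t^-2], which exceeds 2 when [t < 1]. *)
Lemma psi2_norm_ge1 (s : 'cV[R]_p) : s != 0 -> (1 <= psi2_norm P (zs s))%E.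
Proof.
move=> /unit[ep s1]; apply: le_ereal_inf_tmp => _ [t [t0 Et] <-].
rewrite lee_fin leNgt; apply/negP => t1.
move: Et; under eq_fun do rewrite whitc_div_enorm.
set c := (fun j => s j 0 / enorm s).
rewrite unlock => Et.
have mc : measurable_fun setT (fun w => whitc c (X w)) by exact: (measurableT_comp (measurable_whitc c) mX).
have : (\int[P]_w (1 + (whitc c (X w) ^+ 2)%:E * (t ^- 2)%:E) <= 2%:E)%E.
  apply: le_trans Et; apply: ge0_le_integral => //.
  - by move=> w _; rewrite adde_ge0// -EFinM lee_fin mulr_ge0 ?sqr_ge0// invr_ge0 sqr_ge0.
  - apply: emeasurable_funD => //; under eq_fun do rewrite -EFinM.
    by apply/measurable_EFinP; apply: measurable_funM => //; exact: measurable_funX.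
  - apply/measurable_EFinP; apply: measurableT_comp => //.
    by apply: measurable_funM => //; exact: measurable_funX.
  - by move=> w _; rewrite -EFinM -EFinD lee_fin; exact: expR_ge1Dx.
rewrite ge0_integralD//; last 2 first.
- by move=> w _; rewrite -EFinM lee_fin mulr_ge0 ?sqr_ge0// invr_ge0 sqr_ge0.
- under eq_fun do rewrite -EFinM.
  by apply/measurable_EFinP; apply: measurable_funM => //; exact: measurable_funX.
rewrite int_cst ge0_integralZr//; last 3 first.
- by apply/measurable_EFinP; exact: measurable_funX.
- by move=> w _; rewrite lee_fin sqr_ge0.
- by rewrite lee_fin invr_ge0 sqr_ge0.
rewrite whitc_sqr_expectation s1 mul1e -EFinD lee_fin.
have : 1 < t ^- 2 by rewrite invf_gt1 ?exprn_gt0// expr_lt1// ltW.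
lra.
Qed.

Hypothesis p0 : (0 < p)%N.

Lemma psi2_ge1 : 1 <= sx.
Proof.
pose s : 'cV[R]_p := delta_mx (Ordinal p0) 0.
have s0 : s != 0.
  by apply/eqP => /matrixP/(_ (Ordinal p0) 0); rewrite !mxE !eqxx; apply/eqP; rewrite oner_eq0.
rewrite -lee_fin -psi; apply: le_trans (psi2_norm_ge1 s0) _.
by apply: ereal_sup_ubound; exists s.
Qed.

(** The infimum defining the psi2 norm need not be attained, but some admissible [t] lies below
    [2 * sx]; this is the origin of the factor 4, and of [q = 4 * sx ^+ 2] below. *)
Lemma whitc_psi2 (c : 'I_p -> R) (q : R) : 0 < q -> \sum_j c j ^+ 2 <= q ->
  (\int[P]_w (expR (whitc c (X w) ^+ 2 / (4 * sx ^+ 2 * q)))%:E <= 2%:E)%E.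
Proof.
move=> q0 cq.
pose s : 'cV[R]_p := \col_j c j.
have [s0|s0] := eqVneq s 0.
  have cw w : whitc c (X w) = 0.
    apply: big1 => j _; have := congr1 (fun M : 'cV[R]_p => M j 0) s0.
    by rewrite !mxE => ->; rewrite mul0r.
  under eq_integral do rewrite cw expr0n mul0r expR0.
  by rewrite int_cst lee_fin; lra.
have [ep s1] := unit s0.
have sx1 := psi2_ge1.
have sx0 : 0 < sx by exact: lt_le_trans ltr01 sx1.
have : (psi2_norm P (zs s) < (2 * sx)%:E)%E.
  apply: (@le_lt_trans _ _ sx%:E); last by rewrite lte_fin; lra.
  by rewrite -psi; apply: ereal_sup_ubound; exists s.
move=> /ereal_inf_lt[_ [t [t0 Et] <-]]; rewrite lte_fin => tsx.
apply: le_trans Et; rewrite unlock.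
have mc : measurable_fun setT (fun w => whitc c (X w)) by exact: (measurableT_comp (measurable_whitc c) mX).
under [leRHS]eq_integral do rewrite whitc_div_enorm.
apply: ge0_le_integral => //.
- apply/measurable_EFinP; apply: measurableT_comp => //.
  by apply: measurable_funM => //; exact: measurable_funX.
- apply/measurable_EFinP; apply: measurableT_comp => //.
  apply: measurable_funM => //; apply: measurable_funX.
  exact: (measurableT_comp (measurable_whitc _) mX).
- move=> w _; rewrite lee_fin ler_expR.
  have -> : whitc (fun j => s j 0 / enorm s) (X w) = whitc c (X w) / enorm s.
    by rewrite /whitc mulr_suml; apply: eq_bigr => j _; rewrite mxE; ring.
  have es : enorm s ^+ 2 <= q by rewrite enorm_sq; under eq_bigr do rewrite mxE.
  have t2 : t ^+ 2 <= (2 * sx) ^+ 2 by rewrite ler_pXn2r ?nnegrE//; lra.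
  have e2 : 0 < enorm s ^+ 2 by rewrite exprn_gt0.
  have t20 : 0 < t ^+ 2 by rewrite exprn_gt0.
  rewrite expr_div_n.
  rewrite -[X in _ <= X]mulrA -[X in _ <= _ * X]invfM ler_wpM2l ?sqr_ge0//.
  have sxp : 0 < 4 * sx ^+ 2 by rewrite mulr_gt0// exprn_gt0.
  rewrite lef_pV2 ?posrE ?mulr_gt0//.
  have -> : 4 * sx ^+ 2 * q = q * (2 * sx) ^+ 2 by ring.
  by apply: ler_pM => //; exact: ltW.
Qed.

End whitened.

Section whp.
Context d (T : measurableType d) (R : realType) (P : probability T R).

(** The exceptional set is required to be measurable, not [Q]: the events of interest quantify over
    all vectors. *)
Definition whp (c : R) (Q : T -> Prop) :=
  exists B, [/\ measurable B, (P B <= c%:E)%E & forall w, ~ B w -> Q w].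

Lemma whp_set (A : set T) (c : R) (Q : T -> Prop) : measurable A ->
  (P A <= c%:E)%E -> (forall w, ~ A w -> Q w) -> whp c Q.
Proof. by exists A. Qed.

Lemma whp_le (c c' : R) Q : c <= c' -> whp c Q -> whp c' Q.
Proof.
move=> cc [B [mB PB BQ]]; exists B; split=> //.
by apply: le_trans PB _; rewrite lee_fin.
Qed.

Lemma whp_imp (c : R) (Q Q' : T -> Prop) :
  (forall w, Q w -> Q' w) -> whp c Q -> whp c Q'.
Proof. by move=> QQ [B [mB PB BQ]]; exists B; split=> // w /BQ /QQ. Qed.

Lemma whp_and (c1 c2 : R) Q1 Q2 : whp c1 Q1 -> whp c2 Q2 ->
  whp (c1 + c2) (fun w => Q1 w /\ Q2 w).
Proof.
move=> [B1 [mB1 PB1 BQ1]] [B2 [mB2 PB2 BQ2]]; exists (B1 `|` B2); split.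
- exact: measurableU.
- by apply: (le_trans (measureU2 P mB1 mB2)); rewrite EFinD; exact: leeD.
- by move=> w /not_orP[/BQ1 ? /BQ2 ?].
Qed.

Lemma whp_all (I : eqType) (s : seq I) (c : R) (Q : I -> T -> Prop) :
  (forall i, i \in s -> whp c (Q i)) ->
  whp ((size s)%:R * c) (fun w => forall i, i \in s -> Q i w).
Proof.
elim: s => [_|i s IH H].
  by exists set0; split=> //; rewrite measure0 mul0r.
have Hs := IH (fun j js => H j (@mem_behead _ (i :: s) j js)).
have := whp_and (H i (mem_head _ _)) Hs.
rewrite /= -natr1 mulrDl mul1r addrC; apply: whp_imp => w [Qi Qs] j.
by rewrite in_cons => /predU1P[->//|]; exact: Qs.
Qed.

End whp.

(** Each value is compared with the tangent of the exponential at the mean [M]. *)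
Lemma expR_jensen (R : realType) m (w y : 'I_m -> R) : (forall j, 0 <= w j) ->
  \sum_j w j = 1 -> expR (\sum_j w j * y j) <= \sum_j w j * expR (y j).
Proof.
move=> w0 w1; set M := \sum_j w j * y j.
have e0 := expR_ge0 M.
have -> : expR M = \sum_j w j * (expR M * (1 + (y j - M))).
  have -> : \sum_j w j * (expR M * (1 + (y j - M))) =
    expR M * (\sum_j w j + (M - (\sum_j w j) * M)).
    rewrite mulr_suml /M -sumrB -big_split/= mulr_sumr.
    by apply: eq_bigr => j _; rewrite -/M; ring.
  by rewrite w1 mul1r subrr addr0 mulr1.
apply: ler_sum => j _; apply: ler_wpM2l => //.
rewrite -[y j in leRHS](subrK M) [in leRHS]expRD mulrC ler_wpM2r//.
exact: expR_ge1Dx.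
Qed.

(** * High-probability events for the design *)

Section design_events.
Context d (T : measurableType d) (R : realType) (P : probability T R).
Variables (n p : nat) (lambda : p.-tuple R) (x : 'I_n -> T -> p.-tuple R) (sx : R).
Hypothesis (n0 : (0 < n)%N) (p0 : (0 < p)%N).
Hypothesis l0 : forall j, 0 < tnth lambda j.
Hypothesis mx : forall i, measurable_fun setT (x i).
Hypothesis cov : forall i j k, (\int[P]_w (tnth (x i w) j * tnth (x i w) k)%:E =
  (if j == k then tnth lambda j else 0)%:E)%E.
Hypothesis psi : forall i, psi2_vnorm P
  (fun w => mxdiag_col (map_mx (fun l => (Num.sqrt l)^-1) (colt lambda)) *m colt (x i w)) = sx%:E.
Hypothesis indx : indep_family P x.

Let q := 4 * sx ^+ 2.

Lemma subgauss_ge1 : 1 <= sx.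
Proof. exact: (psi2_ge1 l0 (mx (Ordinal n0)) (cov (Ordinal n0)) (psi (Ordinal n0)) p0). Qed.

Let q1 : 1 <= q.
Proof. by have := exprn_ege1 2 subgauss_ge1; rewrite /q; lra. Qed.

Let q0 : 0 < q. Proof. exact: lt_le_trans ltr01 q1. Qed.

Section block.
Variables (k : nat) (f : 'I_k -> nat).
Hypothesis finj : injective f.

Definition zmx (w : T) : 'M[R]_(n, k) :=
  \matrix_(i, j) ((x i w)`_(f j) / Num.sqrt lambda`_(f j)).

Lemma zmxE w u i : (zmx w *m u) i 0 = whit lambda f (x i w) u.
Proof. by rewrite mxE; apply: eq_bigr => j _; rewrite mxE. Qed.

Let whit_sum (u : 'cV[R]_k) :
  \sum_(j < p) (\sum_i (f i == j)%:R * u i 0) ^+ 2 <= enorm u ^+ 2.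
Proof.
rewrite sum_select_sqr// enorm_sq; apply: ler_sum => i _.
by rewrite ler_piMl ?sqr_ge0//; case: (_ < _)%N.
Qed.

Lemma measurable_whit (u : 'cV[R]_k) : measurable_fun setT (fun v => whit lambda f v u).
Proof. by under eq_fun do rewrite whitE; exact: measurable_whitc. Qed.

Lemma whit_psi2 (u : 'cV[R]_k) (b : R) i : 0 < b -> enorm u ^+ 2 <= b ->
  (\int[P]_w (expR (whit lambda f (x i w) u ^+ 2 / b / q))%:E <= 2%:E)%E.
Proof.
move=> b0 ub; under eq_integral do rewrite whitE -mulrA -invfM (mulrC b).
by apply: (whitc_psi2 l0 (mx i) (cov i) (psi i) p0 b0); exact: le_trans (whit_sum u) ub.
Qed.

Lemma whit_sqr_expectation (u : 'cV[R]_k) i : (forall j, f j < p)%N ->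
  (\int[P]_w (whit lambda f (x i w) u ^+ 2)%:E = (enorm u ^+ 2)%:E)%E.
Proof.
move=> fp; under eq_integral do rewrite whitE.
rewrite (whitc_sqr_expectation l0 (mx i) (cov i)) sum_select_sqr// enorm_sq.
by congr EFin; apply: eq_bigr => j _; rewrite fp mul1r.
Qed.

Section scaled.
Variables (u : 'cV[R]_k) (b : R).
Hypotheses (b0 : 0 < b) (ub : enorm u ^+ 2 <= b).

Let V (i : 'I_n) w := whit lambda f (x i w) u ^+ 2 / b.

Let mf : measurable_fun setT (fun v => whit lambda f v u ^+ 2 / b).
Proof. by apply: measurable_funM => //; apply: measurable_funX; exact: measurable_whit. Qed.

Let mV i : measurable_fun setT (V i).
Proof. exact: (measurableT_comp mf (mx i)). Qed.

Let V0 i w : 0 <= V i w. Proof. by rewrite divr_ge0 ?sqr_ge0// ltW. Qed.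

Let indV : indep_family P V.
Proof. exact: indep_family_comp mf indx. Qed.

Let expV i : (\int[P]_w (expR (V i w / q))%:E <= 2%:E)%E.
Proof. exact: whit_psi2. Qed.

Let sumV w : \sum_i V i w = enorm (zmx w *m u) ^+ 2 / b.
Proof. by rewrite enorm_sq mulr_suml; apply: eq_bigr => i _; rewrite zmxE. Qed.

Lemma zmx_expR_expectation :
  (\int[P]_w (expR (enorm (zmx w *m u) ^+ 2 / b / q))%:E <= (2 ^+ n)%:E)%E.
Proof.
under eq_integral do rewrite -sumV.
exact: expectation_expR_sum_le.
Qed.

Lemma measurable_zmx : measurable_fun setT (fun w => enorm (zmx w *m u) ^+ 2 / b).
Proof. by under eq_fun do rewrite -sumV; exact: measurable_sum. Qed.

(** Markov at level [expR (2 n)] against an expectation at most [2 ^ n]. The scale [b] only has to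
    dominate the squared norm of [u], so it can stay positive when the tail signal vanishes. *)
Lemma zmx_upper : whp P (expR (- n%:R)) (fun w => enorm (zmx w *m u) ^+ 2 <= 2 * q * n%:R * b).
Proof.
have mE : measurable_fun setT (fun w => expR (enorm (zmx w *m u) ^+ 2 / b / q)).
  apply: measurableT_comp => //; apply: measurable_funM => //; exact: measurable_zmx.
have e0 := expR_gt0 (2 * n%:R : R).
apply: (whp_set (measurable_le_set (expR (2 * n%:R)) mE)).
  apply: le_trans (markov_ge0 P mE (fun w => expR_ge0 _) e0) _.
  apply: (@le_trans _ _ ((expR (2 * n%:R))^-1%:E * (2 ^+ n)%:E)%E).
    by rewrite lee_wpmul2l ?zmx_expR_expectation// lee_fin invr_ge0 ltW.
  rewrite -EFinM lee_fin -expRN.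
  have -> : (- n%:R : R) = - (2 * n%:R) + n%:R by ring.
  rewrite expRD ler_pM2l ?expR_gt0// -[n%:R]mulr1 expRM_natl.
  by apply: lerXn2r; rewrite ?nnegrE ?expR_ge0//; have := @expR_ge1Dx R 1; lra.
move=> w /=; move/negP; rewrite -ltNge ltr_expR => h.
have : enorm (zmx w *m u) ^+ 2 / b / q <= 2 * n%:R by exact: ltW.
by rewrite ler_pdivrMr// ler_pdivrMr//; lra.
Qed.

Lemma zmx_two_sided : (forall j, f j < p)%N -> enorm u ^+ 2 = b ->
  whp P (2 * expR (- (n%:R / (128 * q ^+ 2))))
    (fun w => n%:R / 2 * b <= enorm (zmx w *m u) ^+ 2 <= 2 * n%:R * b).
Proof.
move=> fp ubE.
have EV i : (\int[P]_w (V i w)%:E = 1)%E.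
  rewrite /V; under eq_integral do rewrite EFinM.
  rewrite ge0_integralZr//; last 3 first.
  - by apply/measurable_EFinP; apply: measurable_funX; exact: (measurableT_comp (measurable_whit u) (mx i)).
  - by move=> w _; rewrite lee_fin sqr_ge0.
  - by rewrite lee_fin invr_ge0 ltW.
  by rewrite whit_sqr_expectation// ubE -EFinM divff// gt_eqF.
have mS := measurable_zmx.
have up := upper_deviation q0 mV V0 indV expV q1 EV.
have lo := lower_deviation q0 mV V0 indV expV q1 EV.
have H1 : whp P (expR (- (n%:R / (128 * q ^+ 2)))) (fun w => enorm (zmx w *m u) ^+ 2 <= 2 * n%:R * b).
  apply: (whp_set _ up).
    by under eq_set do rewrite sumV; exact: measurable_le_set.
  move=> w /=; rewrite sumV => /negP; rewrite -ltNge => /ltW.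
  by rewrite ler_pdivrMr.
have H2 : whp P (expR (- (n%:R / (128 * q ^+ 2)))) (fun w => n%:R / 2 * b <= enorm (zmx w *m u) ^+ 2).
  apply: (whp_set _ lo).
    rewrite (_ : [set w | _] = [set w | - (n%:R / 2) <= - (enorm (zmx w *m u) ^+ 2 / b)]).
      by apply: measurable_le_set; exact: measurable_funN.
    by apply/seteqP; split => w /=; rewrite sumV lerN2.
  move=> w /=; rewrite sumV => /negP; rewrite -ltNge => /ltW.
  by rewrite ler_pdivlMr.
rewrite mulr_natl mulr2n; apply: whp_imp (whp_and H1 H2) => w [h1 h2].
by rewrite h1 h2.
Qed.

End scaled.

(** A union bound over the net transfers the two-sided estimate from fixed vectors to all vectors;
    the net of [R^k] accounts for the factor [2 ^ (66 k)]. *)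
Lemma zmx_isometry : (0 < k)%N -> (forall j, f j < p)%N ->
  whp P (2 ^+ (66 * k) * (2 * expR (- (n%:R / (128 * q ^+ 2)))))
    (fun w => (forall y, enorm (zmx w *m y) <= 3 * Num.sqrt n%:R * enorm y) /\
              (forall y, Num.sqrt n%:R * enorm y <= 3 * enorm (zmx w *m y))).
Proof.
move=> k0 fp.
pose s := enum [pred g : lattice k | innet g].
have ss : (size s)%:R <= 2 ^+ (66 * k) :> R.
  by rewrite -cardE; exact: card_net_le.
apply: (@whp_le _ _ _ _ ((size s)%:R * (2 * expR (- (n%:R / (128 * q ^+ 2)))))).
  by rewrite ler_wpM2r// mulr_ge0// expR_ge0.
pose Q g w := n%:R / 2 * enorm (latvec R g) ^+ 2 <=
   enorm (zmx w *m latvec R g) ^+ 2 <= 2 * n%:R * enorm (latvec R g) ^+ 2.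
apply: (whp_imp _ (@whp_all _ _ _ P _ s _ Q _)); last first.
  move=> g _; have [g0|g0] := eqVneq (latvec R g) 0.
    exists set0; split=> //; first by rewrite measure0 lee_fin mulr_ge0// expR_ge0.
    by move=> w _; rewrite /Q g0 mulmx0 !enorm0 expr0n !mulr0 lexx.
  apply: zmx_two_sided => //; rewrite exprn_gt0// lt0r enorm_ge0 andbT.
  by apply: contraNneq g0 => g0; apply/eqP; apply: enorm_sq_eq0; rewrite g0 expr0n.
move=> w Qw; set r := Num.sqrt n%:R.
have r0 : 0 <= r by exact: sqrtr_ge0.
have rn : r ^+ 2 = n%:R by rewrite sqr_sqrtr.
(* On the net the squared distortions 2 and 1/2 are relaxed to [(3/2)^2] and [(2/3)^2]. [net_upper]
   then gives [12/7 <= 3], and [net_lower] gives [(14/3 - 12/7) / 8 = 31/84], which is above 1/3. *)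
have up g : innet g -> enorm (zmx w *m latvec R g) <= (3 / 2 * r) * enorm (latvec R g).
  move=> ig; have gs : g \in s by rewrite mem_enum.
  apply: enorm_le_sq; first by rewrite !mulr_ge0 ?enorm_ge0.
  have /andP[_ /le_trans] := Qw g gs; apply.
  rewrite !exprMn rn ler_wpM2r ?sqr_ge0// ler_wpM2r//; lra.
have lo g : innet g -> (2 / 3 * r) * enorm (latvec R g) <= enorm (zmx w *m latvec R g).
  move=> ig; have gs : g \in s by rewrite mem_enum.
  rewrite -(@ler_pXn2r _ 2) ?nnegrE ?enorm_ge0 ?mulr_ge0 ?mulr_ge0 ?enorm_ge0//.
  have /andP[+ _] := Qw g gs; apply: le_trans.
  rewrite !exprMn rn ler_wpM2r ?sqr_ge0// mulrC ler_wpM2l//; lra.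
have c0 : 0 <= 3 / 2 * r by rewrite mulr_ge0.
have Up := net_upper k0 c0 up.
split=> y.
  apply: le_trans (Up y) _; rewrite ler_wpM2r ?enorm_ge0//; lra.
have b0 : 0 <= 2 / 3 * r by rewrite mulr_ge0.
have C0 : 0 <= 8 / 7 * (3 / 2 * r) by rewrite mulr_ge0.
have := net_lower k0 b0 C0 lo Up y.
have := enorm_ge0 y; have := enorm_ge0 (zmx w *m y); move: r0; nra.
Qed.

End block.

Section tail.
Variables (dd m : nat).
Hypotheses (m0 : (0 < m)%N) (dm : (dd + m = p)%N).
Let S := \sum_(j < m) lambda`_(dd + j).

Let lpos j : (j < m)%N -> 0 < lambda`_(dd + j).
Proof.
move=> jm; have jp : (dd + j < p)%N by rewrite -dm ltn_add2l.
by have := l0 (Ordinal jp); rewrite (tnth_nth 0).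
Qed.

Let lge0 j : 0 <= lambda`_j.
Proof.
have [jp|jp] := ltnP j p; last by rewrite nth_default// size_tuple.
by have := l0 (Ordinal jp); rewrite (tnth_nth 0) => /ltW.
Qed.

Let S0 : 0 < S.
Proof.
rewrite /S (bigD1 (Ordinal m0))//=; apply: ltr_pwDl; first exact: (lpos m0).
by apply: sumr_ge0 => j _.
Qed.

Definition tailmx (w : T) : 'M[R]_(n, m) := \matrix_(i, j) (x i w)`_(dd + j).

Let mcoord i j : measurable_fun setT (fun w => (x i w)`_j).
Proof.
have [jp|jp] := ltnP j p.
  have E : (fun w => tnth (x i w) (Ordinal jp)) = (fun w => (x i w)`_j).
    by apply/funext => w; rewrite (tnth_nth 0).
  by rewrite -E; exact: (measurableT_comp (measurable_tnth _) (mx i)).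
rewrite (_ : (fun w => _) = cst 0) ?measurable_cst//.
by apply/funext => w; rewrite nth_default// size_tuple.
Qed.

(** The normalized squared length of a tail row is an average of the squared whitened coordinates
    with weights [lambda_j / S]. Jensen therefore transfers the exponential moment from single
    coordinates to the row, without independence between coordinates, and [lower_deviation] applies
    to the independent rows. *)
Lemma tail_trace : whp P (expR (- (n%:R / (128 * q ^+ 2))))
  (fun w => n%:R * S / 2 <= frob (tailmx w)).
Proof.
pose g (v : p.-tuple R) := (\sum_(j < m) v`_(dd + j) ^+ 2) / S.
pose V i w := g (x i w).
have mg : measurable_fun setT g.
  apply: measurable_funM => //; apply: measurable_sum => j; apply: measurable_funX.
  have jp : (dd + j < p)%N by rewrite -dm ltn_add2l.
  have E : (fun v : p.-tuple R => tnth v (Ordinal jp)) = (fun v => v`_(dd + j)).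
    by apply/funext => w; rewrite (tnth_nth 0).
  by rewrite -E; exact: measurable_tnth.
have mV i : measurable_fun setT (V i) by exact: (measurableT_comp mg (mx i)).
have V0 i w : 0 <= V i w.
  by rewrite divr_ge0 ?(ltW S0)//; apply: sumr_ge0 => j _; rewrite sqr_ge0.
have indV : indep_family P V by exact: indep_family_comp mg indx.
pose f (j : nat) (_ : 'I_1) := (dd + j)%N.
have finj j : injective (f j) by move=> a b _; rewrite (ord1 a) (ord1 b).
pose u : 'cV[R]_1 := const_mx 1.
have u1 : enorm u ^+ 2 = 1 by rewrite enorm_sq big_ord1 mxE expr1n.
have fE j v : whit lambda (f j) v u ^+ 2 = v`_(dd + j) ^+ 2 / lambda`_(dd + j).
  rewrite /whit big_ord1 mxE mulr1 expr_div_n sqr_sqrtr//.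
have fexp j i : (\int[P]_w (expR ((x i w)`_(dd + j) ^+ 2 / lambda`_(dd + j) / q))%:E <= 2%:E)%E.
  have := @whit_psi2 _ _ (finj j) u 1 i ltr01; rewrite u1 => /(_ (lexx _)).
  by under eq_integral do rewrite fE divr1.
have f2 (j : 'I_m) i : (\int[P]_w ((x i w)`_(dd + j) ^+ 2)%:E = (lambda`_(dd + j))%:E)%E.
  have fp a : (f j a < p)%N by rewrite /f -dm ltn_add2l.
  have := whit_sqr_expectation (finj j) u i fp; rewrite u1.
  under eq_integral do rewrite fE EFinM.
  rewrite ge0_integralZr//; last 3 first.
  - by apply/measurable_EFinP; apply: measurable_funX.
  - by move=> w _; rewrite lee_fin sqr_ge0.
  - by rewrite lee_fin invr_ge0.
  move=> H; have lj := lpos (ltn_ord j).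
  rewrite -[RHS]mul1e -H -muleA -EFinM mulVf ?mule1//.
  by rewrite gt_eqF.
have EV i : (\int[P]_w (V i w)%:E = 1)%E.
  rewrite /V /g; under eq_integral do rewrite EFinM.
  have mterm (j : 'I_m) : measurable_fun setT (fun w => ((x i w)`_(dd + j) ^+ 2)%:E).
    by apply/measurable_EFinP; apply: measurable_funX.
  rewrite ge0_integralZr//; last 3 first.
  - by apply/measurable_EFinP; apply: measurable_sum => j; apply: measurable_funX.
  - by move=> w _; rewrite lee_fin; apply: sumr_ge0 => j _; rewrite sqr_ge0.
  - by rewrite lee_fin invr_ge0 ltW.
  under eq_integral do rewrite -sumEFin.
  rewrite ge0_integral_sum//; last by move=> j w _; rewrite lee_fin sqr_ge0.
  under eq_bigr do rewrite f2.
  by rewrite sumEFin -EFinM divff// gt_eqF.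
have wsum : \sum_(j < m) lambda`_(dd + j) / S = 1.
  by rewrite -mulr_suml divff// gt_eqF.
have expV i : (\int[P]_w (expR (V i w / q))%:E <= 2%:E)%E.
  have mterm (j : 'I_m) : measurable_fun setT (fun w => (lambda`_(dd + j) / S * expR ((x i w)`_(dd + j) ^+ 2 / lambda`_(dd + j) / q))%:E).
    apply/measurable_EFinP; apply: measurable_funM => //; apply: measurableT_comp => //.
    by apply: measurable_funM => //; apply: measurable_funM => //; apply: measurable_funX.
  apply: (@le_trans _ _ (\int[P]_w (\sum_(j < m) (lambda`_(dd + j) / S * expR ((x i w)`_(dd + j) ^+ 2 / lambda`_(dd + j) / q))%:E))%E).
    apply: ge0_le_integral => //.
    - apply/measurable_EFinP; apply: measurableT_comp => //.
      by apply: measurable_funM.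
    - exact: emeasurable_sum.
    - move=> w _; rewrite sumEFin lee_fin.
      apply: le_trans (expR_jensen (w := fun j : 'I_m => lambda`_(dd + j) / S) _ _ wsum).
        rewrite ler_expR /V /g -mulrA mulr_suml le_eqVlt; apply/orP; left; apply/eqP.
        apply: eq_bigr => j _; field.
        by rewrite !gt_eqF ?lpos.
      by move=> j; rewrite divr_ge0// ltW.
  rewrite ge0_integral_sum//; last first.
    by move=> j w _; rewrite lee_fin mulr_ge0 ?expR_ge0// divr_ge0// ltW.
  rewrite (_ : 2%:E = (\sum_(j < m) (lambda`_(dd + j) / S * 2)%:E)%E); last first.
    by rewrite sumEFin -mulr_suml wsum mul1r.
  apply: lee_sum => j _; under eq_integral do rewrite EFinM.
  rewrite ge0_integralZl//; last 2 first.
  - apply/measurable_EFinP; apply: measurableT_comp => //.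
    by apply: measurable_funM => //; apply: measurable_funM => //; apply: measurable_funX.
  - by rewrite lee_fin divr_ge0// ltW.
  by rewrite [X in (_ <= X)%E]EFinM lee_wpmul2l// lee_fin divr_ge0// ltW.
have lo := lower_deviation q0 mV V0 indV expV q1 EV.
have sumVE w : \sum_i V i w = frob (tailmx w) / S.
  rewrite /frob mulr_suml; apply: eq_bigr => i _; congr (_ / _).
  by apply: eq_bigr => j _; rewrite mxE.
apply: (whp_set _ lo).
  rewrite (_ : [set w | _] = [set w | - (n%:R / 2) <= - (\sum_(i < n) V i w)]).
    by apply: measurable_le_set; apply: measurable_funN; exact: measurable_sum.
  by apply/seteqP; split => w /=; rewrite lerN2.
move=> w /=; rewrite sumVE => /negP; rewrite -ltNge => /ltW.
by rewrite ler_pdivlMr//; lra.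
Qed.

End tail.

End design_events.

(** * Operator norm of the tail columns *)

Lemma sum_blocks (R : realType) (n N : nat) (F : nat -> R) :
  \sum_(b < N) \sum_(k < n) F (b * n + k)%N = \sum_(j < N * n) F j.
Proof.
elim: N => [|N IH]; first by rewrite !big_ord0.
by rewrite big_ord_recr/= IH mulSnr big_split_ord.
Qed.

(** The term 1 accounts for the default value 0 of the maximum. *)
Lemma expR_bigmax_le (R : realType) (I : Type) (s : seq I) (F : I -> R) :
  expR (\big[Num.max/0]_(i <- s) F i) <= 1 + \sum_(i <- s) expR (F i).
Proof.
elim: s => [|i s IH]; first by rewrite !big_nil expR0 addr0.
have S0 : 0 <= \sum_(j <- s) expR (F j) by apply: sumr_ge0 => j _; exact: expR_ge0.
have e0 := expR_ge0 (F i).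
by rewrite !big_cons maxEle; case: ifP => _; lra.
Qed.

Lemma block_operator_le (R : realType) (n m k : nat) (A : 'I_m -> 'M[R]_(n, k))
    (u : 'I_m -> 'cV[R]_k) (c : 'I_m -> R) (e : 'I_m -> R) :
  (forall b, enorm (A b *m u b) <= c b * e b) ->
  enorm (\sum_b A b *m u b) ^+ 2 <= (\sum_b c b ^+ 2) * (\sum_b e b ^+ 2).
Proof.
move=> Ac; apply: le_trans (sum_mul_sqr_le c e).
have H (s : seq 'I_m) : enorm (\sum_(b <- s) A b *m u b) <= \sum_(b <- s) c b * e b.
  elim: s => [|b s IH]; first by rewrite !big_nil enorm0.
  by rewrite !big_cons; apply: le_trans (enormD _ _) _; apply: lerD.
have h := H (index_enum 'I_m).
by rewrite ler_pXn2r ?nnegrE ?enorm_ge0// (le_trans _ h)// enorm_ge0.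
Qed.

(* The tail columns are cut into blocks of [n]. A net of R^n controls each block,
   but there may be arbitrarily many blocks, so their maxima [Bm b] are not
   combined by a union bound: with weights [wt b] of sum at most 1, Jensen bounds
   the exponential of the weighted mean of the maxima. *)
Section tail_operator.
Context d (T : measurableType d) (R : realType) (P : probability T R).
Variables (n p : nat) (lambda : p.-tuple R) (x : 'I_n -> T -> p.-tuple R) (sx : R).
Hypothesis (n0 : (0 < n)%N) (p0 : (0 < p)%N).
Hypothesis l0 : forall j, 0 < tnth lambda j.
Hypothesis mx : forall i, measurable_fun setT (x i).
Hypothesis cov : forall i j k, (\int[P]_w (tnth (x i w) j * tnth (x i w) k)%:E =
  (if j == k then tnth lambda j else 0)%:E)%E.
Hypothesis psi : forall i, psi2_vnorm P
  (fun w => mxdiag_col (map_mx (fun l => (Num.sqrt l)^-1) (colt lambda)) *m colt (x i w)) = sx%:E.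
Hypothesis indx : indep_family P x.
Variables (dd m : nat).
Hypotheses (m0 : (0 < m)%N) (dm : (dd + m = p)%N).
Let S := \sum_(j < m) lambda`_(dd + j).
Hypothesis ldec : forall i j, (i <= j)%N -> lambda`_j <= lambda`_i.
Hypothesis nS : n%:R * lambda`_dd <= S.

Let q := 4 * sx ^+ 2.
Let nR : 0 < n%:R :> R. Proof. by rewrite ltr0n. Qed.

Let q1 : 1 <= q.
Proof.
by have := exprn_ege1 2 (subgauss_ge1 n0 p0 l0 mx cov psi); rewrite /q; lra.
Qed.

Let q0 : 0 < q. Proof. exact: lt_le_trans ltr01 q1. Qed.

Let lge0 j : 0 <= lambda`_j.
Proof.
have [jp|jp] := ltnP j p; last by rewrite nth_default// size_tuple.
by have := l0 (Ordinal jp); rewrite (tnth_nth 0) => /ltW.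
Qed.

Let ldd : 0 < lambda`_dd.
Proof.
have jp : (dd < p)%N by rewrite -dm -ltn_subLR// subnn.
by have := l0 (Ordinal jp); rewrite (tnth_nth 0).
Qed.

Let S0 : 0 < S. Proof. by apply: lt_le_trans nS; rewrite mulr_gt0. Qed.

Let sum_le_S N : \sum_(j < N) lambda`_(dd + j) <= S.
Proof.
rewrite /S -!(big_mkord xpredT (fun j => lambda`_(dd + j))).
have [Nm|Nm] := leqP N m.
  by rewrite (@big_cat_nat _ _ _ N 0 m)//= lerDl sumr_ge0.
rewrite (@big_cat_nat _ _ _ m 0 N)//= ?(ltnW Nm)// (big_nat_cond _ _ m) [X in _ + X]big1 ?addr0//.
by move=> j /andP[/andP[mj _] _]; rewrite nth_default// size_tuple -dm leq_add2l.
Qed.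

Let bl (b : 'I_m) := lambda`_(dd + b * n).

(** The leading eigenvalue of the first block costs at most [S] by [nS]; that of each later block is
    dominated by every eigenvalue of the preceding block, so those terms together cost at most the
    trace [S]. Indices past [p] contribute 0. *)
Let sum_bl : n%:R * \sum_b bl b <= 2 * S.
Proof.
rewrite /bl -(big_mkord xpredT (fun b => lambda`_(dd + b * n))) big_ltn// big_add1.
rewrite mulrDr mul0n addn0 big_mkord.
have -> : 2 * S = S + S by ring.
apply: lerD => //; rewrite mulr_sumr.
apply: le_trans (sum_le_S (m.-1 * n)).
rewrite -(@sum_blocks _ _ _ (fun j => lambda`_(dd + j))).
apply: ler_sum => b _.
rewrite (@le_trans _ _ (\sum_(k < n) lambda`_(dd + b.+1 * n)))//.
  by rewrite sumr_const card_ord mulr_natl.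
apply: ler_sum => k _; apply: ldec; rewrite leq_add2l mulSn addnC leq_add2r.
exact: ltnW.
Qed.

Let fb (b : 'I_m) (k : 'I_n) := (dd + (b * n + k))%N.

Let fbinj b : injective (fb b).
Proof. by move=> j k /addnI/addnI/val_inj. Qed.

Let Zb b w := zmx lambda x (fb b) w.

Let s := enum [pred g : lattice n | innet g && (latvec R g != 0)].

Let s_le : (size s)%:R <= 2 ^+ (66 * n) :> R.
Proof.
apply: le_trans (card_net_le R n); rewrite ler_nat -cardE.
by apply: subset_leq_card; apply/fintype.subsetP => g /andP[].
Qed.

Let F b g w := enorm (Zb b w *m latvec R g) ^+ 2 / enorm (latvec R g) ^+ 2 / q.

Let Bm b w := \big[Num.max/0]_(g <- s) F b g w.

Let Tb b w := 1 + \sum_(g <- s) expR (F b g w).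

Let wt b := n%:R * bl b / (2 * S).

Let Tt w := \sum_b wt b * Tb b w.

Let wt_ge0 b : 0 <= wt b.
Proof.
by apply: divr_ge0; apply: mulr_ge0 => //; [exact: lge0|exact: ltW].
Qed.

Let wt_sum : \sum_b wt b <= 1.
Proof.
rewrite /wt -mulr_suml -mulr_sumr ler_pdivrMr ?mulr_gt0// mul1r.
exact: sum_bl.
Qed.

Let latpos g : g \in s -> 0 < enorm (latvec R g) ^+ 2.
Proof.
rewrite mem_enum => /andP[_ g0]; rewrite exprn_gt0// lt0r enorm_ge0 andbT.
by apply: contraNneq g0 => g0; apply/eqP; apply: enorm_sq_eq0; rewrite g0 expr0n.
Qed.

Let Bm_le b w g : innet g ->
  enorm (Zb b w *m latvec R g) <= Num.sqrt (q * Bm b w) * enorm (latvec R g).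
Proof.
move=> ig; have B0 : 0 <= Bm b w by exact: bigmax_ge_id.
have [g0|g0] := eqVneq (latvec R g) 0; first by rewrite g0 mulmx0 !enorm0 mulr0.
have gs : g \in s by rewrite mem_enum/= inE ig.
apply: enorm_le_sq; first by rewrite mulr_ge0 ?sqrtr_ge0 ?enorm_ge0.
rewrite exprMn (sqr_sqrtr (mulr_ge0 (ltW q0) B0)).
rewrite -ler_pdivrMr ?latpos// [q * _]mulrC -ler_pdivrMr//.
exact: (@le_bigmax_seq _ _ _ s 0 g xpredT (fun g => F b g w) gs isT).
Qed.

Let Zb_le b w y : enorm (Zb b w *m y) <= 8 / 7 * Num.sqrt (q * Bm b w) * enorm y.
Proof. by apply: net_upper => // g; exact: Bm_le. Qed.

Let mF b g : g \in s -> measurable_fun setT (F b g).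
Proof.
move=> gs; apply: measurable_funM => //.
rewrite /Zb; apply: (@measurable_zmx _ _ _ _ _ lambda x mx _ (fb b)).
Qed.

Let expF b g : g \in s -> (\int[P]_w (expR (F b g w))%:E <= (2 ^+ n)%:E)%E.
Proof.
move=> gs; rewrite /F /q /Zb.
exact: (zmx_expR_expectation p0 l0 mx cov psi indx (@fbinj b) (latpos gs) (lexx _)).
Qed.

Let mexpF b g : g \in s -> measurable_fun setT (fun w => (expR (F b g w))%:E).
Proof. by move=> gs; apply/measurable_EFinP; apply: measurableT_comp => //; exact: mF. Qed.

Let mTb b : measurable_fun setT (Tb b).
Proof.
apply: measurable_funD => //.
rewrite (_ : (fun w => _) = fun w => \sum_(g <- s) (if g \in s then expR (F b g w) else 0)).
  apply: measurable_sum => g; case gs: (g \in s) => //.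
  by apply: measurableT_comp => //; exact: mF.
by apply/funext => w; apply: eq_big_seq => g ->.
Qed.

Let Tb_ge0 b w : 0 <= Tb b w.
Proof. by rewrite addr_ge0// sumr_ge0// => g _; exact: expR_ge0. Qed.

(** At most [2 ^ (66 n)] net points, each with expectation at most [2 ^ n]; the extra factor [2 ^ n]
    absorbs the leading 1. *)
Let ETb b : (\int[P]_w (Tb b w)%:E <= (2 ^+ (68 * n))%:E)%E.
Proof.
rewrite /Tb; under eq_integral do rewrite EFinD big_seq -sumEFin.
have mS : measurable_fun setT (fun w => (\sum_(g <- s | g \in s) (expR (F b g w))%:E)%E).
  rewrite (_ : (fun w => _) = fun w => (\sum_(g <- s) (if g \in s then (expR (F b g w))%:E else 0))%E).
    by apply: emeasurable_sum => g; case gs: (g \in s) => //; exact: mexpF.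
  by apply/funext => w; rewrite -big_mkcond.
rewrite ge0_integralD//; last first.
  by move=> w _; apply: sume_ge0 => g _; rewrite lee_fin expR_ge0.
have -> : (\int[P]_w 1%:E = 1)%E.
  by rewrite integral_cst// mul1e; exact: probability_setT.
have -> : (\int[P]_w (\sum_(g <- s | g \in s) (expR (F b g w))%:E) =
    \sum_(g <- s | g \in s) \int[P]_w (expR (F b g w))%:E)%E.
  under eq_integral do rewrite big_mkcond/=.
  rewrite ge0_integral_sum//; first last.
  - by move=> g w _; case: ifP => // _; rewrite lee_fin expR_ge0.
  - by move=> g; case gs: (g \in s) => //; exact: mexpF.
  rewrite [RHS]big_mkcond/=; apply: eq_bigr => g _.
  by case: ifP => // _; rewrite integral0.
apply: (@le_trans _ _ (1 + \sum_(g <- s | g \in s) (2 ^+ n)%:E)%E).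
  by apply: leeD => //; apply: lee_sum => g; exact: expF.
rewrite sumEFin -EFinD lee_fin -big_seq big_const_seq count_predT iter_addr_0.
rewrite -[_ *+ size s]mulr_natl.
have h : (size s)%:R * 2 ^+ n <= 2 ^+ (66 * n) * 2 ^+ n :> R.
  by rewrite ler_wpM2r// exprn_ge0.
apply: (@le_trans _ _ (1 + 2 ^+ (66 * n) * 2 ^+ n)); first by rewrite lerD2l.
rewrite -exprD.
have E : (68 * n = (66 * n + n) + n)%N by rewrite -!mulSnr.
rewrite [X in _ <= 2 ^+ X]E [leRHS]exprD.
have h1 : 1 <= 2 ^+ (66 * n + n) :> R by rewrite exprn_ege1// ler1n.
have h2 : 2 <= 2 ^+ n :> R by rewrite -{1}[2]expr1 ler_eXn2l// ltr1n.
by have := ler_wpM2l (le_trans ler01 h1) h2; lra.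
Qed.

Let ETt : (\int[P]_w (Tt w)%:E <= (2 ^+ (68 * n))%:E)%E.
Proof.
rewrite /Tt; under eq_integral do rewrite -sumEFin.
rewrite ge0_integral_sum//; last 2 first.
- by move=> b; apply/measurable_EFinP; exact: measurable_funM.
- by move=> b w _; rewrite lee_fin mulr_ge0.
apply: (@le_trans _ _ (\sum_(b < m) (wt b * 2 ^+ (68 * n))%:E)%E).
  apply: lee_sum => b _; under eq_integral do rewrite EFinM.
  rewrite ge0_integralZl//; first by rewrite [X in (_ <= X)%E]EFinM lee_wpmul2l// lee_fin.
  - exact/measurable_EFinP.
  - by move=> w _; rewrite lee_fin.
  - by rewrite lee_fin.
by rewrite sumEFin lee_fin -mulr_suml ler_piMl// exprn_ge0.
Qed.

Let mTt : measurable_fun setT Tt.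
Proof. by apply: measurable_sum => b; exact: measurable_funM. Qed.

(** One more [n] than the exponent in [ETt], so that Markov at level [expR L] fails with probability
    at most [expR (- n)]. *)
Let L : R := 69 * n%:R.

(** Jensen with the tangent of the exponential at [L] instead of at the mean. The weights sum to at
    most 1, possibly less; as [L >= 1], the term [(L - 1)] times their sum is still at most [L - 1],
    and the weighted mean of the maxima is at most [L]. Undoing the weights gives [138 = 2 * 69]. *)
Let sum_Bm w : Tt w <= expR L -> \sum_b bl b * Bm b w <= 138 * S.
Proof.
move=> TL; have eL := expR_gt0 L.
have h1 : \sum_b wt b * (expR L * (1 + (Bm b w - L))) <= expR L.
  apply: le_trans TL; apply: ler_sum => b _; rewrite ler_wpM2l//.
  apply: (@le_trans _ _ (expR (Bm b w))); last exact: expR_bigmax_le.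
  rewrite -[X in _ <= expR X](subrK L) [X in _ <= X]expRD [X in X <= _]mulrC ler_wpM2r ?(ltW eL)//.
  exact: expR_ge1Dx.
have L1 : 1 <= L by rewrite /L; have : 1 <= n%:R :> R by [rewrite ler1n]; lra.
have h2 : \sum_b wt b * Bm b w <= L.
  have E : \sum_b wt b * (expR L * (1 + (Bm b w - L))) =
     expR L * (\sum_b wt b * Bm b w - (L - 1) * \sum_b wt b).
    rewrite mulr_sumr -sumrB mulr_sumr; apply: eq_bigr => b _; ring.
  rewrite E -[leRHS]mulr1 ler_pM2l// in h1.
  have : (L - 1) * \sum_b wt b <= L - 1 by rewrite ler_piMr// subr_ge0.
  by lra.
have E : \sum_b bl b * Bm b w = 2 * S / n%:R * \sum_b wt b * Bm b w.
  rewrite mulr_sumr; apply: eq_bigr => b _; rewrite /wt; field.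
  by rewrite !gt_eqF// (gt_eqF S0).
rewrite E (_ : 138 * S = 2 * S / n%:R * L).
  by rewrite ler_wpM2l// divr_ge0// mulr_ge0// ltW.
by rewrite /L; field; rewrite gt_eqF.
Qed.

(** The vector is padded by zeros to [m] blocks of length [n], which is enough because [n >= 1];
    design entries beyond [p] read as 0. *)
Let tailmx_blocks w (th : 'cV[R]_m) :
  let th' j := if insub j is Some j' then th j' 0 else 0 in
  let u b : 'cV[R]_n := \col_k (Num.sqrt lambda`_(fb b k) * th' (b * n + k)%N) in
  tailmx x dd m w *m th = \sum_(b < m) Zb b w *m u b.
Proof.
move=> th' u; apply/matrixP => i j0; rewrite ord1 {j0} summxE.
transitivity (\sum_(j < m * n) (x i w)`_(dd + j) * th' j).
  rewrite mxE -!(big_mkord xpredT (fun j => (x i w)`_(dd + j) * th' j)).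
  rewrite (@big_cat_nat _ _ _ m 0 (m * n))//= ?leq_pmulr// [X in _ + X]big_nat_cond.
  rewrite [X in _ + X]big1 ?addr0 => [|j /andP[/andP[mj _] _]]; last first.
    by rewrite nth_default ?mul0r// size_tuple -dm leq_add2l.
  rewrite big_mkord; apply: eq_bigr => j _; rewrite mxE /th' insubT//= => jm.
  by congr (_ * th _ _); apply: val_inj.
rewrite -(@sum_blocks _ _ _ (fun j => (x i w)`_(dd + j) * th' j)).
apply: eq_bigr => b _; rewrite mxE; apply: eq_bigr => k _; rewrite !mxE -/(fb b k).
have [fp|fp] := ltnP (fb b k) p; last first.
  by rewrite [(x i w)`__]nth_default ?size_tuple// !mul0r.
have lp : 0 < lambda`_(fb b k) by have := l0 (Ordinal fp); rewrite (tnth_nth 0).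
by rewrite mulrA divfK// gt_eqF// sqrtr_gt0.
Qed.

(** Block [b] acts on whitened coordinates with norm at most [8 / 7 * sqrt (q * Bm b)], and
    un-whitening costs at most [sqrt (bl b)]. Cauchy-Schwarz over the blocks leaves the sum of
    [bl b * Bm b], which [sum_Bm] bounds independently of the number of blocks. *)
Lemma tail_operator : whp P (expR (- n%:R)) (fun w =>
  forall th, enorm (tailmx x dd m w *m th) ^+ 2 <= 800 * sx ^+ 2 * S * enorm th ^+ 2).
Proof.
have eL := expR_gt0 L.
apply: (whp_set (measurable_le_set (expR L) mTt)).
  have T0 w : 0 <= Tt w by apply: sumr_ge0 => b _; rewrite mulr_ge0.
  apply: le_trans (markov_ge0 P mTt T0 eL) _.
  apply: (@le_trans _ _ ((expR L)^-1%:E * (2 ^+ (68 * n))%:E)%E).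
    by rewrite lee_wpmul2l// lee_fin invr_ge0 ltW.
  rewrite -EFinM lee_fin -expRN /L.
  have -> : - (69 * n%:R) = - n%:R + - (68 * n)%:R :> R by rewrite natrM; ring.
  rewrite expRD -mulrA ler_piMr ?expR_ge0// expRN mulrC ler_pdivrMr ?expR_gt0// mul1r.
  rewrite -[(68 * n)%:R]mulr1 expRM_natl.
  by apply: lerXn2r; rewrite ?nnegrE ?expR_ge0//; have := @expR_ge1Dx R 1; lra.
move=> w /= /negP; rewrite -ltNge => /ltW/sum_Bm SB th.
pose th' j := if insub j is Some j' then th j' 0 else 0.
pose u b : 'cV[R]_n := \col_k (Num.sqrt lambda`_(fb b k) * th' (b * n + k)%N).
rewrite (tailmx_blocks w th : _ = \sum_(b < m) Zb b w *m u b).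
pose e (b : 'I_m) := Num.sqrt (\sum_(k < n) th' (b * n + k)%N ^+ 2).
pose c b := 8 / 7 * Num.sqrt (q * Bm b w) * Num.sqrt (bl b).
have B0 b : 0 <= Bm b w by exact: bigmax_ge_id.
have e0 (b : 'I_m) : 0 <= \sum_(k < n) th' (b * n + k)%N ^+ 2.
  by apply: sumr_ge0 => k _; exact: sqr_ge0.
have sb b : Num.sqrt (bl b) ^+ 2 = bl b by apply: sqr_sqrtr; exact: lge0.
have eb b : e b ^+ 2 = \sum_(k < n) th' (b * n + k)%N ^+ 2 by exact: sqr_sqrtr.
have qb b : Num.sqrt (q * Bm b w) ^+ 2 = q * Bm b w.
  by apply: sqr_sqrtr; rewrite mulr_ge0 ?(ltW q0).
have ub b : enorm (u b) <= Num.sqrt (bl b) * e b.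
  apply: enorm_le_sq; first by rewrite mulr_ge0 ?sqrtr_ge0.
  rewrite exprMn sb eb enorm_sq mulr_sumr; apply: ler_sum => k _.
  rewrite mxE exprMn (sqr_sqrtr (lge0 _)) ler_wpM2r ?sqr_ge0//.
  by apply: ldec; rewrite leq_add2l leq_addr.
have Zu b : enorm (Zb b w *m u b) <= c b * e b.
  apply: le_trans (Zb_le _ _ _) _; rewrite /c -!mulrA ler_wpM2l//.
  by rewrite ler_wpM2l// ler_wpM2l ?sqrtr_ge0.
apply: le_trans (block_operator_le (c := c) (e := e) Zu) _.
have sx2 : 0 <= sx ^+ 2 by exact: sqr_ge0.
have -> : \sum_(b < m) e b ^+ 2 = enorm th ^+ 2.
  transitivity (\sum_(j < m * n) th' j ^+ 2).
    rewrite -(@sum_blocks _ _ _ (fun j => th' j ^+ 2)).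
    by apply: eq_bigr => b _; rewrite eb.
  rewrite enorm_sq -!(big_mkord xpredT (fun j => th' j ^+ 2)).
  rewrite (@big_cat_nat _ _ _ m 0 (m * n))//= ?leq_pmulr// [X in _ + X]big_nat_cond.
  rewrite [X in _ + X]big1 ?addr0 => [|j /andP[/andP[mj _] _]]; last first.
    by rewrite /th' insubF ?expr0n// ltnNge mj.
  rewrite big_mkord; apply: eq_bigr => j _; rewrite /th' insubT//= => jm.
  by congr (th _ _ ^+ _); apply: val_inj.
rewrite ler_wpM2r ?sqr_ge0//.
have -> : \sum_b c b ^+ 2 = 64 / 49 * q * \sum_b bl b * Bm b w.
  rewrite mulr_sumr; apply: eq_bigr => b _.
  rewrite /c !exprMn sb qb.
  by field.
(* [64 / 49] is the square of the net factor [8 / 7]; with [q = 4 sx^2] the product is just below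
   [721 sx^2 S], rounded up to 800. *)
apply: (@le_trans _ _ (64 / 49 * q * (138 * S))).
  by rewrite ler_wpM2l// mulr_ge0 ?(ltW q0).
have : 0 <= sx ^+ 2 * S by rewrite mulr_ge0// ltW.
by rewrite /q; lra.
Qed.

End tail_operator.

(** * The conditional risk *)

Section matrix_measurability.
Context d (T : measurableType d) (R : realType).

Definition mx_measurable m k (A : T -> 'M[R]_(m, k)) :=
  forall i j, measurable_fun setT (fun w => A w i j).

Lemma mx_measurable_cst m k (A : 'M[R]_(m, k)) : mx_measurable (fun=> A).
Proof. by move=> i j; exact: measurable_cst. Qed.

Lemma mx_measurableD m k (A B : T -> 'M[R]_(m, k)) :
  mx_measurable A -> mx_measurable B -> mx_measurable (fun w => A w + B w).
Proof.
by move=> mA mB i j; under eq_fun do rewrite mxE; exact: measurable_funD.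
Qed.

Lemma mx_measurableM m k l (A : T -> 'M[R]_(m, k)) (B : T -> 'M[R]_(k, l)) :
  mx_measurable A -> mx_measurable B -> mx_measurable (fun w => A w *m B w).
Proof.
move=> mA mB i j; under eq_fun do rewrite mxE.
by apply: measurable_sum => a; exact: measurable_funM.
Qed.

Lemma mx_measurableT m k (A : T -> 'M[R]_(m, k)) :
  mx_measurable A -> mx_measurable (fun w => (A w)^T).
Proof. by move=> mA i j; under eq_fun do rewrite mxE; exact: mA. Qed.

Lemma mx_measurableZ m k (c : R) (A : T -> 'M[R]_(m, k)) :
  mx_measurable A -> mx_measurable (fun w => c *: A w).
Proof.
by move=> mA i j; under eq_fun do rewrite mxE; exact: measurable_funM.
Qed.

Lemma measurable_det m (A : T -> 'M[R]_m) :
  mx_measurable A -> measurable_fun setT (fun w => \det (A w)).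
Proof.
move=> mA; apply: measurable_sum => s; apply: measurable_funM => //.
exact: measurable_prodr.
Qed.

(* [x^-1 = x * exp (- ln (x ^ 2))], also at [x = 0]. *)
Lemma measurable_funV (f : T -> R) :
  measurable_fun setT f -> measurable_fun setT (fun w => (f w)^-1).
Proof.
move=> mf; rewrite (_ : (fun w => _) = (fun w => f w * expR (- ln (f w ^+ 2)))).
  apply: measurable_funM => //; apply: measurableT_comp => //.
  apply: measurable_funN; apply: measurableT_comp; first exact: measurable_ln.
  exact: measurable_funX.
apply/funext => w; have [->|f0] := eqVneq (f w) 0; first by rewrite invr0 mul0r.
rewrite expRN lnK ?posrE ?exprn_even_gt0//.
by field.
Qed.

Lemma mx_measurableV m (A : T -> 'M[R]_m) : (forall w, A w \in unitmx) ->
  mx_measurable A -> mx_measurable (fun w => invmx (A w)).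
Proof.
move=> uA mA i j; under eq_fun do rewrite /invmx uA mxE mxE.
apply: measurable_funM; first by apply: measurable_funV; exact: measurable_det.
apply: measurable_funM => //; apply: measurable_det => a b.
by under eq_fun do rewrite !mxE; exact: mA.
Qed.

Lemma measurable_frob m k (A : T -> 'M[R]_(m, k)) :
  mx_measurable A -> measurable_fun setT (fun w => frob (A w)).
Proof.
by move=> mA; do 2!apply: measurable_sum => ?; apply: measurable_funX; exact: mA.
Qed.

Lemma measurable_enorm_sqr m (A : T -> 'cV[R]_m) :
  mx_measurable A -> measurable_fun setT (fun w => enorm (A w) ^+ 2).
Proof.
move=> mA; under eq_fun do rewrite enorm_sq.
by apply: measurable_sum => i; apply: measurable_funX; exact: mA.
Qed.
End matrix_measurability.

Section ridge_risk.
Variables (T : Type) (R : realType) (n p : nat) (x : 'I_n -> T -> p.-tuple R).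
Variables (th : 'cV[R]_p) (tau sigma : R).
Hypotheses (n0 : (0 < n)%N) (tau0 : 0 < tau).

Definition resolvent_mx (w : T) : 'M[R]_n :=
  invmx (design x w *m (design x w)^T + (n%:R * tau)%:M).

Definition smoother w : 'M[R]_n := design x w *m (design x w)^T *m resolvent_mx w.

Definition ridge_bias w : 'cV[R]_n :=
  (n%:R * tau) *: (resolvent_mx w *m (design x w *m th)).

(* Conditional on the design: squared bias plus variance. *)
Definition ridge_risk w : R :=
  n%:R^-1 * (enorm (ridge_bias w) ^+ 2 + sigma ^+ 2 * frob (smoother w)).

Let g := Num.sqrt (n%:R * tau).

Let nt : 0 < n%:R * tau.
Proof. by rewrite mulr_gt0// ltr0n. Qed.

Let g0 : 0 < g. Proof. by rewrite sqrtr_gt0. Qed.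

Let gE : g ^+ 2 = n%:R * tau. Proof. by rewrite sqr_sqrtr// ltW. Qed.

Let G_ge0 w a : 0 <= dotv a (design x w *m (design x w)^T *m a).
Proof. by rewrite -mulmxA -dotv_mulT dotvv sqr_ge0. Qed.

Lemma resolvent_mxK w : (design x w *m (design x w)^T + (g ^+ 2)%:M) *m resolvent_mx w = 1%:M.
Proof. by rewrite gE mulmxV// gram_unit. Qed.

Lemma ridge_bias_le w : enorm (ridge_bias w) <= enorm (design x w *m th).
Proof. by rewrite /ridge_bias -gE; case: (resolvent_norms (G_ge0 w) (resolvent_mxK w) (design x w *m th)). Qed.

Lemma smoother_entry_le w i j : `|smoother w i j| <= 1.
Proof.
have := smoother_contract (G_ge0 w) (resolvent_mxK w) (bvec j).
rewrite -/(smoother w) enorm_bvec mulr1 => h.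
have : smoother w i j ^+ 2 <= 1.
  rewrite -[leRHS](expr1n _ 2); apply: le_trans (_ : _ <= enorm (smoother w *m bvec j) ^+ 2) _.
    have E : (smoother w *m bvec j) i 0 = smoother w i j by rewrite -colE [LHS]mxE.
    rewrite enorm_sq (bigD1 i)//= E lerDl.
    by apply: sumr_ge0 => a _; exact: sqr_ge0.
  by rewrite ler_pXn2r ?nnegrE ?enorm_ge0.
by rewrite -[leLHS]ger0_norm ?sqr_ge0// normrX expr_le1.
Qed.

Lemma ridge_residual w (e : 'cV[R]_n) :
  design x w *m (ridge (design x w) (design x w *m th + e) tau - th) =
  smoother w *m e - ridge_bias w.
Proof.
rewrite /ridge (gt_eqF tau0) /ridge_pos -/(resolvent_mx w) mulmxBr !mulmxA.
rewrite -/(smoother w) mulmxDr (smootherE (resolvent_mxK w)) gE -/(ridge_bias w).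
by rewrite addrAC [X in X + _]addrAC subrr sub0r addrC.
Qed.
End ridge_risk.

(** * Integrals with their values, and the conditional expectation of the loss *)

Section integral_value.
Context d (T : measurableType d) (R : realType) (P : probability T R).

(** Integrability and a finite value are carried together, so that expectations of long sums can be
    assembled term by term. *)
Definition has_integral (f : T -> R) (r : R) :=
  P.-integrable setT (EFin \o f) /\ (\int[P]_w (f w)%:E = r%:E)%E.

Lemma integrable_has_integral (f : T -> R) : P.-integrable setT (EFin \o f) ->
  exists r, has_integral f r.
Proof.
move=> fi; exists (fine (\int[P]_w (f w)%:E)); split=> //.
by rewrite fineK//; exact: integrable_fin_num.
Qed.

Lemma has_integral_ext (f g : T -> R) r : f =1 g -> has_integral f r -> has_integral g r.
Proof. by move=> /funext ->. Qed.

Lemma has_integralD (f g : T -> R) r s : has_integral f r -> has_integral g s ->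
  has_integral (fun w => f w + g w) (r + s).
Proof.
move=> [fi fr] [gi gs]; split.
  by apply: (integrableD measurableT fi gi).
by under eq_integral do rewrite EFinD; rewrite integralD// fr gs.
Qed.

Lemma has_integralZ (c : R) (f : T -> R) r : has_integral f r ->
  has_integral (fun w => c * f w) (c * r).
Proof.
move=> [fi fr]; split; first by apply: (integrableZl measurableT c fi).
by under eq_integral do rewrite EFinM; rewrite integralZl// fr.
Qed.

Lemma has_integral0 : has_integral (fun=> 0) 0.
Proof. by split; [exact: integrable0|rewrite integral0]. Qed.

Lemma has_integral_sum (I : Type) (s : seq I) (f : I -> T -> R) (r : I -> R) :
  (forall i, has_integral (f i) (r i)) ->
  has_integral (fun w => \sum_(i <- s) f i w) (\sum_(i <- s) r i).
Proof.
move=> fr; elim: s => [|i s IH].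
  rewrite big_nil; apply: has_integral_ext has_integral0 => w.
  by rewrite big_nil.
rewrite big_cons; apply: has_integral_ext (has_integralD (fr i) IH) => w.
by rewrite big_cons.
Qed.

Lemma has_integralM (f g : T -> R) r s : measurable_fun setT f ->
  measurable_fun setT g -> independent2 P f g ->
  has_integral f r -> has_integral g s ->
  has_integral (fun w => f w * g w) (r * s).
Proof.
move=> mf mg fg [fi fr] [gi gs]; split.
  exact: indep_integrableM mf mg fg fi gi.
by rewrite (indep_expectationM mf mg fg fi gi) fr gs.
Qed.

Lemma has_integral_bounded (f g : T -> R) r : measurable_fun setT f ->
  (forall w, `|f w| <= g w) -> has_integral g r -> exists s, has_integral f s.
Proof.
move=> mf fg [gi _]; apply: integrable_has_integral.
apply: le_integrable gi => //; first exact/measurable_EFinP.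
move=> w _ /=; rewrite lee_fin (le_trans (fg w))//; exact: ler_norm.
Qed.

Lemma has_integral_ge0 (f : T -> R) r : measurable_fun setT f -> (forall w, 0 <= f w) ->
  (\int[P]_w (f w)%:E = r%:E)%E -> has_integral f r.
Proof.
move=> mf f0 fr; split=> //; apply/integrableP; split; first exact/measurable_EFinP.
by under eq_integral do rewrite /= ger0_norm//; rewrite fr ltry.
Qed.

Lemma has_integral_indic (A : set T) (f : T -> R) r : measurable A ->
  has_integral (fun w => \1_A w * f w) r -> (\int[P]_(w in A) (f w)%:E = r%:E)%E.
Proof.
move=> mA [_ <-]; rewrite integral_mkcond; apply: eq_integral => w _.
by rewrite patchE indicE; case: ifP => _; rewrite ?mul1r ?mul0r.
Qed.

End integral_value.

Section conditional_risk.
Context d (T : measurableType d) (R : realType) (P : probability T R).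
Variables (n p : nat) (x : 'I_n -> T -> p.-tuple R) (eps : 'I_n -> T -> R).
Variables (th : 'cV[R]_p) (tau sigma : R).
Hypotheses (n0 : (0 < n)%N) (tau0 : 0 < tau).
Hypothesis mx : forall i, measurable_fun setT (x i).
Hypothesis me : forall i, measurable_fun setT (eps i).
Hypothesis joint : forall (B : 'I_n -> set (p.-tuple R)) (C : 'I_n -> set R),
  (forall i, measurable (B i)) -> (forall i, measurable (C i)) ->
  (P ((\bigcap_(i in [set: 'I_n]) (x i @^-1` B i)) `&`
      (\bigcap_(i in [set: 'I_n]) (eps i @^-1` C i))) =
  P (\bigcap_(i in [set: 'I_n]) (x i @^-1` B i)) *
  P (\bigcap_(i in [set: 'I_n]) (eps i @^-1` C i)))%E.
Hypothesis inde : indep_family P eps.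
Hypothesis Eeps : forall i, has_integral P (eps i) 0.
Hypothesis Veps : forall i, has_integral P (fun w => eps i w ^+ 2) (sigma ^+ 2).
Hypothesis sqx : forall i j, P.-integrable setT (fun w => (tnth (x i w) j ^+ 2)%:E).

Let Gx := \big[setU/set0]_(i < n) preimage_set_system setT (x i) measurable.
(** [TG] and [TE] are copies of [T] carrying the sigma-algebras generated by the design and by the
    noise; measurability on them expresses being a function of the design or of the noise. *)
Let TG := g_sigma_algebraType Gx.
Let TE := g_sigma_algebraType (rects eps (index_enum 'I_n)).

Let Gx_ex A : Gx A <-> exists i B, measurable B /\ A = x i @^-1` B.
Proof.
rewrite /Gx -bigcup_seq; split=> [[i _ [B mB <-]]|[i [B [mB ->]]]].
  by exists i, B; rewrite setTI.
by exists i; [rewrite /= mem_index_enum|exists B => //; rewrite setTI].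
Qed.

Let measurable_TG (f : T -> R) : measurable_fun [set: TG] f -> measurable_fun [set: T] f.
Proof.
move=> mf _ B mB; have := mf measurableT B mB; rewrite !setTI.
apply: (smallest_sub (@sigma_algebra_measurable _ T)) => A /Gx_ex[i [C [mC ->]]].
by rewrite -[_ @^-1` _]setTI; exact: mx.
Qed.

Let measurable_TE (f : T -> R) : measurable_fun [set: TE] f -> measurable_fun [set: T] f.
Proof.
move=> mf _ B mB; have := mf measurableT B mB; rewrite !setTI.
apply: (smallest_sub (@sigma_algebra_measurable _ T)).
exact: rects_measurable.
Qed.

Let measurable_TG_set A : <<s Gx >> A -> measurable A.
Proof.
apply: (smallest_sub (@sigma_algebra_measurable _ T)) => {}A /Gx_ex[i [C [mC ->]]].
by rewrite -[_ @^-1` _]setTI; exact: mx.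
Qed.

Let TG_TE_indep (f g : T -> R) : measurable_fun [set: TG] f ->
  measurable_fun [set: TE] g -> independent2 P f g.
Proof.
move=> mf mg A B mA mB.
apply: (@prob_indep_sigma2 _ _ _ P (rects x (index_enum 'I_n)) (rects eps (index_enum 'I_n))).
- exact: rects_measurable.
- exact: rects_setI.
- exact: rects_setT.
- exact: rects_measurable.
- exact: rects_setI.
- exact: rects_setT.
- by move=> _ _ [B' [mB' _ ->]] [C' [mC' _ ->]]; exact: joint.
- have := mf measurableT A mA; rewrite setTI; apply: smallest_sub.
    exact: smallest_sigma_algebra.
  move=> C /Gx_ex[i [D [mD ->]]]; apply: sub_sigma_algebra.
  by apply: rects_comp => //; rewrite mem_index_enum.
- by have := mg measurableT B mB; rewrite setTI.
Qed.

Let meps_TE i : measurable_fun [set: TE] (eps i).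
Proof.
move=> _ B mB; rewrite setTI; apply: sub_sigma_algebra.
by apply: rects_comp => //; rewrite mem_index_enum.
Qed.

Let eps_indep j k : j != k -> independent2 P (eps j) (eps k).
Proof.
move=> jk A B mA mB.
pose C i := if i == j then A else setT.
have mC i : measurable (C i) by rewrite /C; case: ifP.
have Ck : C k = setT by rewrite /C eq_sym (negbTE jk).
have E : \bigcap_(i in [set: 'I_n]) (eps i @^-1` C i) = eps j @^-1` A.
  apply/seteqP; split => [w /(_ j I)|w Aw i _]; rewrite /= /C ?eqxx//.
  by case: eqP => // ->.
by have := indep_family_seq inde mC Ck mB; rewrite E.
Qed.

Let eps_cov j k : has_integral P (fun w => eps j w * eps k w)
  (if j == k then sigma ^+ 2 else 0).
Proof.
have [<-|jk] := eqVneq j k.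
  by apply: has_integral_ext (Veps j) => w; rewrite expr2.
by rewrite -(mulr0 0); apply: has_integralM => //; exact: eps_indep.
Qed.

Let xcoord i j : measurable_fun [set: TG] (fun w => tnth (x i w) j).
Proof.
move=> _ B mB; rewrite setTI; apply: sub_sigma_algebra; apply/Gx_ex.
exists i, ((fun v => tnth v j) @^-1` B); split=> //.
by rewrite -[_ @^-1` _]setTI; exact: measurable_tnth.
Qed.

Let mdesign : mx_measurable (design x : TG -> _).
Proof. by move=> i j; rewrite /design; under eq_fun do rewrite mxE; exact: xcoord. Qed.

Let mgram : mx_measurable (fun w : TG => design x w *m (design x w)^T).
Proof. by apply: mx_measurableM => //; exact: mx_measurableT. Qed.

Let mres : mx_measurable (resolvent_mx x tau : TG -> _).
Proof.
apply: mx_measurableV => [w|]; first exact: gram_unit.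
by apply: mx_measurableD => //; exact: mx_measurable_cst.
Qed.

Let msmo : mx_measurable (smoother x tau : TG -> _).
Proof. exact: mx_measurableM. Qed.

Let mfit : mx_measurable (fun w : TG => design x w *m th).
Proof. by apply: mx_measurableM => //; exact: mx_measurable_cst. Qed.

Let mbias : mx_measurable (ridge_bias x th tau : TG -> _).
Proof. by apply: mx_measurableZ; exact: mx_measurableM. Qed.

Lemma measurable_ridge_risk : measurable_fun [set: TG] (ridge_risk x th tau sigma).
Proof.
apply: measurable_funM => //; apply: measurable_funD.
  exact: measurable_enorm_sqr.
by apply: measurable_funM => //; exact: measurable_frob.
Qed.

Let fit_sqr : exists r, has_integral P (fun w => enorm (design x w *m th) ^+ 2) r.
Proof.
have [r Hr] : exists r, has_integral P (fun w => enorm th ^+ 2 * frob (design x w)) r.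
  have [s Hs] : exists s : 'I_n -> 'I_p -> R,
      forall i j, has_integral P (fun w => tnth (x i w) j ^+ 2) (s i j).
    pose s i j := fine (\int[P]_w (tnth (x i w) j ^+ 2)%:E)%E.
    exists s => i j; split; first exact: sqx.
    by rewrite /s fineK//; exact: integrable_fin_num.
  exists (enorm th ^+ 2 * \sum_i \sum_j s i j); apply: has_integralZ.
  apply: has_integral_ext (has_integral_sum _ (fun i => has_integral_sum _ (Hs i))) => w.
  by apply: eq_bigr => i _; apply: eq_bigr => j _; rewrite mxE.
apply: (@has_integral_bounded _ _ _ P _ _ r _ _ Hr).
  by apply: measurable_TG; exact: measurable_enorm_sqr.
move=> w; rewrite ger0_norm ?sqr_ge0// !enorm_sq mulrC mulr_suml.
apply: ler_sum => i _; rewrite mxE; exact: (sum_mul_sqr_le (fun j => design x w i j) (fun j => th j 0)).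
Qed.

(** The entries of the smoother are at most 1 and the bias is at most the fit, so every coefficient
    met below is dominated by 1 plus the squared fit, which is integrable because the design has
    second moments. *)
Let bound1 (f : T -> R) : measurable_fun [set: TG] f ->
  (forall w, `|f w| <= 1 + enorm (design x w *m th) ^+ 2) -> exists r, has_integral P f r.
Proof.
move=> mf fb; have [r Hr] := fit_sqr.
have H1 : has_integral P (fun=> 1) 1.
  apply: has_integral_ge0 => //; rewrite integral_cst// mul1e; exact: probability_setT.
exact: (has_integral_bounded (measurable_TG mf) fb (has_integralD H1 Hr)).
Qed.

Definition ridge_loss w : R :=
  n%:R^-1 * enorm (smoother x tau w *m (\col_i eps i w) - ridge_bias x th tau w) ^+ 2.

(** The square is expanded into terms of the form indicator of [A] times a function of the design
    times a monomial in the noise. Design and noise are independent, so each expectation factorizes: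
    the linear terms vanish by centering and the quadratic ones reduce to their diagonal. *)
Lemma ridge_loss_integral A : <<s Gx >> A ->
  (\int[P]_(w in A) (ridge_loss w)%:E = \int[P]_(w in A) (ridge_risk x th tau sigma w)%:E)%E.
Proof.
move=> sA.
pose I w : R := \1_A w.
have mA : measurable A by exact: measurable_TG_set.
have mI : measurable_fun [set: TG] (I : TG -> R).
  apply: measurable_indic; exact: sA.
have I01 w : 0 <= I w <= 1 by rewrite /I indicE; case: (w \in A); rewrite /= lexx ler01.
pose H w := smoother x tau w; pose b w := ridge_bias x th tau w.
have Hle w i j : `|H w i j| <= 1 by exact: smoother_entry_le.
have ble w i : b w i 0 ^+ 2 <= enorm (design x w *m th) ^+ 2.
  apply: (@le_trans _ _ (enorm (b w) ^+ 2)).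
    by rewrite enorm_sq (bigD1 i)//= lerDl; apply: sumr_ge0 => k _; exact: sqr_ge0.
  by rewrite ler_pXn2r ?nnegrE ?enorm_ge0//; exact: ridge_bias_le.
have Ib w c e : 0 <= e -> `|c| <= 1 + e -> `|I w * c| <= 1 + e.
  move=> e0 ce; have /andP[I0 I1] := I01 w.
  by rewrite normrM ger0_norm// (le_trans _ ce)// ler_piMl.
have [r Hr] : exists r : 'I_n -> R, forall i, has_integral P (fun w => I w * b w i 0 ^+ 2) (r i).
  suff H0 i : exists s, has_integral P (fun w => I w * b w i 0 ^+ 2) s.
    by exists (fun i => sval (cid (H0 i))) => i; exact: (svalP (cid (H0 i))).
  apply: bound1 => [|w].
    by apply: measurable_funM => //; apply: measurable_funX; exact: mbias.
  apply: Ib; rewrite ?sqr_ge0// ger0_norm ?sqr_ge0// (le_trans (ble w i))//.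
  by rewrite lerDr.
have [u Hu] : exists u : 'I_n -> 'I_n -> R, forall i j,
    has_integral P (fun w => I w * (b w i 0 * H w i j)) (u i j).
  suff H0 i j : exists s, has_integral P (fun w => I w * (b w i 0 * H w i j)) s.
    by exists (fun i j => sval (cid (H0 i j))) => i j; exact: (svalP (cid (H0 i j))).
  apply: bound1 => [|w].
    by apply: measurable_funM => //; apply: measurable_funM; [exact: mbias|exact: msmo].
  apply: Ib; rewrite ?sqr_ge0// normrM (le_trans (_ : _ <= `|b w i 0| * 1))//.
    by rewrite ler_wpM2l.
  have := ble w i; rewrite -[X in X <= _ -> _]ger0_norm ?sqr_ge0// normrX mulr1.
  by have := normr_ge0 (b w i 0); nra.
have [v Hv] : exists v : 'I_n -> 'I_n -> 'I_n -> R, forall i j k,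
    has_integral P (fun w => I w * (H w i j * H w i k)) (v i j k).
  suff H0 i j k : exists s, has_integral P (fun w => I w * (H w i j * H w i k)) s.
    by exists (fun i j k => sval (cid (H0 i j k))) => i j k; exact: (svalP (cid (H0 i j k))).
  apply: bound1 => [|w].
    by apply: measurable_funM => //; apply: measurable_funM; exact: msmo.
  apply: Ib; rewrite ?sqr_ge0// normrM.
  have := Hle w i j; have := Hle w i k; have := normr_ge0 (H w i j); have := normr_ge0 (H w i k).
  have := sqr_ge0 (enorm (design x w *m th)); nra.
(* The common value of the two integrals, written with the integrals [r] of the squared bias entries
   and [v] of the products of smoother entries. *)
pose val := n%:R^-1 * (\sum_i (r i + sigma ^+ 2 * \sum_j v i j j)).
have -> : (\int[P]_(w in A) (ridge_loss w)%:E = val%:E)%E.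
  apply: has_integral_indic => //.
  have K1 i j : has_integral P (fun w => I w * (b w i 0 * H w i j) * eps j w) (u i j * 0).
    apply: has_integralM => //; first by case: (Hu i j) => /measurable_int/measurable_EFinP.
    apply: TG_TE_indep => //.
    by apply: measurable_funM => //; apply: measurable_funM; [exact: mbias|exact: msmo].
  have K2 i j k : has_integral P (fun w => I w * (H w i j * H w i k) * (eps j w * eps k w))
      (v i j k * if j == k then sigma ^+ 2 else 0).
    apply: has_integralM => //.
    - by case: (Hv i j k) => /measurable_int/measurable_EFinP.
    - exact: measurable_funM.
    - apply: TG_TE_indep => //; last exact: measurable_funM.
      by apply: measurable_funM => //; apply: measurable_funM; exact: msmo.
  have K i := has_integralD (has_integralD (Hr i)
      (has_integralZ (- 2) (has_integral_sum (index_enum 'I_n) (K1 i))))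
      (has_integral_sum (index_enum 'I_n) (fun j => has_integral_sum (index_enum 'I_n) (K2 i j))).
  have := has_integralZ n%:R^-1 (has_integral_sum (index_enum 'I_n) K).
  have -> : n%:R^-1 * (\sum_i (r i + - 2 * (\sum_j u i j * 0) +
      \sum_j \sum_k v i j k * (if j == k then sigma ^+ 2 else 0))) = val.
    congr (_ * _); apply: eq_bigr => i _.
    rewrite -mulr_suml !mulr0 addr0 mulr_sumr; congr (_ + _); apply: eq_bigr => j _.
    rewrite (bigD1 j)//= eqxx big1 ?addr0 => [|k kj]; first by rewrite mulrC.
    by rewrite eq_sym (negbTE kj) mulr0.
  apply: has_integral_ext => w; rewrite /ridge_loss mulrCA; congr (_ * _).
  rewrite enorm_sq [RHS]mulr_sumr; apply: eq_bigr => i _.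
  pose D := \sum_j H w i j * eps j w.
  have -> : (smoother x tau w *m (\col_i eps i w) - ridge_bias x th tau w) i 0 =
      D - b w i 0.
    rewrite mxE [X in X + _]mxE [X in _ + X]mxE; congr (_ - _).
    by apply: eq_bigr => j _; rewrite [X in _ * X]mxE.
  have -> : \sum_j I w * (b w i 0 * H w i j) * eps j w = I w * (b w i 0 * D).
    by rewrite /D !mulr_sumr; apply: eq_bigr => j _; ring.
  have -> : \sum_j \sum_k I w * (H w i j * H w i k) * (eps j w * eps k w) = I w * (D * D).
    rewrite /D mulr_suml mulr_sumr; apply: eq_bigr => j _.
    by rewrite !mulr_sumr; apply: eq_bigr => k _; ring.
  ring.
apply/esym/has_integral_indic => //.
have K i := has_integralD (Hr i) (has_integralZ (sigma ^+ 2)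
   (has_integral_sum (index_enum 'I_n) (fun j => Hv i j j))).
apply: has_integral_ext (has_integralZ n%:R^-1 (has_integral_sum (index_enum 'I_n) K)) => w.
rewrite /ridge_risk mulrCA; congr (_ * _).
rewrite enorm_sq /frob mulr_sumr -big_split/= mulr_sumr; apply: eq_bigr => i _.
rewrite -/(b w) -/(H w) mulrDr; congr (_ + _).
rewrite mulrCA; congr (_ * _); rewrite mulr_sumr; apply: eq_bigr => j _.
by rewrite -expr2.
Qed.

Let risk_integrable : P.-integrable setT (EFin \o ridge_risk x th tau sigma).
Proof.
have [r Hr] := fit_sqr.
have H1 : has_integral P (fun=> 1) 1.
  apply: has_integral_ge0 => //; rewrite integral_cst// mul1e; exact: probability_setT.
have Hg := has_integralZ n%:R^-1 (has_integralD Hr (has_integralZ (sigma ^+ 2 * (n%:R * n%:R)) H1)).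
suff [s []//] : exists s, has_integral P (ridge_risk x th tau sigma) s.
apply: (has_integral_bounded _ _ Hg).
  exact: measurable_TG measurable_ridge_risk.
move=> w; have fH : frob (smoother x tau w) <= n%:R * n%:R.
  rewrite /frob (@le_trans _ _ (\sum_(i < n) \sum_(j < n) 1))//; last first.
    by rewrite !sumr_const !card_ord mulr_natl.
  apply: ler_sum => i _; apply: ler_sum => j _.
  by rewrite -[leLHS]ger0_norm ?sqr_ge0// normrX expr_le1// smoother_entry_le.
rewrite ger0_norm /ridge_risk; last first.
  by rewrite mulr_ge0// addr_ge0 ?sqr_ge0// mulr_ge0 ?sqr_ge0 ?frob_ge0.
rewrite ler_wpM2l// mulr1 lerD//; last by rewrite ler_wpM2l ?sqr_ge0.
by rewrite ler_pXn2r ?nnegrE ?enorm_ge0//; exact: ridge_bias_le.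
Qed.

Let null_of_pos (f : T -> R) (A : set T) : measurable A ->
  measurable_fun setT f -> (forall w, A w -> 0 < f w) ->
  (\int[P]_(w in A) (f w)%:E = 0)%E -> P A = 0%E.
Proof.
move=> mA mf f0 If.
have : (\int[P]_(w in A) `|(f w)%:E| = 0)%E.
  rewrite -[RHS]If; apply: eq_integral => w /set_mem Aw.
  by rewrite gee0_abs// lee_fin ltW// f0.
move/(ae_eq_integral_abs P mA); case=> [|N [mN PN AN]].
  by apply/measurable_EFinP; exact: measurable_funTS.
apply/eqP; rewrite eq_le measure_ge0 andbT -PN; apply: le_measure; rewrite ?inE//.
move=> w Aw; apply: AN => /= H; have := H Aw.
by have := f0 w Aw; move=> + [] => /[swap] ->; rewrite ltxx.
Qed.

(** The sets where one of the two functions exceeds the other belong to the sigma-algebra of the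
    design; the integral of the positive difference over each is 0, so both sets are null. *)
Lemma cond_expectation_ridge_loss (mse : T -> R) :
  cond_expectation P (g_sigma_preimage x) ridge_loss mse ->
  exists N, [/\ measurable N, P N = 0%E &
     forall w, ~ N w -> mse w = ridge_risk x th tau sigma w].
Proof.
move=> [mseG msei mseE]; pose F := ridge_risk x th tau sigma.
have mmse : measurable_fun [set: TG] mse by move=> _ B mB; rewrite setTI; exact: mseG.
have mF : measurable_fun [set: TG] F by exact: measurable_ridge_risk.
have half (f h : T -> R) : measurable_fun [set: TG] f -> measurable_fun [set: TG] h ->
    P.-integrable setT (EFin \o f) -> P.-integrable setT (EFin \o h) ->
    (forall A, <<s Gx >> A -> (\int[P]_(w in A) (f w)%:E = \int[P]_(w in A) (h w)%:E)%E) ->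
    measurable [set w | h w < f w] /\ P [set w | h w < f w] = 0%E.
  move=> mf mh fi hi fh; set A := [set w | _].
  have sA : <<s Gx >> A.
    have mD : measurable_fun [set: TG] (fun w => f w - h w) by exact: measurable_funB.
    have := mD measurableT `]0, +oo[%classic (measurable_itv _); rewrite setTI.
    congr (<<s _ >> _); apply/seteqP; split => w /=;
    by rewrite in_itv/= andbT subr_gt0.
  have mA : measurable A by exact: measurable_TG_set.
  split=> //; apply: (@null_of_pos (fun w => f w - h w)) => //.
  - by apply: measurable_TG; exact: measurable_funB.
  - by move=> w; rewrite /A/= subr_gt0.
  have fiA := integrableS measurableT mA (@subsetT _ _) fi.
  have hiA := integrableS measurableT mA (@subsetT _ _) hi.
  under eq_integral do rewrite EFinB.
  rewrite integralB// fh// subee//.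
  exact: integrable_fin_num.
have E1 A : <<s Gx >> A -> (\int[P]_(w in A) (mse w)%:E = \int[P]_(w in A) (F w)%:E)%E.
  by move=> sA; rewrite mseE// ridge_loss_integral.
have [mN1 PN1] := half _ _ mmse mF msei risk_integrable E1.
have [mN2 PN2] := half _ _ mF mmse risk_integrable msei (fun A sA => esym (E1 A sA)).
exists ([set w | F w < mse w] `|` [set w | mse w < F w]); split.
- exact: measurableU.
- apply/eqP; rewrite eq_le measure_ge0 andbT.
  apply: (@le_trans _ _ (P [set w | (F w < mse w)%R] + P [set w | (mse w < F w)%R])%E).
    exact: measureU2.
  by rewrite PN1 PN2 adde0.
- move=> w /not_orP[/negP h1 /negP h2].
  by apply: le_anti; rewrite !leNgt h1 h2.
Qed.

End conditional_risk.

(** * Two-sided risk bounds *)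

Section risk_bounds.
Variables (R : realType) (n d m : nat).
Variables (Z : 'M[R]_(n, d)) (X2 : 'M[R]_(n, m)) (l : 'rV[R]_d) (Q : 'M[R]_n).
Variables (r g kap K t tau ld sigma : R) (v : 'cV[R]_d) (f : 'cV[R]_n).
Let G := Z *m diag_mx l *m Z^T + X2 *m X2^T.
Let s := tau + t.
Hypotheses (r0 : 0 < r) (rn : r ^+ 2 = n%:R).
Hypotheses (g0 : 0 < g) (gt : g ^+ 2 = n%:R * tau).
Hypotheses (kap0 : 0 <= kap) (kapt : kap ^+ 2 = K * (n%:R * t)) (K1 : 1 <= K).
Hypotheses (t0 : 0 < t) (ld0 : 0 < ld) (lge : forall k, ld <= l 0 k).
Hypothesis (QK : (G + (g ^+ 2)%:M) *m Q = 1%:M).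
Hypothesis (Zub : forall y, enorm (Z *m y) <= 3 * r * enorm y).
Hypothesis (Zlb : forall y, r * enorm y <= 3 * enorm (Z *m y)).
Hypothesis (Xub : forall a, enorm (X2 *m a) <= kap * enorm a).
Hypothesis (Xtr : n%:R * (n%:R * t) / 2 <= frob X2).
Hypothesis (ft : enorm f <= r * t * enorm v).

Let b := g ^+ 2 *: (Q *m (Z *m (diag_mx l *m v) + f)).
Let risk := n%:R^-1 * (enorm b ^+ 2 + sigma ^+ 2 * frob (G *m Q)).

Let n0 : 0 < n%:R :> R. Proof. by rewrite -rn exprn_gt0. Qed.
Let tau0 : 0 < tau. Proof. by rewrite -(pmulr_rgt0 _ n0) -gt exprn_gt0. Qed.
Let s0 : 0 < s. Proof. by rewrite addr_gt0. Qed.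
Let K0 : 0 < K. Proof. exact: lt_le_trans ltr01 K1. Qed.
Let v0 : 0 <= enorm v. Proof. exact: enorm_ge0. Qed.

Lemma risk_le : risk <= ((3 * K + 1) ^+ 2 + 162 * (1 + K) ^+ 2 + 8 * K ^+ 2) *
  (enorm v ^+ 2 * s ^+ 2 + sigma ^+ 2 * (d%:R / n%:R + (t / s) ^+ 2)).
Proof.
have hb : enorm b ^+ 2 <= n%:R * ((3 * K + 1) ^+ 2 * (enorm v ^+ 2 * s ^+ 2)).
  have : enorm b <= r * ((3 * K + 1) * (enorm v * s)).
    have := bias_le r0 rn g0 gt kap0 kapt K1 t0 ld0 lge QK Zlb Xub v f.
    rewrite -/b -/s => /le_trans; apply.
    have : r * t * enorm v <= r * s * enorm v.
      by rewrite ler_wpM2r// ler_wpM2l ?(ltW r0)// /s lerDr ltW.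
    by move: ft; lra.
  rewrite -(@ler_pXn2r _ 2) ?nnegrE ?enorm_ge0//; last first.
    have k3 : 0 <= 3 * K + 1 by move: (ltW K0); lra.
    by apply: mulr_ge0; [exact: ltW|apply: mulr_ge0 => //; apply: mulr_ge0 => //; exact: ltW].
  by rewrite !exprMn rn.
have hf := smoother_frob_le r0 rn g0 gt kap0 kapt K1 t0 ld0 lge QK Zub Zlb Xub.
rewrite -/G -/s in hf.
rewrite /risk ler_pdivrMl//.
have dn : 0 <= d%:R / n%:R :> R by rewrite divr_ge0.
have ts : 0 <= (t / s) ^+ 2 by exact: sqr_ge0.
have E : 162 * (1 + K) ^+ 2 * d%:R + 8 * K ^+ 2 * (n%:R * (t / s) ^+ 2) =
   n%:R * (162 * (1 + K) ^+ 2 * (d%:R / n%:R) + 8 * K ^+ 2 * (t / s) ^+ 2).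
  by field; rewrite !gt_eqF.
rewrite {}E in hf.
have hs := ler_wpM2l (sqr_ge0 sigma) hf.
apply: le_trans (lerD hb hs) _.
rewrite [X in _ + X]mulrCA -mulrDr ler_pM2l//.
move: hb hf hs => _ _ _; set D := d%:R / n%:R in dn *; set W := (t / s) ^+ 2 in ts *.
set h := enorm v ^+ 2 * s ^+ 2.
have h0 : 0 <= h by rewrite mulr_ge0 ?sqr_ge0.
have s2 : 0 <= sigma ^+ 2 by exact: sqr_ge0.
set a1 := (3 * K + 1) ^+ 2; set a2 := 162 * _; set a3 := 8 * K ^+ 2.
have A1 : 0 <= a1 by exact: sqr_ge0.
have A2 : 0 <= a2 by rewrite mulr_ge0 ?sqr_ge0.
have A3 : 0 <= a3 by rewrite mulr_ge0 ?sqr_ge0.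
have := mulr_ge0 A2 h0; have := mulr_ge0 A3 h0.
have sD : 0 <= sigma ^+ 2 * D by rewrite mulr_ge0.
have sW : 0 <= sigma ^+ 2 * W by rewrite mulr_ge0.
have := mulr_ge0 A1 sD; have := mulr_ge0 A1 sW.
have := mulr_ge0 A3 sD; have := mulr_ge0 A2 sW.
by lra.
Qed.

Variables (kp A : R).
Hypotheses (kp01 : 0 <= kp <= 1) (A0 : 0 < A).
Hypothesis kpos : 0 < kp -> s <= 2 * tau /\ 6 * enorm f <= r * ld * enorm v.

(** Trivial when [kp = 0]. Otherwise [kpos] lets the perturbation [f] absorb at most half of
    [enorm v] in [bias_ge], which doubles the constant to 6, and [s <= 2 tau] doubles it again;
    [144 = 12^2]. *)
Let bias_lower : kp * (s ^+ 2 * enorm v ^+ 2) <=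
  144 * (1 + K * s / ld) ^+ 2 * (n%:R^-1 * enorm b ^+ 2).
Proof.
have /andP[k0 k1] := kp01.
have rhs0 : 0 <= 144 * (1 + K * s / ld) ^+ 2 * (n%:R^-1 * enorm b ^+ 2).
  by apply: mulr_ge0; [apply: mulr_ge0 => //; exact: sqr_ge0|rewrite mulr_ge0 ?sqr_ge0 ?invr_ge0 ?(ltW n0)].
have [<-|kn0] := eqVneq 0 kp; first by rewrite mul0r.
have kp0 : 0 < kp by rewrite lt0r eq_sym kn0.
have [st fl] := kpos kp0.
apply: (@le_trans _ _ (s ^+ 2 * enorm v ^+ 2)).
  by rewrite ler_piMl// mulr_ge0 ?sqr_ge0.
have := bias_ge r0 rn g0 gt kap0 kapt K1 t0 ld0 lge QK Zub Zlb Xub v f.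
rewrite -/s; set c := 1 + K * s / ld; set a := enorm (Q *m _).
have c0 : 0 < c by rewrite addr_gt0// divr_gt0// mulr_gt0.
have a0 : 0 <= a by exact: enorm_ge0.
have f2 : 3 * enorm f / (r * ld) <= enorm v / 2.
  by rewrite ler_pdivrMr ?mulr_gt0//; lra.
move=> h; have h2 : enorm v <= 6 * r * c * a by lra.
have bE : enorm b = g ^+ 2 * a by rewrite /b enormZ ger0_norm ?sqr_ge0.
have h3 : s * enorm v <= 12 * (tau * r * c * a).
  apply: le_trans (ler_pM (ltW s0) v0 st h2) _.
  by rewrite le_eqVlt; apply/orP; left; apply/eqP; ring.
have : (s * enorm v) ^+ 2 <= (12 * (tau * r * c * a)) ^+ 2.
  by rewrite ler_pXn2r ?nnegrE ?mulr_ge0 ?(ltW s0) ?(ltW tau0) ?(ltW r0) ?(ltW c0)//.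
rewrite exprMn => /le_trans; apply; rewrite bE gt -rn.
by rewrite le_eqVlt; apply/orP; left; apply/eqP; field; rewrite gt_eqF.
Qed.

(** In order, the costs of the bias for small [s], the bias for large [s], the tail variance and the
    head variance; adding them makes one constant serve both ranges. The factor [2 * A] reflects the
    enlarged range of [risk_ge_small]. *)
Definition lower_const :=
  144 * (1 + 2 * K * A) ^+ 2 + 144 * ((1 + K * A) / A) ^+ 2 +
  4 * K ^+ 2 + 81 ^+ 3 * (2 * A + 9) ^+ 2.

Let c1 := 144 * (1 + 2 * K * A) ^+ 2.
Let c2 := 144 * ((1 + K * A) / A) ^+ 2.
Let c3 := 4 * K ^+ 2.
Let c4 := 81 ^+ 3 * (2 * A + 9) ^+ 2.
Let C1 : 0 <= c1. Proof. by rewrite mulr_ge0// sqr_ge0. Qed.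
Let C2 : 0 <= c2. Proof. by rewrite mulr_ge0// sqr_ge0. Qed.
Let C3 : 0 < c3. Proof. by rewrite mulr_gt0// exprn_gt0. Qed.
Let C4 : 0 <= c4. Proof. by rewrite mulr_ge0// ?sqr_ge0// exprn_ge0. Qed.

Let B := n%:R^-1 * enorm b ^+ 2.
Let B0 : 0 <= B. Proof. by rewrite mulr_ge0 ?sqr_ge0// ?invr_ge0 ?(ltW n0). Qed.
Let V := n%:R^-1 * frob (G *m Q).
Let V0 : 0 <= V. Proof. by rewrite mulr_ge0 ?frob_ge0// ?invr_ge0 ?(ltW n0). Qed.

Let tailV : (t / s) ^+ 2 <= c3 * V.
Proof.
have := smoother_frob_ge_tail r0 rn g0 gt kap0 kapt K1 t0 ld0 lge QK Xub Xtr.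
rewrite -/G -/s => h; rewrite -(ler_pM2l n0) (le_trans h)//.
by rewrite /V le_eqVlt; apply/orP; left; apply/eqP; rewrite /c3; field; rewrite gt_eqF.
Qed.

Let finish x y : x <= (c1 + c2) * B -> y <= (c3 + c4) * V ->
  lower_const^-1 * (x + sigma ^+ 2 * y) <= risk.
Proof.
move=> xB yV; have L0 : 0 < lower_const by rewrite /lower_const; move: C1 C2 C3 C4; rewrite /c1 /c2 /c3 /c4; lra.
rewrite ler_pdivrMl//.
have -> : risk = B + sigma ^+ 2 * V by rewrite /risk /B /V; ring.
have -> : lower_const = c1 + c2 + c3 + c4 by [].
have s2 := sqr_ge0 sigma; have sV := mulr_ge0 s2 V0.
have := ler_wpM2l s2 yV.
have := mulr_ge0 (ltW C3) B0; have := mulr_ge0 C4 B0.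
have := mulr_ge0 C1 sV; have := mulr_ge0 C2 sV; lra.
Qed.

(** Valid up to twice the threshold [A * ld], so that a point on the threshold can be approached
    from the right. *)
Lemma risk_ge_small : s <= 2 * A * ld ->
  lower_const^-1 * (kp * enorm v ^+ 2 * s ^+ 2 +
    sigma ^+ 2 * (d%:R / n%:R + (t / s) ^+ 2)) <= risk.
Proof.
move=> sA; apply: finish.
  rewrite -mulrA [enorm v ^+ 2 * _]mulrC.
  apply: le_trans bias_lower _; rewrite -/B ler_wpM2r//.
  apply: (@le_trans _ _ c1); last by rewrite lerDl.
  rewrite /c1 ler_wpM2l// ler_pXn2r ?nnegrE ?addr_ge0 ?mulr_ge0 ?(ltW K0) ?(ltW A0) ?invr_ge0 ?(ltW s0) ?(ltW ld0)//.
  rewrite lerD2l ler_pdivrMr//.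
  by have := ler_wpM2l (ltW K0) sA; lra.
have h := smoother_frob_ge_head r0 rn g0 gt t0 ld0 lge QK Zub Zlb sA.
rewrite -/G in h.
have : d%:R / n%:R <= c4 * V.
  rewrite ler_pdivrMr// (le_trans h)// /V /c4.
  by rewrite le_eqVlt; apply/orP; left; apply/eqP; field; rewrite gt_eqF.
by have := tailV; lra.
Qed.

Lemma risk_ge_large : A * ld <= s ->
  lower_const^-1 * (kp * enorm v ^+ 2 * ld ^+ 2 +
    sigma ^+ 2 * (t / s) ^+ 2) <= risk.
Proof.
move=> sA; apply: finish; last first.
  by apply: le_trans tailV _; rewrite ler_wpM2r// lerDl.
(* Since [A * ld <= s], the loss factor of [bias_lower] multiplied by [ld] is at most a constant
   times [s]; this trades [s ^+ 2] for [ld ^+ 2] in the bias. *)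
have h : ld * (1 + K * s / ld) <= (1 + K * A) / A * s.
  have -> : ld * (1 + K * s / ld) = ld + K * s by field; rewrite gt_eqF.
  have -> : (1 + K * A) / A * s = s / A + K * s by field; rewrite gt_eqF.
  by rewrite lerD2r ler_pdivlMr// mulrC.
have c0 : 0 < 1 + K * s / ld by rewrite addr_gt0// divr_gt0// mulr_gt0.
have /andP[k0 _] := kp01.
have h2 : (ld * (1 + K * s / ld)) ^+ 2 <= ((1 + K * A) / A * s) ^+ 2.
  rewrite ler_pXn2r ?nnegrE// ?mulr_ge0 ?(ltW ld0) ?(ltW c0) ?(ltW s0) ?invr_ge0 ?(ltW A0)//.
  by rewrite addr_ge0// mulr_ge0 ?(ltW K0) ?(ltW A0).
have s20 : 0 < s ^+ 2 by rewrite exprn_gt0.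
rewrite -(ler_pM2r s20).
have vk : 0 <= kp * (s ^+ 2 * enorm v ^+ 2) by rewrite mulr_ge0// mulr_ge0 ?sqr_ge0.
have c20 : 0 < (1 + K * s / ld) ^+ 2 by rewrite exprn_gt0.
have h3 : kp * (s ^+ 2 * enorm v ^+ 2) * ld ^+ 2 <= c2 * s ^+ 2 * B.
  apply: (@le_trans _ _ (144 * (ld * (1 + K * s / ld)) ^+ 2 * B)).
    have := ler_wpM2r (sqr_ge0 ld) bias_lower; rewrite -/B => /le_trans; apply.
    by rewrite le_eqVlt; apply/orP; left; apply/eqP; ring.
  by rewrite ler_wpM2r//; move: h2; rewrite [X in _ <= X -> _]exprMn /c2; lra.
have : 0 <= c1 * B * s ^+ 2 by rewrite mulr_ge0 ?sqr_ge0// mulr_ge0.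
by lra.
Qed.

End risk_bounds.

(** * Reduction of the design to whitened head and tail columns *)

Lemma sum_split (R : nmodType) (F : nat -> R) d m p : (d + m = p)%N ->
  \sum_(j < p) F j = \sum_(k < d) F k + \sum_(j < m) F (d + j)%N.
Proof. by move=> <-; rewrite big_split_ord. Qed.

Section head_tail.
Variables (dT : measure_display) (T : measurableType dT).
Variables (R : realType) (n p d m : nat) (lambda theta : p.-tuple R).
Variables (x : 'I_n -> T -> p.-tuple R).
Hypotheses (dm : (d + m = p)%N) (l0 : forall j, 0 < tnth lambda j).

Lemma nth_gt0 j : (j < p)%N -> 0 < lambda`_j.
Proof. by move=> jp; have := l0 (Ordinal jp); rewrite (tnth_nth 0). Qed.

Let hd (k : 'I_d) : 0 < lambda`_k.
Proof. by apply: nth_gt0; rewrite -dm ltn_addr. Qed.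

Let tl (k : 'I_m) : 0 < lambda`_(d + k).
Proof. by apply: nth_gt0; rewrite -dm ltn_add2l. Qed.

Definition headmx w : 'M[R]_(n, d) := zmx lambda x (@nat_of_ord d) w.

(** Divided by the square roots, not multiplied: the head fit becomes [Z diag(l) v] with [v] this
    vector, the form used in the bias bounds, and its squared norm is the head signal. *)
Definition whead : 'cV[R]_d := \col_k (theta`_k / Num.sqrt lambda`_k).

Definition wtail : 'cV[R]_m := \col_k (Num.sqrt lambda`_(d + k) * theta`_(d + k)).

Definition hlambda : 'rV[R]_d := \row_k lambda`_k.

Let sqr k : 0 < lambda`_k -> Num.sqrt lambda`_k ^+ 2 = lambda`_k.
Proof. by move=> /ltW; exact: sqr_sqrtr. Qed.

Lemma design_gram w : design x w *m (design x w)^T =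
  headmx w *m diag_mx hlambda *m (headmx w)^T + tailmx x d m w *m (tailmx x d m w)^T.
Proof.
apply/matrixP => i j; rewrite mxE [RHS]mxE.
transitivity (\sum_(k < p) (x i w)`_k * (x j w)`_k).
  by apply: eq_bigr => k _; rewrite !mxE !(tnth_nth 0).
rewrite (@sum_split _ (fun k => (x i w)`_k * (x j w)`_k) _ _ _ dm); congr (_ + _).
  rewrite mxE; apply: eq_bigr => k _.
  rewrite mul_mx_diag !mxE; have h := hd k.
  have s0 : Num.sqrt lambda`_k != 0 by rewrite gt_eqF// sqrtr_gt0.
  by rewrite -[X in _ / _ * X](sqr h); field.
by rewrite mxE; apply: eq_bigr => k _; rewrite !mxE.
Qed.

Lemma design_fit w : design x w *m colt theta =
  headmx w *m (diag_mx hlambda *m whead) +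
  zmx lambda x (fun k : 'I_m => (d + k)%N) w *m wtail.
Proof.
apply/matrixP => i j; rewrite ord1 {j} mxE [RHS]mxE.
transitivity (\sum_(k < p) (x i w)`_k * theta`_k).
  by apply: eq_bigr => k _; rewrite !mxE !(tnth_nth 0).
rewrite (@sum_split _ (fun k => (x i w)`_k * theta`_k) _ _ _ dm); congr (_ + _).
  rewrite mxE; apply: eq_bigr => k _.
  rewrite mul_diag_mx !mxE; have h := hd k.
  have s0 : Num.sqrt lambda`_k != 0 by rewrite gt_eqF// sqrtr_gt0.
  by rewrite -[X in _ * (X * _)](sqr h); field.
rewrite mxE; apply: eq_bigr => k _; rewrite !mxE; have h := tl k.
have s0 : Num.sqrt lambda`_(d + k) != 0 by rewrite gt_eqF// sqrtr_gt0.
by field.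
Qed.

Lemma head_signalE : head_signal lambda theta d = enorm whead ^+ 2.
Proof.
rewrite /head_signal /mxnorm.
have -> : ((headv d theta)^T *m invmx (mxdiag_col (headv d lambda)) *m headv d theta) 0 0
    = enorm whead ^+ 2.
  have uM : mxdiag_col (headv d lambda) \in unitmx.
    rewrite unitmxE det_diag unitfE; apply/prodf_neq0 => k _.
    by rewrite !mxE gt_eqF.
  pose y : 'cV[R]_d := \col_k (theta`_k / lambda`_k).
  have yE : mxdiag_col (headv d lambda) *m y = headv d theta.
    apply/matrixP => k j; rewrite ord1 /mxdiag_col mul_diag_mx !mxE mulrCA divff ?mulr1//.
    by rewrite gt_eqF.
  rewrite -mulmxA -{2}yE mulKmx// mxE enorm_sq; apply: eq_bigr => k _.
  by rewrite !mxE expr_div_n sqr// expr2 mulrA.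
by rewrite sqr_sqrtr// sqr_ge0.
Qed.

Lemma tail_signalE : m = (p - d)%N -> tail_signal lambda theta d = enorm wtail ^+ 2.
Proof.
move=> mE; rewrite /tail_signal /mxnorm.
have E : ((tailv d theta)^T *m mxdiag_col (tailv d lambda) *m tailv d theta) 0 0
    = enorm wtail ^+ 2.
  rewrite -mulmxA mxE enorm_sq.
  transitivity (\sum_(k < p - d) lambda`_(d + k) * theta`_(d + k) ^+ 2).
    by apply: eq_bigr => k _; rewrite /mxdiag_col mul_diag_mx !mxE expr2 mulrCA.
  by rewrite -mE; apply: eq_bigr => k _; rewrite !mxE exprMn sqr.
by rewrite E sqr_sqrtr// sqr_ge0.
Qed.

End head_tail.

Section tail_quantities.
Variables (R : realType) (p d m : nat) (lambda : p.-tuple R).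
Hypotheses (dm : (d + m = p)%N) (m0 : (0 < m)%N).
Hypothesis l0 : forall j, 0 < tnth lambda j.
Let S := \sum_(j < m) lambda`_(d + j).

Lemma tail_sumE : \sum_(d <= j < p) lambda`_j = S.
Proof.
rewrite -{1}[d]add0n big_addn; have -> : (p - d = m)%N by rewrite -dm addKn.
rewrite big_mkord.
by apply: eq_bigr => j _; rewrite addnC.
Qed.

Lemma tail_lt : (d < p)%N.
Proof. by rewrite -dm -[ltnLHS]addn0 ltn_add2l. Qed.

Lemma tail_head_gt0 : 0 < lambda`_d.
Proof. exact: nth_gt0 tail_lt. Qed.

Lemma tail_sum_ge : lambda`_d <= S.
Proof.
rewrite /S (bigD1 (Ordinal m0))//= addn0 lerDl sumr_ge0// => j _.
by apply/ltW/nth_gt0 => //; rewrite -dm ltn_add2l.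
Qed.

Lemma tail_sum_gt0 : 0 < S.
Proof. exact: lt_le_trans tail_head_gt0 tail_sum_ge. Qed.

Lemma tail_rankE : tail_rank lambda d = S / lambda`_d.
Proof. by rewrite /tail_rank tail_sumE. Qed.

Lemma tail_rank_scaleE n : lambda`_d * (tail_rank lambda d / n%:R) = S / n%:R.
Proof. by rewrite tail_rankE mulrA mulrCA divff ?mulr1// gt_eqF// tail_head_gt0. Qed.

Lemma eff_ridgeE n tau : eff_ridge lambda d n tau = tau + S / n%:R.
Proof. by rewrite /eff_ridge tail_rank_scaleE. Qed.

Lemma tail_varE n (s : R) : lambda`_d ^+ 2 / s ^+ 2 * (tail_rank lambda d ^+ 2 / n%:R ^+ 2)
  = (S / n%:R / s) ^+ 2.
Proof. by rewrite -(tail_rank_scaleE n); rewrite !expr_div_n !exprMn !exprVn; ring. Qed.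

Lemma kappa2_01 n delta tau : 0 <= tau -> 0 < delta < 1 ->
  0 <= kappa2 lambda d n delta tau <= 1.
Proof.
move=> t0 /andP[d0 d1]; rewrite /kappa2 le_max lexx orbT/= ge_max ler01 andbT.
rewrite gerBl addr_ge0//; last first.
  by rewrite mulr_ge0// divr_ge0 ?sqrtr_ge0// subr_ge0 ltW// -[ltRHS]sqrtr1 ltr_sqrt.
have Sn : 0 <= S / n%:R by rewrite divr_ge0// ltW// tail_sum_gt0.
have E : 0 <= Num.sqrt delta / (1 - Num.sqrt delta).
  by rewrite divr_ge0 ?sqrtr_ge0// subr_ge0 ltW// -[ltRHS]sqrtr1 ltr_sqrt.
apply: mulr_ge0; last by rewrite addr_ge0// mulr_ge0.
apply: mulr_ge0 => //; rewrite eff_ridgeE tail_rank_scaleE.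
by apply: divr_ge0 => //; exact: addr_ge0.
Qed.

(** Positivity forces the subtracted bracket below 1, hence each of its nonnegative parts:
    [t / s < 1/16] and [sqrt delta / (1 - sqrt delta) < 1/64]. The first gives [t <= tau], the
    second [delta < 1/4096]. *)
Lemma kappa2_gt0 n delta tau : (0 < n)%N -> 0 <= tau -> 0 < delta < 1 ->
  0 < kappa2 lambda d n delta tau -> tau + S / n%:R <= 2 * tau /\ 72 * delta <= 1.
Proof.
move=> n0 t0 /andP[d0 d1]; rewrite /kappa2 lt_max ltxx orbF eff_ridgeE tail_rank_scaleE.
have e0 : 0 < Num.sqrt delta by rewrite sqrtr_gt0.
have e1 : Num.sqrt delta < 1 by rewrite -[ltRHS]sqrtr1 ltr_sqrt.
have eE : Num.sqrt delta ^+ 2 = delta by rewrite sqr_sqrtr// ltW.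
set e := Num.sqrt delta in e0 e1 eE *.
have T0 : 0 < S / n%:R by rewrite divr_gt0 ?tail_sum_gt0// ltr0n.
set t := S / n%:R in T0 *; set s := tau + t.
have s0 : 0 < s by rewrite ltr_wpDl.
have E0 : 0 <= e / (1 - e) by apply: divr_ge0; rewrite ?subr_ge0 ltW.
have F0 : 0 <= t / s by apply: divr_ge0; rewrite ltW.
have EF := mulr_ge0 E0 F0.
rewrite subr_gt0 => H.
have [Hs He] : t / s < 1 / 16 /\ e / (1 - e) < 1 / 64.
  by move: E0 F0 EF H; set a := e / _; set b := t / s => *; split; lra.
split; first move: Hs.
  by rewrite ltr_pdivrMr// /s; lra.
move: He; rewrite ltr_pdivrMr ?subr_gt0// => h.
have : e * e <= (1 / 64) * e by rewrite ler_wpM2r ?(ltW e0)//; lra.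
by rewrite -eE expr2; lra.
Qed.
End tail_quantities.

Section good_design.
Variables (dT : measure_display) (T : measurableType dT) (R : realType).
Variables (n p d m : nat) (lambda theta : p.-tuple R) (x : 'I_n -> T -> p.-tuple R).
Variables (sigma sx delta A0 : R).
Hypotheses (n0 : (0 < n)%N) (dm : (d + m = p)%N) (d0 : (0 < d)%N) (m0 : (0 < m)%N).
Hypothesis l0 : forall j, 0 < tnth lambda j.
Hypothesis ldec : forall i j, (i <= j < p)%N -> lambda`_j <= lambda`_i.
Hypotheses (sx1 : 1 <= sx) (delta01 : 0 < delta < 1) (A00 : 0 < A0).
Hypothesis head0 : headv d theta != 0.

Let S := \sum_(j < m) lambda`_(d + j).
Let ld := lambda`_d.-1.
Let head := head_signal lambda theta d.
Let Z w := headmx d lambda x w.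
Let Zt w := zmx lambda x (fun k : 'I_m => (d + k)%N) w.

(** Condition (c) solved for the tail signal. Being positive, it can serve as the scale [b] in
    [zmx_upper]. *)
Definition tail_budget := delta / (4 * (1 + sx ^+ 2)) * (1 / ld + 4 * n%:R / S) ^- 2 * head.

Definition good_design w := [/\
  (forall y, enorm (Z w *m y) <= 3 * Num.sqrt n%:R * enorm y) /\
  (forall y, Num.sqrt n%:R * enorm y <= 3 * enorm (Z w *m y)),
  forall a, enorm (tailmx x d m w *m a) ^+ 2 <= 800 * sx ^+ 2 * S * enorm a ^+ 2,
  n%:R * S / 2 <= frob (tailmx x d m w) &
  enorm (Zt w *m wtail d m lambda theta) ^+ 2 <= 2 * (4 * sx ^+ 2) * n%:R * tail_budget].

Let nR : 0 < n%:R :> R. Proof. by rewrite ltr0n. Qed.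
Let S0 : 0 < S. Proof. exact: tail_sum_gt0. Qed.
Let ld0 : 0 < ld.
Proof. by apply: nth_gt0 => //; rewrite (leq_ltn_trans (leq_pred _))// -dm -[ltnLHS]addn0 ltn_add2l. Qed.

Lemma head_signal_gt0 : 0 < head.
Proof.
rewrite /head (head_signalE theta dm l0) lt0r sqr_ge0 andbT.
apply: contraNneq head0 => /enorm_sq_eq0 /matrixP h.
apply/eqP/matrixP => k j; rewrite !mxE.
have lk : 0 < lambda`_k by apply: nth_gt0 => //; rewrite -dm ltn_addr.
have := h k 0; rewrite !mxE => /eqP; rewrite mulf_eq0 invr_eq0 => /orP[/eqP//|].
by rewrite gt_eqF// sqrtr_gt0.
Qed.

Let c := 1 / ld + 4 * n%:R / S.
Let c0 : 0 < c. Proof. by rewrite addr_gt0 ?divr_gt0 ?mulr_gt0. Qed.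

Lemma tail_budget_gt0 : 0 < tail_budget.
Proof.
have /andP[? _] := delta01.
rewrite mulr_gt0 ?head_signal_gt0// mulr_gt0 ?invr_gt0 ?exprn_gt0//.
by rewrite divr_gt0// mulr_gt0// ltr_pwDl// sqr_ge0.
Qed.

(** [c^-1] is at most [t / 4] and at most [ld], one for each term of [c]. Taking [u = t / 4] gives
    the smallness of [f] needed above; taking [u = ld] gives [36 * 2 * delta = 72 * delta], the
    number in [kappa2_gt0]. The factor [1 + sx ^+ 2] in (c) absorbs the sub-gaussian constant. *)
Let budget_le u : 0 < u -> c^-1 <= u ->
  2 * (4 * sx ^+ 2) * n%:R * tail_budget <= 2 * delta * n%:R * u ^+ 2 * head.
Proof.
move=> u0 cu; have /andP[de0 _] := delta01.
have q0 : 0 < 1 + sx ^+ 2 by rewrite ltr_pwDl// sqr_ge0.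
have -> : 2 * (4 * sx ^+ 2) * n%:R * tail_budget =
    2 * delta * n%:R * (sx ^+ 2 / (1 + sx ^+ 2) * c^-1 ^+ 2) * head.
  by rewrite /tail_budget -/c; field; rewrite !gt_eqF.
rewrite ler_wpM2r ?(ltW head_signal_gt0)//; rewrite ler_wpM2l ?mulr_ge0 ?(ltW de0) ?(ltW nR)//.
have h : c^-1 ^+ 2 <= u ^+ 2 by rewrite ler_pXn2r ?nnegrE ?invr_ge0 ?(ltW c0) ?(ltW u0).
apply: le_trans h; rewrite ler_piMl ?sqr_ge0// ler_pdivrMr// mul1r.
by rewrite lerDr.
Qed.

Lemma good_design_risk w tau : good_design w -> 0 < tau ->
  let K := 800 * sx ^+ 2 in
  let s := tau + S / n%:R in
  let risk := ridge_risk x (colt theta) tau sigma w in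
  let kp := kappa2 lambda d n delta tau in
  [/\ risk <= ((3 * K + 1) ^+ 2 + 162 * (1 + K) ^+ 2 + 8 * K ^+ 2) *
        (head * s ^+ 2 + sigma ^+ 2 * (d%:R / n%:R + (S / n%:R / s) ^+ 2)),
      s <= 2 * A0 * ld -> (lower_const K A0)^-1 * (kp * head * s ^+ 2 +
        sigma ^+ 2 * (d%:R / n%:R + (S / n%:R / s) ^+ 2)) <= risk &
      A0 * ld <= s -> (lower_const K A0)^-1 * (kp * head * ld ^+ 2 +
        sigma ^+ 2 * (S / n%:R / s) ^+ 2) <= risk].
Proof.
move=> [[zub zlb] tub ttr fb] tau0 K s risk kp.
pose r : R := Num.sqrt n%:R; pose g := Num.sqrt (n%:R * tau).
pose t := S / n%:R; pose kap := Num.sqrt (K * (n%:R * t)).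
have nt0 : 0 < n%:R * tau by rewrite mulr_gt0.
have r0 : 0 < r by rewrite sqrtr_gt0.
have rn : r ^+ 2 = n%:R by rewrite sqr_sqrtr.
have g0 : 0 < g by rewrite sqrtr_gt0.
have gE : g ^+ 2 = n%:R * tau by rewrite sqr_sqrtr// ltW.
have t0 : 0 < t by rewrite divr_gt0.
have nt : n%:R * t = S by rewrite mulrC divfK ?gt_eqF.
have K1 : 1 <= K.
  have : 1 <= sx ^+ 2 by rewrite -[leLHS](expr1n _ 2) ler_pXn2r ?nnegrE ?(le_trans ler01 sx1).
  by rewrite /K; lra.
have K0 : 0 <= K by rewrite (le_trans ler01).
have kap0 : 0 <= kap by exact: sqrtr_ge0.
have kapt : kap ^+ 2 = K * (n%:R * t).
  by apply: sqr_sqrtr; rewrite nt mulr_ge0// ltW.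
have lge (k : 'I_d) : ld <= hlambda d lambda 0 k.
  rewrite mxE; apply: ldec; rewrite -ltnS prednK// ltn_ord/= -dm.
  by rewrite (leq_trans _ (leq_addr _ _))// prednK.
have QK : (Z w *m diag_mx (hlambda d lambda) *m (Z w)^T +
    tailmx x d m w *m (tailmx x d m w)^T + (g ^+ 2)%:M) *m resolvent_mx x tau w = 1%:M.
  by rewrite -design_gram//; exact: resolvent_mxK.
have Xub a : enorm (tailmx x d m w *m a) <= kap * enorm a.
  rewrite -(@ler_pXn2r _ 2) ?nnegrE ?mulr_ge0 ?enorm_ge0//.
  by rewrite exprMn kapt nt; exact: tub.
have Xtr : n%:R * (n%:R * t) / 2 <= frob (tailmx x d m w) by rewrite nt.
set f := Zt w *m wtail d m lambda theta in fb.
set v := whead d lambda theta.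
have hE : head = enorm v ^+ 2 by exact: (head_signalE theta dm l0).
have /andP[de0 de1] := delta01.
have ct : c^-1 <= t / 4.
  rewrite -[leRHS]invrK lef_pV2 ?posrE ?invr_gt0 ?divr_gt0//.
  rewrite /c; have -> : (t / 4)^-1 = 4 * n%:R / S by rewrite /t; field; rewrite !gt_eqF.
  by rewrite lerDr divr_ge0// ltW.
have cld : c^-1 <= ld.
  rewrite -[leRHS]invrK lef_pV2 ?posrE ?invr_gt0// /c div1r lerDl.
  by apply: divr_ge0; [exact: mulr_ge0|exact: ltW].
have v0 : 0 <= enorm v by exact: enorm_ge0.
have ft : enorm f <= r * t * enorm v.
  rewrite -(@ler_pXn2r _ 2) ?nnegrE ?enorm_ge0 ?(mulr_ge0 (mulr_ge0 (ltW r0) (ltW t0)))//.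
  apply: le_trans fb _; apply: le_trans (budget_le _ ct) _; first by rewrite divr_gt0.
  rewrite hE [leRHS]exprMn [(r * t) ^+ 2]exprMn rn ler_wpM2r ?sqr_ge0//.
  have h1 : 0 <= n%:R * t ^+ 2 by rewrite mulr_ge0 ?sqr_ge0 ?(ltW nR).
  have := ler_wpM2r h1 (ltW de1); rewrite mul1r.
  by rewrite [(t / 4) ^+ 2]expr_div_n; lra.
have kp01 : 0 <= kp <= 1 by apply: (kappa2_01 dm m0 l0 _ (ltW tau0) delta01).
have kpos : 0 < kp -> tau + t <= 2 * tau /\ 6 * enorm f <= r * ld * enorm v.
  move=> /(kappa2_gt0 dm m0 l0 n0 (ltW tau0) delta01)[h1 h2]; split => //.
  rewrite -(@ler_pXn2r _ 2) ?nnegrE ?mulr_ge0 ?enorm_ge0 ?(ltW r0) ?(ltW ld0)//.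
  rewrite exprMn; have := le_trans fb (budget_le ld0 cld) => fb2.
  rewrite [leRHS]exprMn [(r * ld) ^+ 2]exprMn rn -hE.
  have h3 : 0 <= n%:R * ld ^+ 2 * head.
    by apply: mulr_ge0; [apply: mulr_ge0; [exact: ltW|exact: sqr_ge0]|exact/ltW/head_signal_gt0].
  have := ler_wpM2r h3 h2; rewrite mul1r => h4.
  have := ler_wpM2l (sqr_ge0 (6 : R)) fb2 => h5; apply: le_trans h5 _.
  by apply: le_trans h4; lra.
have riskE : risk = n%:R^-1 * (enorm (g ^+ 2 *: (resolvent_mx x tau w *m
    (Z w *m (diag_mx (hlambda d lambda) *m v) + f))) ^+ 2 + sigma ^+ 2 *
    frob ((Z w *m diag_mx (hlambda d lambda) *m (Z w)^T +
    tailmx x d m w *m (tailmx x d m w)^T) *m resolvent_mx x tau w)).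
  by rewrite /Z /f /Zt -design_gram// -design_fit// gE.
rewrite riskE hE; split.
- exact: (risk_le sigma r0 rn g0 gE kap0 kapt K1 t0 ld0 lge QK zub zlb Xub ft).
- exact: (risk_ge_small sigma r0 rn g0 gE kap0 kapt K1 t0 ld0 lge QK zub zlb Xub Xtr kp01 A00 kpos).
- exact: (risk_ge_large sigma r0 rn g0 gE kap0 kapt K1 t0 ld0 lge QK zub zlb Xub Xtr kp01 A00 kpos).
Qed.

End good_design.

(** * From rational to real penalties *)

Section right_limits.
Variable R : realType.

Lemma right_limit_le (F G : R -> R) x : F u @[u --> x^'+] --> F x ->
  G u @[u --> x^'+] --> G x ->
  (forall e, 0 < e -> exists u, x < u < x + e /\ F u <= G u) -> F x <= G x.
Proof.
move=> cF cG h; rewrite leNgt; apply/negP => lt.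
have cD : F u - G u @[u --> x^'+] --> F x - G x by exact: cvgB.
have : \forall u \near x^'+, 0 < F u - G u by apply: cvgr_gt cD _ _; rewrite subr_gt0.
case=> e /= e0 he; have [u [/andP[xu ux] le]] := h e e0.
have : 0 < F u - G u.
  apply: he => //=; rewrite /ball/= ltr_norml; apply/andP; split; lra.
by rewrite subr_gt0 ltNge le.
Qed.

Lemma right_limit_itvcy (F : R -> R) x : {within `[0, +oo[, continuous F} -> 0 <= x ->
  F u @[u --> x^'+] --> F x.
Proof.
move=> /continuous_within_itvcyP[h1 h2]; rewrite le_eqVlt => /orP[/eqP<-//|x0].
by apply: cvg_at_right_filter; apply: h1; rewrite in_itv/= x0.
Qed.

Variables (t H D sg M1 M2 A ld : R) (F kp : R -> R).
Hypotheses (t0 : 0 < t) (A0 : 0 < A) (ld0 : 0 < ld).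
Hypothesis cF : {within `[0, +oo[, continuous F}.
Hypothesis ckp : forall x, 0 <= x -> kp u @[u --> x^'+] --> kp x.
Let s x := x + t.

Hypothesis rat_le : forall q : rat, 0 < (ratr q : R) ->
  F (ratr q) <= M2 * (H * s (ratr q) ^+ 2 + sg * (D + (t / s (ratr q)) ^+ 2)).
Hypothesis rat_ge_small : forall q : rat, 0 < (ratr q : R) -> s (ratr q) <= 2 * A * ld ->
  M1 * (kp (ratr q) * H * s (ratr q) ^+ 2 + sg * (D + (t / s (ratr q)) ^+ 2)) <= F (ratr q).
Hypothesis rat_ge_large : forall q : rat, 0 < (ratr q : R) -> A * ld <= s (ratr q) ->
  M1 * (kp (ratr q) * H * ld ^+ 2 + sg * (t / s (ratr q)) ^+ 2) <= F (ratr q).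

Let cs x : s u @[u --> x^'+] --> s x.
Proof. by apply: cvg_at_right_filter; apply: cvgD; [exact: cvg_id|exact: cvg_cst]. Qed.

Let csqr (f : R -> R) x : f u @[u --> x^'+] --> f x -> f u ^+ 2 @[u --> x^'+] --> f x ^+ 2.
Proof. by move=> cf; rewrite expr2; under eq_fun do rewrite expr2; exact: cvgM. Qed.

Let cts x : 0 <= x -> (t / s u) ^+ 2 @[u --> x^'+] --> (t / s x) ^+ 2.
Proof.
move=> x0; apply: (@csqr (fun u => t / s u)); apply: cvgM; first exact: cvg_cst.
by apply: cvgV; [rewrite gt_eqF// /s ltr_wpDl|exact: cs].
Qed.

Let rat_right (P : R -> Prop) x e : 0 <= x -> 0 < e ->
  (forall q : rat, 0 < (ratr q : R) -> x < ratr q < x + e -> P (ratr q)) ->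
  exists u, x < u < x + e /\ P u.
Proof.
move=> x0 e0 h; have : x < x + e by rewrite ltrDl.
move=> /rat_in_itvoo[q]; rewrite in_itv/= => xq.
exists (ratr q); split => //; apply: h => //; have /andP[xq' _] := xq.
exact: le_lt_trans xq'.
Qed.

(** Rationals are taken strictly to the right of [x], hence positive even for [x = 0]. In the second
    range they stay in it; in the first they may cross the threshold, which the factor 2 in
    [rat_ge_small] allows. *)
Lemma extend_bounds x : 0 <= x ->
  (s x <= A * ld -> M1 * (kp x * H * s x ^+ 2 + sg * (D + (t / s x) ^+ 2)) <= F x
    <= M2 * (H * s x ^+ 2 + sg * (D + (t / s x) ^+ 2))) /\
  (A * ld <= s x -> M1 * (kp x * H * ld ^+ 2 + sg * (t / s x) ^+ 2) <= F x).
Proof.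
move=> x0; have cFx := right_limit_itvcy cF x0.
have cV : sg * (D + (t / s u) ^+ 2) @[u --> x^'+] --> sg * (D + (t / s x) ^+ 2).
  by apply: cvgM; [exact: cvg_cst|apply: cvgD; [exact: cvg_cst|exact: cts]].
have cH : kp u * H @[u --> x^'+] --> kp x * H.
  by apply: cvgM; [exact: ckp|exact: cvg_cst].
split => [sA|sA].
  apply/andP; split.
    apply: (@right_limit_le (fun x => M1 * (kp x * H * s x ^+ 2 + sg * (D + (t / s x) ^+ 2)))) => //.
      apply: cvgM; first exact: cvg_cst; apply: cvgD => //.
      by apply: cvgM => //; exact/csqr/cs.
    move=> e e0; have Al : 0 < A * ld by rewrite mulr_gt0.
    (* A shift by less than [A * ld] keeps [s] below [2 * A * ld]. *)
    have m0 : 0 < Num.min e (A * ld) by rewrite lt_min e0.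
    have [|u [/andP[xu ux] uP]] := @rat_right (fun u => M1 * (kp u * H * s u ^+ 2 + sg * (D + (t / s u) ^+ 2)) <= F u) x _ x0 m0.
      move=> q q0 /andP[xq qx]; apply: rat_ge_small => //.
      have : x + Num.min e (A * ld) <= x + A * ld by rewrite lerD2l ge_min lexx orbT.
      by move: sA; rewrite /s; lra.
    exists u; split => //; rewrite xu/=; apply: lt_le_trans ux _.
    by rewrite lerD2l ge_min lexx.
  apply: (@right_limit_le _ (fun x => M2 * (H * s x ^+ 2 + sg * (D + (t / s x) ^+ 2)))) => //.
    apply: cvgM; first exact: cvg_cst; apply: cvgD => //.
    by apply: cvgM; [exact: cvg_cst|exact/csqr/cs].
  move=> e e0; apply: (@rat_right (fun u => F u <= M2 * (H * s u ^+ 2 + sg * (D + (t / s u) ^+ 2)))) => // q q0 _.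
  exact: rat_le.
apply: (@right_limit_le (fun x => M1 * (kp x * H * ld ^+ 2 + sg * (t / s x) ^+ 2))) => //.
  apply: cvgM; first exact: cvg_cst; apply: cvgD; first by apply: cvgM => //; exact: cvg_cst.
  by apply: cvgM; [exact: cvg_cst|exact: cts].
move=> e e0; apply: (@rat_right (fun u => M1 * (kp u * H * ld ^+ 2 + sg * (t / s u) ^+ 2) <= F u)) => // q q0 /andP[xq _].
by apply: rat_ge_large => //; move: sA; rewrite /s; lra.
Qed.

End right_limits.

Lemma kappa2_right_limit (R : realType) (p d m n : nat) (lambda : p.-tuple R) (delta x : R) :
  (d + m = p)%N -> (0 < m)%N -> (forall j, 0 < tnth lambda j) -> (0 < n)%N -> 0 <= x ->
  kappa2 lambda d n delta u @[u --> x^'+] --> kappa2 lambda d n delta x.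
Proof.
move=> dm m0 l0 n0 x0; apply: cvg_at_right_filter.
have t0 : 0 < \sum_(j < m) lambda`_(d + j) / n%:R.
  by rewrite -mulr_suml divr_gt0 ?ltr0n// (tail_sum_gt0 dm m0 l0).
have cs : eff_ridge lambda d n u @[u --> x] --> eff_ridge lambda d n x.
  by apply: cvgD; [exact: cvg_id|exact: cvg_cst].
have := @continuous_max R R (fun u => 1 -
    (16 * (lambda`_d * (tail_rank lambda d / n%:R) / eff_ridge lambda d n u)
             * (1 + 112 * (Num.sqrt delta / (1 - Num.sqrt delta)))
          + 64 * (Num.sqrt delta / (1 - Num.sqrt delta)))) (fun=> 0) x.
apply; last exact: cvg_cst.
apply: cvgB; first exact: cvg_cst.
apply: cvgD; last exact: cvg_cst.
apply: cvgM; last exact: cvg_cst.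
apply: cvgM; first exact: cvg_cst.
apply: cvgM; first exact: cvg_cst.
apply: cvgV => //; rewrite (eff_ridgeE dm m0 l0) mulr_suml gt_eqF// ltr_wpDl//.
Qed.

(** * Independence and moments in the linear model *)

Section linear_model.
Variables (d : measure_display) (T : measurableType d) (R : realType) (P : probability T R).
Variables (n p : nat) (x : 'I_n -> T -> p.-tuple R) (eps y : 'I_n -> T -> R).
Variable (theta : p.-tuple R).
Hypothesis yE : forall i w, y i w = ((colt (x i w))^T *m colt theta) 0 0 + eps i w.
Hypothesis indyx : indep_family P (fun i w => (y i w, x i w)).
Hypothesis index : forall i, independent2 P (eps i) (x i).

Let L (v : p.-tuple R) : R := ((colt v)^T *m colt theta) 0 0.

Let mL : measurable_fun setT L.
Proof.
rewrite (_ : L = fun v => \sum_j tnth v j * tnth theta j).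
  apply: measurable_sum => j; apply: measurable_funM; last exact: measurable_cst.
  exact: measurable_tnth.
by apply/funext => v; rewrite /L mxE; apply: eq_bigr => j _; rewrite !mxE.
Qed.

(** As [eps = y - L x], an event on the pair noise and design of one observation is a measurable
    event on the pair of response and design. Independence between observations and then within each
    one splits the probability completely. *)
Let factorize (B : 'I_n -> set (p.-tuple R)) (C : 'I_n -> set R) :
  (forall i, measurable (B i)) -> (forall i, measurable (C i)) ->
  P ((\bigcap_(i in [set: 'I_n]) x i @^-1` B i) `&`
     (\bigcap_(i in [set: 'I_n]) eps i @^-1` C i)) =
  ((\prod_(i < n) P (eps i @^-1` C i)) * (\prod_(i < n) P (x i @^-1` B i)))%E.
Proof.
move=> mB mC; pose E i := [set z : R * p.-tuple R | B i z.2 /\ C i (z.1 - L z.2)].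
have mE i : measurable (E i).
  have -> : E i = (snd @^-1` B i) `&` ((fun z => z.1 - L z.2) @^-1` C i) by [].
  apply: measurableI.
    by rewrite -[X in measurable X]setTI; apply: measurable_snd.
  rewrite -[X in measurable X]setTI.
  have : measurable_fun setT (fun z : R * p.-tuple R => z.1 - L z.2).
    by apply: measurable_funB => //; exact: measurableT_comp.
  exact.
have pre i : (fun w => (y i w, x i w)) @^-1` E i = eps i @^-1` C i `&` x i @^-1` B i.
  apply/seteqP; split => w /=; rewrite /E/= yE -/(L _) addrAC subrr add0r => -[]; split => //.
have <- : \bigcap_(i in [set: 'I_n]) (fun w => (y i w, x i w)) @^-1` E i =
  (\bigcap_(i in [set: 'I_n]) x i @^-1` B i) `&` (\bigcap_(i in [set: 'I_n]) eps i @^-1` C i).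
  apply/seteqP; split => [w h|w [h1 h2] i _]; last first.
    have -> : ((fun w => (y i w, x i w)) @^-1` E i) w = (eps i @^-1` C i `&` x i @^-1` B i) w by rewrite pre.
    by split; [exact: h2|exact: h1].
  by split=> i _; have := h i I; rewrite pre => -[].
rewrite indyx// -big_split; apply: eq_bigr => i _.
by rewrite pre index.
Qed.

Let prob1 S (Z : T -> S) : P (Z @^-1` setT) = 1%E.
Proof. by rewrite preimage_setT; exact: probability_setT. Qed.

Let cap1 S (Z : 'I_n -> T -> S) : \bigcap_(i in [set: 'I_n]) Z i @^-1` setT = setT.
Proof. by apply/seteqP; split. Qed.

Let prod1 S (Z : 'I_n -> T -> S) : (\prod_(i < n) P (Z i @^-1` setT) = 1)%E.
Proof. by rewrite big1// => i _; rewrite prob1. Qed.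

Lemma model_indep_design : indep_family P x.
Proof.
move=> B mB; have := @factorize B (fun=> setT) mB (fun=> measurableT).
by rewrite cap1 setIT prod1 mul1e.
Qed.

Lemma model_indep_noise : indep_family P eps.
Proof.
move=> C mC; have := @factorize (fun=> setT) C (fun=> measurableT) mC.
by rewrite cap1 setTI prod1 mule1.
Qed.

Lemma model_joint (B : 'I_n -> set (p.-tuple R)) (C : 'I_n -> set R) :
  (forall i, measurable (B i)) -> (forall i, measurable (C i)) ->
  P ((\bigcap_(i in [set: 'I_n]) x i @^-1` B i) `&`
     (\bigcap_(i in [set: 'I_n]) eps i @^-1` C i)) =
  (P (\bigcap_(i in [set: 'I_n]) x i @^-1` B i) *
   P (\bigcap_(i in [set: 'I_n]) eps i @^-1` C i))%E.
Proof.
by move=> mB mC; rewrite factorize// model_indep_design// model_indep_noise// muleC.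
Qed.

Lemma model_insample_loss tau : (0 < n)%N -> 0 < tau ->
  insample_loss x y theta tau = ridge_loss x eps (colt theta) tau.
Proof.
move=> n0 tau0; apply/funext => w.
have E : response y w = design x w *m colt theta + \col_i eps i w.
  apply/matrixP => i j; rewrite ord1 !mxE yE; congr (_ + _); rewrite mxE.
  by apply: eq_bigr => k _; rewrite !mxE.
by rewrite /insample_loss E (ridge_residual x (colt theta) n0 tau0).
Qed.

End linear_model.

Section moments.
Variables (d : measure_display) (T : measurableType d) (R : realType) (P : probability T R).

Lemma covariance_centered (f g : T -> R) : ('E_P[f] = 0)%E -> ('E_P[g] = 0)%E ->
  covariance P f g = (\int[P]_w (f w * g w)%:E)%E.
Proof.
move=> f0 g0; rewrite covariance.unlock f0 g0/= expectation.unlock.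
apply: eq_integral => w _; congr (_%:E); by rewrite -[LHS]/((f w - 0) * (g w - 0)) !subr0.
Qed.

Lemma centered_has_integral (f : T -> R) s : measurable_fun setT f ->
  ('E_P[f] = 0)%E -> ('V_P[f] = s%:E)%E ->
  has_integral P f 0 /\ has_integral P (fun w => f w ^+ 2) s.
Proof.
move=> mf f0 fs.
have h2 : has_integral P (fun w => f w ^+ 2) s.
  apply: has_integral_ge0 => [|w|]; [exact: measurable_funX|exact: sqr_ge0|].
  rewrite -fs /variance covariance_centered//.
(* The variance gives integrability of the square, hence of [f] itself by [|f| <= 1 + f^2]. *)
have [||r [fi _]] := @has_integral_bounded _ _ _ P f (fun w => 1 + f w ^+ 2) (1 + s) mf.
- by move=> w; rewrite -(ler_pM2l (ltr0n _ 2)) -[f w ^+ 2]real_normK ?num_real//; have := sqr_ge0 (`|f w|); have := sqr_ge0 (`|f w| - 1); lra.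
- apply: has_integralD => //; apply: has_integral_ge0 => //.
  by rewrite integral_cst// mul1e; exact: probability_setT.
split=> //; split=> //; rewrite -[RHS]f0 expectation.unlock.
by apply: eq_integral.
Qed.

End moments.

(** * Failure probability and conclusion *)

Definition failure_bound (R : realType) (n d : nat) (sx : R) : R :=
  2 ^+ (66 * d) * (2 * expR (- (n%:R / (128 * (4 * sx ^+ 2) ^+ 2)))) +
  (expR (- n%:R) + (expR (- (n%:R / (128 * (4 * sx ^+ 2) ^+ 2))) + expR (- n%:R))).

(** With [U = n / sx^4], the five exponentials, counted with multiplicity, are each at most
    [z = exp (- U / 4096)], and [z <= y^3] because [nu <= 1/4] and [C >= 300] make the exponent of
    [y] tiny. Then [5 y^3 <= 2 y] follows from [y < 1/2]. *)
Lemma failure_bound_le (R : realType) (n d : nat) (C sx nu : R) : (0 < n)%N -> 1 <= sx ->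
  300 <= C -> C * sx ^+ 2 * Num.sqrt (d%:R / n%:R) < 1 / 2 -> 0 < nu < 1 / 4 ->
  let y := expR (- (nu ^+ 2 * n%:R / (C ^+ 2 * sx ^+ 4))) in
  2 * y < 1 -> failure_bound n d sx <= 2 * y.
Proof.
move=> n0 sx1 C300 da /andP[nu0 nu4] y y1.
have nR : 0 < n%:R :> R by rewrite ltr0n.
have sx0 : 0 < sx by rewrite (lt_le_trans ltr01).
have C0 : 0 < C by lra.
have C2 : 0 < C ^+ 2 by rewrite exprn_gt0.
have CC : 300 * 300 <= C ^+ 2 by rewrite expr2; exact: (ler_pM (ler0n R 300) (ler0n R 300) C300 C300).
have q0 : 0 < sx ^+ 4 by rewrite exprn_gt0.
have q1 : 1 <= sx ^+ 4 by rewrite exprn_ege1.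
have [U UE] : exists U, U = n%:R / sx ^+ 4 by exists (n%:R / sx ^+ 4).
have U0 : 0 < U by rewrite UE divr_gt0.
have Un : U <= n%:R by rewrite UE ler_pdivrMr// ler_peMr// ltW.
(* Condition (a) squared gives [4 C^2 d <= U], and [4 * 300^2 = 360000] exceeds
   [66 * 4096 = 270336]: half of the rate [U / 2048] pays for the net factor [2 ^ (66 d)]. *)
have dU : 300 * 900 * d%:R + 4 * 300 * d%:R <= U.
  have s0 : 0 <= C * sx ^+ 2 * Num.sqrt (d%:R / n%:R).
    by apply: mulr_ge0; [apply: mulr_ge0; [exact: ltW|exact: sqr_ge0]|exact: sqrtr_ge0].
  have h := ler_pM s0 s0 (ltW da) (ltW da).
  have E : C * sx ^+ 2 * Num.sqrt (d%:R / n%:R) * (C * sx ^+ 2 * Num.sqrt (d%:R / n%:R)) =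
      C ^+ 2 * d%:R / U.
    rewrite mulrACA -[X in _ * X]expr2 sqr_sqrtr; last by rewrite divr_ge0.
    by rewrite UE; field; rewrite !gt_eqF.
  move: h; rewrite {}E ler_pdivrMr// => h.
  have d0 : 0 <= d%:R :> R by [].
  by have := ler_wpM2r d0 CC; lra.
have E1 : n%:R / (128 * (4 * sx ^+ 2) ^+ 2) = U / 64 / 32.
  by rewrite UE; field; rewrite gt_eqF.
have [z zE] : exists z, z = expR (- (U / 64 / 64)) by exists (expR (- (U / 64 / 64))).
have e1 : 2 ^+ (66 * d) * expR (- (U / 64 / 32)) <= z.
  have : (2 : R) ^+ (66 * d) <= expR ((66 * d)%:R).
    rewrite -[(66 * d)%:R]mulr1 expRM_natl.
    by rewrite lerXn2r ?nnegrE ?expR_ge0//; have := expR_ge1Dx (1 : R); lra.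
  move=> /(ler_wpM2r (expR_ge0 (- (U / 64 / 32)))) /le_trans; apply.
  by rewrite -expRD zE ler_expR natrM; lra.
have e2 : expR (- (U / 64 / 32)) <= z by rewrite zE ler_expR; lra.
have e3 : expR (- n%:R) <= z by rewrite zE ler_expR; lra.
have y0 : 0 < y by exact: expR_gt0.
have zy : z <= y ^+ 3.
  rewrite zE /y -expRM_natl ler_expR.
  have -> : nu ^+ 2 * n%:R / (C ^+ 2 * sx ^+ 4) = nu ^+ 2 * U / C ^+ 2.
    by rewrite UE; field; rewrite !gt_eqF.
  have nu2 : nu ^+ 2 <= 1 / 16.
    by have := ler_pM (ltW nu0) (ltW nu0) (ltW nu4) (ltW nu4); rewrite -expr2; lra.
  have h : nu ^+ 2 * U / C ^+ 2 <= U / 64 / 64 / 3.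
    rewrite ler_pdivrMr//.
    have := ler_wpM2r (ltW U0) nu2; have := ler_wpM2l (ltW U0) CC.
    by lra.
  by lra.
have yy : 5 * y ^+ 3 <= 2 * y.
  have h : y * y <= 1 / 2 * y by rewrite ler_wpM2r ?(ltW y0)//; lra.
  have := ler_wpM2r (ltW y0) h; rewrite !exprS expr0 mulr1.
  by lra.
rewrite /failure_bound E1.
by apply: le_trans yy; lra.
Qed.

Lemma countable_null (d : measure_display) (T : measurableType d) (R : realType)
  (P : probability T R) (I : countType) (Q : I -> T -> Prop) :
  (forall i, exists N, [/\ measurable N, P N = 0%E & forall w, ~ N w -> Q i w]) ->
  exists N, [/\ measurable N, P N = 0%E & forall w, ~ N w -> forall i, Q i w].
Proof.
move=> /choice[N hN].
pose M k := if unpickle k is Some i then N i else set0.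
have nM k : P.-negligible (M k).
  rewrite /M; case: unpickle => [i|]; last exact: negligible_set0.
  by have [mN N0 _] := hN i; exists (N i); split.
have [A [mA A0 MA]] := negligible_bigcup nM.
exists A; split => // w nA i; have [_ _] := hN i; apply=> Nw; apply: nA; apply: MA.
by exists (pickle i) => //; rewrite /M pickleK.
Qed.

Section good_design_probability.
Variables (dT : measure_display) (T : measurableType dT) (R : realType) (P : probability T R).
Variables (n p d m : nat) (lambda theta : p.-tuple R) (x : 'I_n -> T -> p.-tuple R).
Variables (sx delta : R).
Hypotheses (n0 : (0 < n)%N) (dm : (d + m = p)%N) (d0 : (0 < d)%N) (m0 : (0 < m)%N).
Hypothesis l0 : forall j, 0 < tnth lambda j.
Hypothesis ldec : forall i j, (i <= j)%N -> lambda`_j <= lambda`_i.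
Hypothesis mx : forall i, measurable_fun setT (x i).
Hypothesis cov : forall i j k, (\int[P]_w (tnth (x i w) j * tnth (x i w) k)%:E =
  (if j == k then tnth lambda j else 0)%:E)%E.
Hypothesis psi : forall i, psi2_vnorm P (fun w =>
  mxdiag_col (map_mx (fun l => (Num.sqrt l)^-1) (colt lambda)) *m colt (x i w)) = sx%:E.
Hypothesis indx : indep_family P x.
Hypotheses (delta01 : 0 < delta < 1) (head0 : headv d theta != 0).
Let S := \sum_(j < m) lambda`_(d + j).
Hypothesis nS : n%:R * lambda`_d <= S.
Hypothesis sparse : tail_signal lambda theta d <= tail_budget n d m lambda theta sx delta.

Lemma good_design_whp : whp P (failure_bound n d sx) (good_design d m lambda theta x sx delta).
Proof.
have p0 : (0 < p)%N by rewrite -dm addn_gt0 d0.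
have dp (j : 'I_d) : (j < p)%N by rewrite -dm ltn_addr.
have H1 := zmx_isometry n0 p0 l0 mx cov psi indx (@ord_inj d) d0 dp.
have H2 := tail_operator n0 p0 l0 mx cov psi indx m0 dm ldec nS.
have H3 := tail_trace n0 p0 l0 mx cov psi indx m0 dm.
have finj : injective (fun k : 'I_m => (d + k)%N).
  by move=> i j /addnI /ord_inj.
have tb := tail_budget_gt0 sx n0 dm m0 l0 delta01 head0.
have md : m = (p - d)%N by rewrite -dm addKn.
have H4 : whp P (expR (- n%:R)) (fun w => enorm (zmx lambda x (fun k : 'I_m => (d + k)%N) w *m
    wtail d m lambda theta) ^+ 2 <= 2 * (4 * sx ^+ 2) * n%:R * tail_budget n d m lambda theta sx delta).
  apply: (zmx_upper n0 p0 l0 mx cov psi indx finj tb).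
  by rewrite -(tail_signalE theta dm l0 md).
have := whp_and H1 (whp_and H2 (whp_and H3 H4)).
by apply: whp_imp => w [h1 [h2 [h3 h4]]]; split.
Qed.
End good_design_probability.

Lemma lower_const_gt0 (R : realType) (K A : R) : 0 <= K -> 0 < A -> 0 < lower_const K A.
Proof.
move=> K0 A0; rewrite /lower_const.
have sq (c : nat) (a : R) : 0 <= c%:R * a ^+ 2 by exact: (mulr_ge0 (ler0n _ _) (sqr_ge0 _)).
apply: ltr_wpDl; first by do 2?apply: addr_ge0; exact: sq.
apply: mulr_gt0; first exact/exprn_gt0/ltr0Sn.
by apply: exprn_gt0; apply: addr_gt0; [exact: (mulr_gt0 (ltr0Sn _ 1) A0)|exact: ltr0Sn].
Qed.

Lemma upper_const_gt0 (R : realType) (K : R) : 0 <= K ->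
  0 < (3 * K + 1) ^+ 2 + 162 * (1 + K) ^+ 2 + 8 * K ^+ 2.
Proof.
move=> K0; have sq (c : nat) (a : R) : 0 <= c%:R * a ^+ 2.
  exact: (mulr_ge0 (ler0n _ _) (sqr_ge0 _)).
rewrite -addrA; apply: ltr_wpDr; first by apply: addr_ge0; exact: sq.
apply: exprn_gt0; apply: ltr_wpDl ltr01; exact: (mulr_ge0 (ler0n _ 3) K0).
Qed.

(** The order of the quantifiers expresses what the constants depend on: [M1] and [M2] are chosen
    before the dimensions, the probability space and the data, while [eta2] is tied to the data by
    an equation. The nonzero head gives the ratio in (c) its meaning, since division by 0 yields
    0. *)
Theorem theorem4 (R : realType) :
  exists C0 : R, 0 < C0 /\
  forall sigma_x eta2 delta2 nu A0 : R,
  0 < delta2 < 1 -> 0 < nu < 1 / 4 -> 0 < A0 ->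
  exists M1 M2 : R, [/\ 0 < M1, 0 < M2 &
  forall (n p d : nat) (dT : measure_display) (T : measurableType dT)
    (P : probability T R)
    (theta lambda : p.-tuple R) (sigma : R)
    (x : 'I_n -> {RV P >-> p.-tuple R}) (eps y : 'I_n -> {RV P >-> R})
    (mse : R -> T -> R),
  let Sigma := mxdiag_col (colt lambda) in
  let Sigma_inv_half := mxdiag_col (map_mx (fun l => (Num.sqrt l)^-1) (colt lambda)) in
  let r := tail_rank lambda d in
  let ld := lambda`_d.-1 in
  let ld1 := lambda`_d in
  let s tau := eff_ridge lambda d n tau in
  (1 <= n)%N -> (1 <= d)%N -> (d < p)%N ->
  sorted (fun a b => b <= a) lambda -> (forall j, 0 < tnth lambda j) ->
  (forall i w, y i w = ((colt (x i w))^T *m colt theta) 0 0 + eps i w) ->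
  iid P (fun i w => (y i w, x i w)) ->
  (forall i, independent2 P (eps i) (x i)) ->
  (forall i j, ('E_P[fun w => tnth (x i w) j] = 0)%E) ->
  (forall i j k,
     covariance P (fun w => tnth (x i w) j) (fun w => tnth (x i w) k)
     = (Sigma j k)%:E) ->
  (forall i, ('E_P[eps i] = 0)%E) ->
  (forall i, ('V_P[eps i] = (sigma ^+ 2)%:E)%E) ->
  (forall i, psi2_vnorm P (fun w => Sigma_inv_half *m colt (x i w)) = sigma_x%:E) ->
  is_MSE_in P x y theta mse ->
  (* (a) *)
  (d <= n)%N -> C0 * sigma_x ^+ 2 * Num.sqrt (d%:R / n%:R) < 1 / 2 ->
  (* (b) *)
  eta2 = C0 * sigma_x ^+ 2
           * Num.sqrt (4 * n%:R ^+ 2 / r ^+ 2 + 2 * n%:R / r) ->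
  eta2 <= 1 / 2 ->
  (* (c) *)
  headv d theta != 0 ->
  tail_signal lambda theta d / head_signal lambda theta d
    <= delta2 / (4 * (1 + sigma_x ^+ 2))
         * (1 / ld + 4 * n%:R / \sum_(d <= j < p) lambda`_j) ^- 2 ->
  1 < r * nu ^+ 2 / (C0 ^+ 2 * sigma_x ^+ 4) ->
  exists A : set T, [/\ measurable A,
    ((1 - 2 * n%:R * expR (- (nu * Num.sqrt r / (C0 * sigma_x ^+ 2)))
        - 2 * expR (- (nu ^+ 2 * n%:R / (C0 ^+ 2 * sigma_x ^+ 4)))
        - 2 * expR (- (nu ^+ 2 * n%:R / (C0 * sigma_x ^+ 4)))
        - 12 * expR (- (n%:R / C0)))%:E <= P A)%E &
    forall w, A w -> forall tau, 0 <= tau ->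
      (s tau <= A0 * ld ->
         M1 * (kappa2 lambda d n delta2 tau * head_signal lambda theta d
                 * s tau ^+ 2
               + sigma ^+ 2 * (d%:R / n%:R
                   + ld1 ^+ 2 / s tau ^+ 2 * (r ^+ 2 / n%:R ^+ 2)))
         <= mse tau w
         <= M2 * (head_signal lambda theta d * s tau ^+ 2
               + sigma ^+ 2 * (d%:R / n%:R
                   + ld1 ^+ 2 / s tau ^+ 2 * (r ^+ 2 / n%:R ^+ 2)))) /\
      (A0 * ld <= s tau ->
         M1 * (kappa2 lambda d n delta2 tau * head_signal lambda theta d
                 * ld ^+ 2
               + sigma ^+ 2 * (ld1 ^+ 2 / s tau ^+ 2 * (r ^+ 2 / n%:R ^+ 2)))
         <= mse tau w)]].
Proof.
(* 300 is what [failure_bound_le] requires; only the inequality is kept, so that [C0] stays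
   opaque. *)
have [C0 C300] : exists C : R, 300 <= C by exists 300.
have C0gt0 : 0 < C0 by exact: (lt_le_trans (ltr0Sn R 299) C300).
exists C0; split => // sx eta2 delta nu A0 delta01 nu01 A00.
(* The constant of [tail_operator], shared by the upper and the lower bound. *)
pose K := 800 * sx ^+ 2.
have K0 : 0 <= K by exact: (mulr_ge0 (ler0n R 800) (sqr_ge0 _)).
exists (lower_const K A0)^-1, ((3 * K + 1) ^+ 2 + 162 * (1 + K) ^+ 2 + 8 * K ^+ 2).
split; [by rewrite invr_gt0 lower_const_gt0|exact: upper_const_gt0|].
move=> n p d dT T P theta lambda sigma x eps y mse Sigma Sigma_inv_half r ld ld1 s.
move=> n0 d0 dp lsort l0 yE [_ indyx] index Ex cx Eeps Veps psi [mseE msec].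
move=> dn ha hb1 hb head0 sparse hr.
pose m := (p - d)%N.
have dm : (d + m = p)%N by rewrite subnKC// ltnW.
have m0 : (0 < m)%N by rewrite subn_gt0.
have p0 : (0 < p)%N by exact: leq_ltn_trans dp.
have nR : 0 < n%:R :> R by rewrite ltr0n.
have mx i : measurable_fun setT (x i) by exact: measurable_funPT.
have me i : measurable_fun setT (eps i) by exact: measurable_funPT.
have cov i j k : (\int[P]_w (tnth (x i w) j * tnth (x i w) k)%:E =
    (if j == k then tnth lambda j else 0)%:E)%E.
  rewrite -covariance_centered// cx /Sigma /mxdiag_col !mxE.
  by case: eqVneq => // _; rewrite mulr1n.
have indx := model_indep_design yE indyx index.
have sx1 : 1 <= sx by apply: (subgauss_ge1 n0 p0 l0 mx cov psi).
have ldec i j : (i <= j)%N -> lambda`_j <= lambda`_i.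
  move=> ij; have [jp|pj] := ltnP j p; last first.
    rewrite (nth_default _ (_ : size lambda <= j)%N) ?size_tuple//.
    have [ip|pi] := ltnP i p; first exact/ltW/nth_gt0.
    by rewrite nth_default ?size_tuple.
  have trans : transitive (fun a b : R => b <= a) by move=> ? ? ? h1 /le_trans; apply.
  have refl : reflexive (fun a b : R => b <= a) by move=> ?; exact: lexx.
  apply: (sorted_leq_nth trans refl 0 lsort) => //; rewrite inE size_tuple//.
  exact: leq_ltn_trans jp.
have S0 := tail_sum_gt0 dm m0 l0.
set S := \sum_(j < m) lambda`_(d + j) in S0.
have ld10 : 0 < lambda`_d by exact: nth_gt0.
have rE : r = S / lambda`_d by exact: tail_rankE.
have r0 : 0 < r by rewrite rE divr_gt0.
have Csx : 1 <= C0 * sx ^+ 2.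
  have s1 : 1 <= sx ^+ 2 by rewrite exprn_ege1.
  by have := ler_wpM2r (le_trans ler01 s1) C300; lra.
(* As [C0 * sx ^+ 2 >= 1], condition (b) bounds the square root by 1/2, so [2 n / r <= 1/4]; in
   particular [n <= r], which is the stated inequality multiplied by the first tail eigenvalue. *)
have nS : n%:R * lambda`_d <= S.
  have X0 : 0 <= 4 * n%:R ^+ 2 / r ^+ 2 by rewrite divr_ge0 ?sqr_ge0// mulr_ge0// sqr_ge0.
  have Y0 : 0 <= n%:R / r by rewrite divr_ge0 ?(ltW r0).
  set X := 4 * n%:R ^+ 2 / r ^+ 2 + 2 * n%:R / r in hb1.
  have XE : X = 4 * n%:R ^+ 2 / r ^+ 2 + 2 * (n%:R / r) by rewrite /X mulrA.
  have Xge0 : 0 <= X by rewrite XE; lra.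
  have hX : Num.sqrt X <= 1 / 2.
    by apply: le_trans hb; rewrite hb1 ler_peMl// sqrtr_ge0.
  have X4 : X <= 1 / 4.
    by have := ler_pM (sqrtr_ge0 X) (sqrtr_ge0 X) hX hX; rewrite -expr2 sqr_sqrtr//; lra.
  have : n%:R / r <= 1 by lra.
  by rewrite ler_pdivrMr// mul1r rE ler_pdivlMr.
have hs0 := head_signal_gt0 dm l0 head0.
have sparse' : tail_signal lambda theta d <= tail_budget n d m lambda theta sx delta.
  by move: sparse; rewrite ler_pdivrMr// (tail_sumE _ dm).
have good := good_design_whp n0 dm d0 m0 l0 ldec mx cov psi indx delta01 head0 nS sparse'.
have moments i : has_integral P (eps i) 0 /\ has_integral P (fun w => eps i w ^+ 2) (sigma ^+ 2).
  exact: centered_has_integral.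
(* Positive rationals are countably many, so one null set serves them all. *)
have [N [mN N0 hN]] : exists N, [/\ measurable N, P N = 0%E & forall w, ~ N w ->
    forall q : rat, 0 < (ratr q : R) -> mse (ratr q) w = ridge_risk x (colt theta) (ratr q) sigma w].
  apply: countable_null => q.
  have [q0|q0] := ltP 0 (ratr q : R); last by exists set0; split.
  have := mseE _ (ltW q0); rewrite (model_insample_loss yE)// => ce.
  have [M [mM M0 hM]] := cond_expectation_ridge_loss n0 q0 mx me
    (model_joint yE indyx index) (model_indep_noise yE indyx index)
    (fun i => (moments i).1) (fun i => (moments i).2)
    (fun i j => integrable_coord_sqr (mx i) (cov i) j) ce.
  by exists M; split => // w nM _; exact: hM.
set y1 := expR (- (nu ^+ 2 * n%:R / (C0 ^+ 2 * sx ^+ 4))).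
have e1 : 0 <= 2 * n%:R * expR (- (nu * Num.sqrt r / (C0 * sx ^+ 2))).
  by rewrite mulr_ge0 ?expR_ge0// mulr_ge0.
have e2 := expR_ge0 (- (nu ^+ 2 * n%:R / (C0 * sx ^+ 4))).
have e3 := expR_ge0 (- (n%:R / C0)).
(* If [2 * y1 >= 1] the claimed probability is at most 0 and the empty event suffices; otherwise
   [y1 < 1/2] is available to absorb the failure bound. *)
have [y2|y2] := leP 1 (2 * y1).
  by exists set0; split => //; rewrite measure0 lee_fin; lra.
have [B [mB PB hB]] := good.
have fb := failure_bound_le n0 sx1 C300 ha nu01 y2.
exists (~` (B `|` N)); split; first by apply: measurableC; exact: measurableU.
  rewrite probability_setC; last exact: measurableU.
  have : (P (B `|` N) <= (2 * y1)%:E)%E.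
    apply: le_trans (_ : P B + P N <= _)%E; first exact: measureU2.
    by rewrite N0 adde0 (le_trans PB)// lee_fin.
  move=> h; apply: le_trans (leeB (lexx _) h).
  by rewrite -EFinB lee_fin; lra.
move=> w nBN tau tau0.
have nB : ~ B w by move=> Bw; apply: nBN; left.
have nN : ~ N w by move=> Nw; apply: nBN; right.
have gw := hB w nB; have mw := hN w nN.
have ldec' i j : (i <= j < p)%N -> lambda`_j <= lambda`_i by move=> /andP[/ldec].
have t0 : 0 < S / n%:R by rewrite divr_gt0.
have ld0 : 0 < ld by apply: nth_gt0 => //; exact: leq_ltn_trans (leq_pred _) dp.
have ckp u : 0 <= u -> kappa2 lambda d n delta v @[v --> u^'+] --> kappa2 lambda d n delta u.
  exact: (kappa2_right_limit dm m0 l0 n0).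
have gr q q0 := good_design_risk sigma (tau := ratr q) n0 dm d0 m0 l0 ldec' sx1 delta01 A00 head0 gw q0.
have [|||h1 h2] := extend_bounds (H := head_signal lambda theta d) (D := d%:R / n%:R)
  (sg := sigma ^+ 2) (M1 := (lower_const K A0)^-1)
  (M2 := (3 * K + 1) ^+ 2 + 162 * (1 + K) ^+ 2 + 8 * K ^+ 2) t0 A00 ld0 (msec w) ckp _ _ _ tau0.
- by move=> q q0; rewrite mw//; have [] := gr q q0.
- by move=> q q0; rewrite mw//; have [_ h _] := gr q q0.
- by move=> q q0; rewrite mw//; have [_ _ h] := gr q q0.
by rewrite /s (eff_ridgeE dm m0 l0) (tail_varE dm m0 l0).
Qed.
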